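(* Let $V:\mathbb{T}\to\mathbb{R}$ be $\mathcal{C}^\infty$, let $A,B,X,Z$ be the infinite matrices indexed by $\mathbb{Z}\times\mathbb{Z}$ $$A(m,n)=|m|^2\delta_{m,n},\qquad B(m,n)=\hat V(m-n),$$ $$X(m,n)=\frac{\hat V(m-n)}{i(|m|^2-|n|^2)}\ \text{ if } m\neq\pm n,\qquad X(m,n)=0\ \text{ if } m=\pm n,$$ $$Z(m,n)=B(m,n)\ \text{ if } m=\pm n,\qquad Z(m,n)=0\ \text{ if } m\neq\pm n,$$ and let $R$ be defined by $e^{iX}(A+B)e^{-iX}=A+Z+R$. Then the Lie splitting method $e^{i\tau(A+Z)}e^{i\tau R}$ approximating $e^{i\tau(A+Z+R)}$ converges without loss of derivative: for every $s\geq0$ there is a constant $C$ such that for $\tau$ small enough and all $x\in h^s$, $$\|e^{i\tau(A+Z+R)}x-e^{i\tau(A+Z)}e^{i\tau R}x\|_s\leq C\tau^2\|x\|_s.$$ As a consequence, the scheme $e^{-iX}e^{i\tau(A+Z)}e^{i\tau R}e^{iX}$ defines an order $1$ scheme without loss of derivative for the equation $\dot x=i(A+B)x$: for every $s\geq0$ there is a constant $C$ independent of $x$ such that for $\tau$ small enough and all $x\in h^s$, $$\|e^{i\tau(A+B)}x-e^{-iX}e^{i\tau(A+Z)}e^{i\tau R}e^{iX}x\|_s\leq C\tau^2\|x\|_s.$$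
   Context: $\mathbb{T}=\mathbb{R}/2\pi\mathbb{Z}$, and $\hat V(k)=\frac{1}{2\pi}\int_{\mathbb{T}}e^{-ikx}V(x)\,\mathrm{d}x$. For $s\in\mathbb{R}$, $h^s$ is the space of complex sequences indexed by $\mathbb{Z}$ with $\|x\|_s=\big(\sum_{k\in\mathbb{Z}}(1+|k|)^{2s}|x_k|^2\big)^{1/2}<\infty$. Infinite matrices act on sequences by $(Ax)_m=\sum_{n\in\mathbb{Z}}A(m,n)x_n$. The equation $\dot x=i(A+B)x$ is the Schrödinger equation $\partial_tu=-i\Delta u+iV(x)u$ on $\mathbb{T}$ written for the Fourier coefficients $x=\hat u$. For $H\in\{A+B,\,A+Z,\,A+Z+R,\,R\}$, $e^{i\tau H}$ denotes the flow at time $\tau$ of $\dot x=iHx$; $X$ is a bounded operator on every $h^s$ and $e^{\pm iX}$ is its exponential. *)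

(* Defs.v *)
From HB Require Import structures.
From mathcomp Require Import all_boot all_order all_algebra.
From mathcomp Require Import complex.
From mathcomp Require Import all_classical all_reals all_analysis.

Set Implicit Arguments.
Unset Strict Implicit.
Unset Printing Implicit Defensive.

Import Order.TTheory GRing.Theory Num.Theory.
Import numFieldNormedType.Exports.

Local Open Scope classical_set_scope.
Local Open Scope ring_scope.
Local Open Scope complex_scope.

(* R[i] carries no normed R-module structure here, so limits, derivatives and
   integrals of complex-valued functions are taken on real and imaginary
   parts. *)
Definition climn {R : realType} (u : nat -> R[i]) : R[i] :=
  limn (fun n => complex.Re (u n)) +i* limn (fun n => complex.Im (u n)).

Definition is_cderive {R : realType} (f : R -> R[i]) (t : R) (d : R[i]) : Prop :=
  is_derive t (1 : R) (fun r => complex.Re (f r)) (complex.Re d) /\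
  is_derive t (1 : R) (fun r => complex.Im (f r)) (complex.Im d).

Definition cintegral {R : realType} (D : set R) (f : R -> R[i]) : R[i] :=
  (\int[lebesgue_measure]_(x in D) complex.Re (f x)) +i*
  (\int[lebesgue_measure]_(x in D) complex.Im (f x)).

Definition cexpi {R : realType} (t : R) : R[i] := cos t +i* sin t.

(* A function on R / 2 pi Z is a 2 pi-periodic function on R. *)
Definition torus_fun {R : realType} (V : R -> R) : Prop :=
  forall x, V (x + 2 * pi) = V x.

Definition smooth {R : realType} (V : R -> R) : Prop :=
  forall (n : nat) (x : R), derivable (derive1n n V) x 1.

Definition fourier {R : realType} (V : R -> R) (k : int) : R[i] :=
  ((2 * pi)^-1)%:C *
  cintegral `[0, 2 * pi] (fun x => cexpi (- (k%:~R * x)) * (V x)%:C).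

Section Sequences.
Context {R : realType}.

Definition zseq := int -> R[i].
Definition zmatrix := int -> int -> R[i].
Definition zoperator := zseq -> zseq.

(* Extended-real valued: x belongs to h^s iff hnorm s x is finite. *)
Definition hnorm (s : R) (x : zseq) : \bar R :=
  ((\esum_(k in [set: int])
      ((1 + `|k|%:~R) `^ (2 * s) * (ComplexField.Normc.normc (x k)) ^+ 2)%:E)
   `^ (2^-1)%R)%E.

Definition in_hs (s : R) : set zseq := [set x | (hnorm s x < +oo)%E].

(* Limit of symmetric partial sums; the sums over Z taken below on elements of
   h^s converge absolutely when V is smooth. *)
Definition zsum (f : zseq) : R[i] :=
  climn (fun N => \sum_(i < N.*2.+1) f (i%:Z - N%:Z)).

Definition matact (M : zmatrix) : zoperator :=
  fun x m => zsum (fun n => M m n * x n).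

Definition scaleop (c : R[i]) (T : zoperator) : zoperator :=
  fun x k => c * T x k.

(* The exponential series applied to x, summed in each coordinate; for T bounded
   on h^s this is the value at x of the norm-convergent series. *)
Definition expop (T : zoperator) : zoperator :=
  fun x k => climn (fun N => \sum_(j < N) (j`!%:R)^-1 * iter j T x k).

(* The equation is read coordinatewise, for curves that are continuous in
   l^2 = h^0; this makes sense for x in h^s with s >= 0, on which A only takes
   values in h^(s-2). *)
Definition is_solution (H : zoperator) (x : zseq) (u : R -> zseq) : Prop :=
  [/\ u 0 = x,
      forall t, in_hs 0 (u t),
      forall t, hnorm 0 (fun k => u r k - u t k) @[r --> t] --> 0%E
    & forall t k, is_cderive (fun r => u r k) t ('i%C * H (u t) k)].

(* The value at time tau of the solution of x' = i H x issued from x; the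
   default value 0 is only used when there is no solution. *)
Definition flow (H : zoperator) (tau : R) : zoperator :=
  fun x => xget (fun _ _ => 0) [set u | is_solution H x u] tau.

End Sequences.

Arguments zseq R : clear implicits.
Arguments zmatrix R : clear implicits.
Arguments zoperator R : clear implicits.

Section Operators.
Context {R : realType}.
Variable V : R -> R.

Definition matA : zmatrix R := fun m n => (`|m| ^+ 2)%:~R * (m == n)%:R.

Definition matB : zmatrix R := fun m n => fourier V (m - n).

Definition matX : zmatrix R := fun m n =>
  if (m == n) || (m == - n) then 0
  else fourier V (m - n) / ('i%C * (`|m| ^+ 2 - `|n| ^+ 2)%:~R).

Definition matZ : zmatrix R := fun m n =>
  if (m == n) || (m == - n) then matB m n else 0.

Definition opA : zoperator R := matact matA.
Definition opB : zoperator R := matact matB.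
Definition opX : zoperator R := matact matX.
Definition opZ : zoperator R := matact matZ.

Definition expiX : zoperator R := expop (scaleop 'i%C opX).
Definition expNiX : zoperator R := expop (scaleop (- 'i%C) opX).

(* Solves exp(iX) (A + B) exp(-iX) = A + Z + R for R. The products make sense
   coordinatewise on every h^s: A + B maps h^s to h^(s-2), on which exp(iX)
   acts. *)
Definition opR : zoperator R :=
  (expiX \o (opA + opB) \o expNiX) - (opA + opZ).

End Operators.

(* Main.v *)
Require Import Defs.
From HB Require Import structures.
From mathcomp Require Import all_boot all_order all_algebra.
From mathcomp Require Import complex ring lra zify.
From mathcomp Require Import all_classical all_reals all_analysis.
Import Order.TTheory GRing.Theory Num.Theory.
Import numFieldNormedType.Exports.
Import ComplexField.Normc.
Set Implicit Arguments.
Unset Strict Implicit.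
Unset Printing Implicit Defensive.
Local Open Scope classical_set_scope.
Local Open Scope ring_scope.
Local Open Scope complex_scope.

(** Why the theorem is true.  Write <k> = 1 + |k|.  The whole argument is
    carried out on matrix entries, with the help of moderate weights: functions
    w on Z with w p <= <m - p>^N w m, such as constants, <k>^N and <k - n>^-N.
    A matrix with rapidly decreasing off-diagonal entries maps sequences bounded
    by w to sequences bounded by a multiple of w, and the constant depends on N
    only (tame_matact).  Conversely, such a bound applied to the basis vector at
    n with the weight <k - n>^-N gives back the decay of the entries
    (tame_kbound).  Operators of this kind are closed under composition and
    bounded on h^s for all s >= 0 by a Schur test (kernel_hnorm_le), so that an
    entrywise estimate is enough for the theorem, and scalar calculus is enough
    for the estimates.

    The structure of the problem enters in three ways.  As V is smooth, its
    Fourier coefficients decrease rapidly (fourier_decay), so B and Z are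
    bounded; as |m|^2 - |n|^2 = (m - n)(m + n), the entries of X carry an
    additional factor of size 1 / <m>.  For the same reason a commutator with A
    costs only one power of <m>, although A has order two (tame_commA).  And X
    is chosen so that i(AX - XA) = B - Z; therefore, writing
    exp(iX) = 1 + iX + G where G gains two powers (expop_second_order), the terms
    of order zero of exp(iX)(A + B) - (A + Z)exp(iX) cancel and the rest gains
    one power.  Composed with exp(-iX) this is R, hence R gains one power
    (tame_opR) and the commutator of A + Z with R is bounded: no derivative is
    lost.

    In the interaction picture the phases exp(i t |m|^2) do not change moduli, so
    a coordinatewise mean value inequality yields a Gronwall lemma in weighted
    sup norms (gronwall), hence uniqueness of the flows; their existence comes
    from Dyson series (dyson_spec), whose sum has entries with rapid decay.  Two
    applications of the Gronwall lemma give the result.  If S, SF and SR are the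
    flows of A + Z + R, A + Z and R, then SF_t R - R SF_t solves the equation of
    A + Z with the bounded commutator as a source, and is O(t)
    (commutator_estimate); then S_t - SF_t SR_t solves the equation of A + Z + R
    with this O(t) quantity as a source, and is O(t^2) (lie_local_error).  For the
    second claim, exp(-iX) intertwines the flow of A + Z + R with that of A + B
    (conjugated_flow) and is bounded on h^s. *)

(** * Modulus and convergence of complex numbers *)

Section ComplexNorm.
Context {R : realType}.
Implicit Types (z w : R[i]) (t : R).

Lemma normc_ge0 z : 0 <= normc z.
Proof. by case: z => a b; rewrite sqrtr_ge0. Qed.

Lemma normc_eq0 z : (normc z == 0) = (z == 0).
Proof.
by apply/eqP/eqP => [/eq0_normc//|->]; rewrite normc0.
Qed.

Lemma normcD z w : normc (z + w) <= normc z + normc w.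
Proof. exact: le_normcD. Qed.

Lemma normc_opp z : normc (- z) = normc z.
Proof. exact: normcN. Qed.

Lemma normcB z w : normc (z - w) <= normc z + normc w.
Proof. by rewrite -(normc_opp w) normcD. Qed.

Lemma normc_distC z w : normc (z - w) = normc (w - z).
Proof. by rewrite -normc_opp opprB. Qed.

Lemma normc_dist_triangle u z w : normc (z - w) <= normc (z - u) + normc (u - w).
Proof. by apply: le_trans (normcD _ _); rewrite addrA subrK. Qed.

Lemma normc_real t : normc t%:C = `|t|.
Proof. by rewrite /= expr0n addr0 sqrtr_sqr. Qed.

Lemma normc_nat n : normc (n%:R : R[i]) = n%:R.
Proof.
have -> : (n%:R : R[i]) = (n%:R : R)%:C by rewrite rmorph_nat.
by rewrite normc_real ger0_norm.
Qed.

Lemma normc_int (m : int) : normc (m%:~R : R[i]) = `|m%:~R|.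
Proof.
have -> : (m%:~R : R[i]) = (m%:~R : R)%:C by rewrite rmorph_int.
by rewrite normc_real.
Qed.

Lemma normc_i : normc ('i%C : R[i]) = 1.
Proof. by rewrite /= expr0n expr1n add0r sqrtr1. Qed.

Lemma normc_cexpi t : normc (cexpi t) = 1.
Proof. by rewrite /= cos2Dsin2 sqrtr1. Qed.

Lemma cexpi0 : cexpi 0 = 1 :> R[i].
Proof. by rewrite /cexpi cos0 sin0. Qed.

Lemma cexpiD s t : cexpi (s + t) = cexpi s * cexpi t :> R[i].
Proof.
rewrite /cexpi cosD sinD.
by apply/eqP; rewrite eq_complex /= eqxx (addrC (sin s * cos t)) eqxx.
Qed.

Lemma cexpiN t : cexpi (- t) * cexpi t = 1 :> R[i].
Proof. by rewrite -cexpiD addNr cexpi0. Qed.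

Lemma ler_Re_normc z : `|complex.Re z| <= normc z.
Proof.
by case: z => a b /=; rewrite -sqrtr_sqr ler_wsqrtr// lerDl sqr_ge0.
Qed.

Lemma ler_Im_normc z : `|complex.Im z| <= normc z.
Proof.
by case: z => a b /=; rewrite -sqrtr_sqr ler_wsqrtr// lerDr sqr_ge0.
Qed.

Lemma normc_le_ReIm z : normc z <= `|complex.Re z| + `|complex.Im z|.
Proof.
case: z => a b /=; rewrite -[leRHS]ger0_norm ?addr_ge0// -sqrtr_sqr.
rewrite ler_wsqrtr// sqrrD !real_normK ?num_real// lerD2r lerDl.
by rewrite mulrn_wge0// mulr_ge0.
Qed.

Lemma normc_sum I (r : seq I) (P : pred I) (f : I -> R[i]) :
  normc (\sum_(i <- r | P i) f i) <= \sum_(i <- r | P i) normc (f i).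
Proof.
elim/big_ind2 : _ => //; first by rewrite normc0.
by move=> a b c d ab cd; rewrite (le_trans (normcD _ _))// lerD.
Qed.

Lemma Re_sum I (r : seq I) (P : pred I) (f : I -> R[i]) :
  complex.Re (\sum_(i <- r | P i) f i) = \sum_(i <- r | P i) complex.Re (f i).
Proof.
by apply: big_morph => // -[a b] [u v].
Qed.

Lemma Im_sum I (r : seq I) (P : pred I) (f : I -> R[i]) :
  complex.Im (\sum_(i <- r | P i) f i) = \sum_(i <- r | P i) complex.Im (f i).
Proof.
by apply: big_morph => // -[a b] [u v].
Qed.

End ComplexNorm.

Section ComplexLimit.
Context {R : realType}.

(** The same limits as those taken on real and imaginary parts (ccvg_ReIm,
    ccvg_climn), in a form that is compatible with moduli and products. *)
Definition ccvg {I : Type} (F : set_system I) (u : I -> R[i]) (l : R[i]) :=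
  forall e : R, 0 < e -> \forall i \near F, normc (u i - l) <= e.

Section Filter.
Context {I : Type} (F : set_system I) {FF : Filter F}.
Implicit Types (u v : I -> R[i]) (a b c : R[i]).

Lemma ccvg_cst c : ccvg F (fun=> c) c.
Proof. by move=> e e0; apply: nearW => i; rewrite subrr normc0 ltW. Qed.

Lemma ccvgD u v a b : ccvg F u a -> ccvg F v b ->
  ccvg F (fun i => u i + v i) (a + b).
Proof.
move=> ua vb e e0; have e2 : 0 < e / 2 by rewrite divr_gt0.
near=> i.
have -> : u i + v i - (a + b) = (u i - a) + (v i - b) by ring.
rewrite (le_trans (normcD _ _))// [leRHS](splitr e) lerD//.
- by near: i; exact: ua.
- by near: i; exact: vb.
Unshelve. all: by end_near. Qed.

Lemma ccvgZ c u a : ccvg F u a -> ccvg F (fun i => c * u i) (c * a).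
Proof.
move=> ua e e0.
have c0 : 0 < normc c + 1 by rewrite ltr_wpDl// normc_ge0.
have ec : 0 < e / (normc c + 1) by rewrite divr_gt0.
near=> i; rewrite -mulrBr normcM.
apply: (@le_trans _ _ ((normc c + 1) * normc (u i - a))).
  by rewrite ler_wpM2r ?normc_ge0// lerDl.
by rewrite -ler_pdivlMl// mulrC; near: i; exact: ua.
Unshelve. all: by end_near. Qed.

Lemma ccvg_near_eq u v a : (\forall i \near F, u i = v i) ->
  ccvg F u a -> ccvg F v a.
Proof.
by move=> uv ua e /ua; apply: filterS2 uv => i ->.
Qed.

Lemma ccvg_sub u a : ccvg F (fun i => u i - a) 0 <-> ccvg F u a.
Proof.
by split=> ua e /ua; apply: filterS => i; rewrite subr0.
Qed.

Lemma ccvg_bounded u a : ccvg F u a ->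
  \forall i \near F, normc (u i) <= normc a + 1.
Proof.
move=> /(_ 1 ltr01); apply: filterS => i uia.
have {1}-> : u i = a + (u i - a) by rewrite addrC subrK.
by rewrite (le_trans (normcD _ _))// lerD2l.
Qed.

Lemma ccvgM u v a b : ccvg F u a -> ccvg F v b ->
  ccvg F (fun i => u i * v i) (a * b).
Proof.
move=> ua vb.
suff H : ccvg F (fun i => (u i - a) * v i) 0.
  have := ccvgD H (ccvgZ a vb); rewrite add0r.
  by under eq_fun do rewrite mulrBl subrK.
have [C C0 hC] : exists2 C, 0 < C & \forall i \near F, normc (v i) <= C.
  exists (normc b + 1); first by rewrite ltr_wpDl// normc_ge0.
  exact: ccvg_bounded.
move=> e e0; have eC : 0 < e / C by rewrite divr_gt0.
near=> i; rewrite subr0 normcM -[e](divfK (lt0r_neq0 C0)).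
apply: ler_pM; rewrite ?normc_ge0//.
- by near: i; exact: ua.
- by near: i.
Unshelve. all: by end_near. Qed.

Lemma ccvg_Re u a : ccvg F u a -> (fun i => complex.Re (u i)) @ F --> complex.Re a.
Proof.
move=> ua; apply/cvgrPdist_le => e /ua; apply: filterS => i.
rewrite normc_distC; apply: le_trans.
by case: a {ua} => a a'; case: (u i) => b b'; exact: (ler_Re_normc (_ +i* _)).
Qed.

Lemma ccvg_Im u a : ccvg F u a -> (fun i => complex.Im (u i)) @ F --> complex.Im a.
Proof.
move=> ua; apply/cvgrPdist_le => e /ua; apply: filterS => i.
rewrite normc_distC; apply: le_trans.
by case: a {ua} => a a'; case: (u i) => b b'; exact: (ler_Im_normc (_ +i* _)).
Qed.

Lemma ccvg_ReIm u a : (fun i => complex.Re (u i)) @ F --> complex.Re a ->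
  (fun i => complex.Im (u i)) @ F --> complex.Im a -> ccvg F u a.
Proof.
move=> /cvgrPdist_le ur /cvgrPdist_le ui e e0.
have e2 : 0 < e / 2 by rewrite divr_gt0.
near=> i; rewrite normc_distC (le_trans (normc_le_ReIm _))//.
have [/= ur' ui'] : `|complex.Re a - complex.Re (u i)| <= e / 2 /\
         `|complex.Im a - complex.Im (u i)| <= e / 2.
  by split; near: i; [exact: ur|exact: ui].
rewrite [leRHS](splitr e).
by move: ur' ui'; case: (a) => a1 a2; case: (u i) => b1 b2 /= *; exact: lerD.
Unshelve. all: by end_near. Qed.

End Filter.

Lemma ccvg_unique I (F : set_system I) {FF : ProperFilter F} (u : I -> R[i]) a b :
  ccvg F u a -> ccvg F u b -> a = b.
Proof.
move=> ua ub; apply/eqP; rewrite -subr_eq0 -normc_eq0.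
rewrite eq_le normc_ge0 andbT; apply/ler_addgt0Pl => e e0; rewrite addr0.
have e2 : 0 < e / 2 by rewrite divr_gt0.
near F => i; rewrite (le_trans (normc_dist_triangle (u i) _ _))//.
rewrite [leRHS](splitr e) lerD//; first rewrite normc_distC.
- by near: i; exact: ua.
- by near: i; exact: ub.
Unshelve. all: by end_near. Qed.

Lemma ccvg_normc_le I (F : set_system I) {FF : ProperFilter F} (u : I -> R[i]) a c :
  ccvg F u a -> (\forall i \near F, normc (u i) <= c) -> normc a <= c.
Proof.
move=> ua uc; apply/ler_addgt0Pl => e e0; near F => i.
have -> : a = (a - u i) + u i by rewrite subrK.
rewrite (le_trans (normcD _ _))// lerD//; last by near: i.
by rewrite normc_distC; near: i; exact: ua.
Unshelve. all: by end_near. Qed.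

Lemma ccvg_climn (u : nat -> R[i]) l : ccvg \oo u l -> climn u = l.
Proof.
move=> ul; rewrite /climn (cvg_lim _ (ccvg_Re ul))//.
by rewrite (cvg_lim _ (ccvg_Im ul))//; case: l {ul}.
Qed.

End ComplexLimit.

(** * Derivatives of complex-valued curves *)

Section ComplexDerivative.
Context {R : realType}.
Implicit Types (f g : R -> R[i]) (t r : R) (c d : R[i]).

Lemma is_derive1P (f : R -> R) t (d : R) :
  is_derive t (1 : R) f d <-> h^-1 * (f (h + t) - f t) @[h --> (0:R)^'] --> d.
Proof.
have E : (fun h => h^-1 *: (f (h *: (1 : R) + t) - f t)) =
         (fun h => h^-1 * (f (h + t) - f t)).
  by apply/funext => h; rewrite [h *: _]mulr1.
split=> [[df <-]|df].
  by move: df; rewrite /derivable /derive E.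
apply: DeriveDef; first by rewrite /derivable E; apply/cvg_ex; exists d.
by rewrite /derive E; exact: cvg_lim.
Qed.

(** Difference quotients turn term by term differentiation into the exchange
    of a limit and a sum. *)
Lemma is_cderiveP f t d :
  is_cderive f t d <->
  ccvg (0 : R)^' (fun h : R => (h^-1)%:C * (f (h + t) - f t)) d.
Proof.
have ReE h : complex.Re ((h^-1)%:C * (f (h + t) - f t)) =
    h^-1 * (complex.Re (f (h + t)) - complex.Re (f t)).
  by case: (f (h + t)) => a b; case: (f t) => u v /=; ring.
have ImE h : complex.Im ((h^-1)%:C * (f (h + t) - f t)) =
    h^-1 * (complex.Im (f (h + t)) - complex.Im (f t)).
  by case: (f (h + t)) => a b; case: (f t) => u v /=; ring.
split=> [[/is_derive1P dr /is_derive1P di]|df].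
- apply: ccvg_ReIm; first by under eq_fun do rewrite ReE.
  by under eq_fun do rewrite ImE.
- split; apply/is_derive1P.
  + by move/ccvg_Re : df; rewrite (funext ReE).
  + by move/ccvg_Im : df; rewrite (funext ImE).
Qed.

Lemma ccvg_dnbhs0 : ccvg (0 : R)^' (fun h => h%:C) 0.
Proof.
move=> e e0; near=> h; rewrite subr0 normc_real.
by near: h; exact: dnbhs0_le.
Unshelve. all: by end_near. Qed.

Lemma is_cderive_ccvg0 f t d : is_cderive f t d ->
  ccvg (0 : R)^' (fun h : R => f (h + t)) (f t).
Proof.
move=> /is_cderiveP df; apply/ccvg_sub.
have /(_ _) := ccvgM ccvg_dnbhs0 df; rewrite mul0r => H; apply: ccvg_near_eq H.
near=> h; rewrite mulrA -rmorphM mulfV ?mul1r//.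
by near: h; exact: nbhs_dnbhs_neq.
Unshelve. all: by end_near. Qed.

Lemma is_cderive_continuous f t d : is_cderive f t d -> ccvg (nbhs t) f (f t).
Proof.
move=> [[fr _] [fi _]]; apply: ccvg_ReIm.
- by apply: (differentiable_continuous (f := fun r => complex.Re (f r)));
    exact/derivable1_diffP.
- by apply: (differentiable_continuous (f := fun r => complex.Im (f r)));
    exact/derivable1_diffP.
Qed.

Lemma is_cderive_cst c t : is_cderive (fun=> c) t 0.
Proof.
apply/is_cderiveP; under eq_fun do rewrite subrr mulr0.
exact: ccvg_cst.
Qed.

Lemma is_cderive_eq (f : R -> R[i]) t (d d' : R[i]) :
  is_cderive f t d -> d = d' -> is_cderive f t d'.
Proof. by move=> + <-. Qed.

Lemma is_cderiveD f g t c d : is_cderive f t c -> is_cderive g t d ->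
  is_cderive (fun r => f r + g r) t (c + d).
Proof.
move=> /is_cderiveP fc /is_cderiveP gd; apply/is_cderiveP.
have /(_ _) := ccvgD fc gd; under eq_fun do rewrite -mulrDr.
by under [X in _ -> ccvg _ X _]eq_fun do rewrite opprD addrACA.
Qed.

Lemma is_cderiveM f g t c d : is_cderive f t c -> is_cderive g t d ->
  is_cderive (fun r => f r * g r) t (c * g t + f t * d).
Proof.
move=> fc gd; have fct := is_cderive_ccvg0 fc.
move: fc gd => /is_cderiveP fc /is_cderiveP gd; apply/is_cderiveP.
apply: ccvg_near_eq (ccvgD (ccvgM fc (ccvg_cst _)) (ccvgM fct gd)).
by apply: nearW => h; ring.
Qed.

Lemma is_cderiveZ k f t c : is_cderive f t c ->
  is_cderive (fun r => k * f r) t (k * c).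
Proof.
by move=> fc; have := is_cderiveM (is_cderive_cst k t) fc; rewrite mul0r add0r.
Qed.

Lemma is_cderiveB f g t c d : is_cderive f t c -> is_cderive g t d ->
  is_cderive (fun r => f r - g r) t (c - d).
Proof.
move=> fc /(is_cderiveZ (-1)); rewrite mulN1r => gd.
by have := is_cderiveD fc gd; under eq_fun do rewrite mulN1r.
Qed.

Lemma is_derive1_mull (l t : R) : is_derive t (1:R) (fun r : R => l * r) l.
Proof.
have /(_ _ (is_derive_id t 1)) := @is_deriveZ _ _ _ (@id R) l t (1:R).
by rewrite [l *: _]mulr1.
Qed.

Lemma is_cderive_cexpi (l t : R) :
  is_cderive (fun r => cexpi (l * r)) t ('i%C * l%:C * cexpi (l * t)).
Proof.
have dl := is_derive1_mull l t.
split=> /=.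
- apply: is_derive_eq (@is_derive1_comp R cos _ t _ _ (is_derive_cos _) dl) _.
  by rewrite /=; ring.
- apply: is_derive_eq (@is_derive1_comp R sin _ t _ _ (is_derive_sin _) dl) _.
  by rewrite /=; ring.
Qed.

Lemma derive_dist_le (f g df dg : R -> R) (a b : R) : a <= b ->
  (forall r, a <= r <= b -> is_derive r (1:R) f (df r)) ->
  (forall r, a <= r <= b -> is_derive r (1:R) g (dg r)) ->
  (forall r, a <= r <= b -> `|df r| <= dg r) ->
  `|f b - f a| <= g b - g a.
Proof.
move=> ab fd gd fg.
have incr (h dh : R -> R) : (forall r, a <= r <= b -> is_derive r (1:R) h (dh r)) ->
    (forall r, a <= r <= b -> 0 <= dh r) -> h a <= h b.
  move=> hd h0; rewrite -subr_ge0.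
  have [| |c cab ->] := @MVT_segment R h dh a b ab.
  - by move=> r; rewrite in_itv/= => /andP[ar rb]; apply: hd; rewrite !ltW.
  - apply: derivable_within_continuous => r; rewrite in_itv/= => rab.
    by have [] := hd r rab.
  - by rewrite mulr_ge0 ?subr_ge0// h0//; move: cab; rewrite in_itv.
rewrite ler_norml; apply/andP; split.
- suff : g a + f a <= g b + f b by move=> H; lra.
  apply: (incr (fun r => g r + f r) (fun r => dg r + df r)) => r rab.
  + exact: is_deriveD (gd r rab) (fd r rab).
  + by have := fg r rab; rewrite ler_norml => /andP[]; lra.
- suff : g a - f a <= g b - f b by move=> H; lra.
  apply: (incr (fun r => g r - f r) (fun r => dg r - df r)) => r rab.
  + exact: is_deriveB (gd r rab) (fd r rab).
  + by have := fg r rab; rewrite ler_norml => /andP[]; lra.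
Qed.

Lemma is_cderive_opp f t d : is_cderive f (- t) d ->
  is_cderive (fun r => f (- r)) t (- d).
Proof.
have dN : is_derive t (1:R) (fun r : R => - r) (-1) := is_deriveNid t (1:R).
case=> fr fi; split.
- apply: is_derive_eq (is_derive1_comp (f := fun r => complex.Re (f r)) fr dN) _.
  by case: (d) => a b /=; rewrite mulrN1.
- apply: is_derive_eq (is_derive1_comp (f := fun r => complex.Im (f r)) fi dN) _.
  by case: (d) => a b /=; rewrite mulrN1.
Qed.

(** Mean value inequality by comparison with a real function.  The factor 2
    comes from bounding real and imaginary parts separately; a nonconstant
    derivative of g produces the factorials in the bounds of Dyson series. *)
Lemma cderive_dist_le f df (g dg : R -> R) t :
  (forall r, is_cderive f r (df r)) ->
  (forall r, 0 <= r -> is_derive r (1:R) g (dg r)) ->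
  (forall r, `|r| <= `|t| -> normc (df r) <= dg `|r|) ->
  normc (f t - f 0) <= 2 * (g `|t| - g 0).
Proof.
wlog t0 : f df t / 0 <= t => [H fd gd fg|].
  have [t0|t0] := leP 0 t; first exact: (H f df t).
  have := H (fun r => f (- r)) (fun r => - df (- r)) (- t).
  rewrite opprK oppr0 normrN; apply => //.
  - by rewrite oppr_ge0 ltW.
  - by move=> r; apply: is_cderive_opp; exact: fd.
  - by move=> r rt; rewrite normc_opp -(normrN r) fg// normrN.
move=> fd gd fg; rewrite (ger0_norm t0) mulr2n mulrDl !mul1r.
rewrite (ger0_norm t0) in fg.
have ReB z w : complex.Re (z - w) = complex.Re z - complex.Re w :> R.
  by case: z w => a b [].
have ImB z w : complex.Im (z - w) = complex.Im z - complex.Im w :> R.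
  by case: z w => a b [].
rewrite (le_trans (normc_le_ReIm _))// ReB ImB lerD//.
- apply: (@derive_dist_le (fun r => complex.Re (f r)) g
     (fun r => complex.Re (df r)) dg) => // r /andP[r0 rt].
  + by have [] := fd r.
  + exact: gd.
  + rewrite (le_trans (ler_Re_normc _))//.
    by have := fg r; rewrite ger0_norm//; exact.
- apply: (@derive_dist_le (fun r => complex.Im (f r)) g
     (fun r => complex.Im (df r)) dg) => // r /andP[r0 rt].
  + by have [] := fd r.
  + exact: gd.
  + rewrite (le_trans (ler_Im_normc _))//.
    by have := fg r; rewrite ger0_norm//; exact.
Qed.

Lemma cderive_lipschitz f df (c T t : R) :
  (forall r, is_cderive f r (df r)) ->
  (forall r, `|r| <= T -> normc (df r) <= c) -> `|t| <= T ->
  normc (f t - f 0) <= 2 * c * `|t|.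
Proof.
move=> fd fc tT.
have := @cderive_dist_le f df (fun r => c * r) (fun=> c) t fd.
rewrite mulr0 subr0 mulrA; apply.
- by move=> r _; exact: is_derive1_mull.
- by move=> r rt; apply: fc; exact: le_trans tT.
Qed.

End ComplexDerivative.

(** * Primitives of continuous curves *)

Section Primitive.
Context {R : realType}.
Notation mu := (@lebesgue_measure R).
Implicit Types (t x r : R).

(** The integral from a base point a to x, minus the integral from a to 0, does
    not depend on a as long as a lies to the left of both 0 and x; so the base
    point can be moved with x and still be kept fixed near each t. *)
Lemma continuous_primitive (f : R -> R) : continuous f ->
  exists2 F : R -> R, F 0 = 0 & forall t, is_derive t (1 : R) F (f t).
Proof.
move=> cf.
have fi (a x : R) : mu.-integrable `]a, x] (EFin \o f).
  have : mu.-integrable `[a, x] (EFin \o f).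
    apply: continuous_compact_integrable; first exact: segment_compact.
    exact: continuous_subspaceT.
  by apply: integrableS => //; exact: subset_itv_oc_cc.
pose K (a x : R) : R := \int[mu]_(y in `]a, x]) f y.
have KB (a b x : R) : a <= b -> b <= x -> K a x - K a b = K b x.
  by move=> ab bx; apply: Rintegral_itvB; rewrite ?bnd_simp.
pose a0 (x : R) : R := - (`|x| + 1).
pose F x := K (a0 x) x - K (a0 x) 0.
have FE (a x : R) : a <= a0 x -> F x = K a x - K a 0.
  move=> ax; have x0 : a0 x <= 0 by rewrite /a0; have := normr_ge0 x; lra.
  have xx : a0 x <= x by rewrite /a0; have := lerNnormlW (lexx `|x|); lra.
  by rewrite /F -(KB _ _ _ ax xx) -(KB _ _ _ ax x0); ring.
exists F; first by rewrite /F subrr.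
move=> t; pose a := - (`|t| + 2).
have at0 : a < t by rewrite /a; have := lerNnormlW (lexx `|t|); lra.
have t1 : t < t + 1 by rewrite ltrDl.
have at' : (BRight a < BRight t)%O by rewrite bnd_simp.
have [dK K'] := @continuous_FTC1 R f (BRight a) t (t + 1) t1 (fi _ _) at' (cf t).
have dF : is_derive t (1:R) (fun x => K a x - K a 0) (f t).
  rewrite -[f t]subr0; apply: is_deriveB.
  by apply: DeriveDef; [exact: dK|rewrite -derive1E; exact: K'].
apply: near_eq_is_derive dF; near=> x; rewrite -FE// /a0 /a.
have : `|x| <= `|t| + 1; last by lra.
have -> : x = t - (t - x) by ring.
rewrite (le_trans (ler_normB _ _))// lerD2l.
by near: x; apply: cvgr_dist_le => //; exact: cvg_id.
Unshelve. all: by end_near. Qed.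

Lemma ccvg_primitive (f : R -> R[i]) : (forall t, ccvg (nbhs t) f (f t)) ->
  exists2 F : R -> R[i], F 0 = 0 & forall t, is_cderive F t (f t).
Proof.
move=> cf.
have [t|Fr Fr0 dFr] := @continuous_primitive (fun r => complex.Re (f r)).
  exact: (ccvg_Re (cf t)).
have [t|Fi Fi0 dFi] := @continuous_primitive (fun r => complex.Im (f r)).
  exact: (ccvg_Im (cf t)).
by exists (fun r => Fr r +i* Fi r) => [|t]; [rewrite Fr0 Fi0|split; [exact: dFr|exact: dFi]].
Qed.

End Primitive.

(** * Dominated series indexed by the natural numbers *)

Section DominatedSeries.
Context {R : realType}.
Implicit Types (f g : nat -> R[i]) (a : nat -> R) (c l : R[i]) (e r t h : R).

Definition summ (a : nat -> R) := exists C, forall N, \sum_(j < N) a j <= C.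

Lemma summ_tail (a : nat -> R) : (forall j, 0 <= a j) -> summ a ->
  forall e, 0 < e -> exists J, forall N, \sum_(j < N) a (J + j)%N <= e.
Proof.
move=> a0 [C aC] e e0.
pose S N : R := \sum_(j < N) a j.
have Snd : nondecreasing_seq S.
  by apply/nondecreasing_seqP => n; rewrite /S big_ord_recr/= lerDl.
have Scv : cvgn S.
  apply: nondecreasing_is_cvgn => //; exists C => _ [n _ <-]; exact: aC.
have SL N : S N <= limn S by exact: nondecreasing_cvgn_le.
have /cvgrPdist_le/(_ e e0) [J _ /(_ J (leqnn J)) /=] := Scv.
rewrite ger0_norm ?subr_ge0// => SJ; exists J => N.
have : S (J + N)%N <= limn S by [].
by rewrite /S big_split_ord/=; rewrite /S in SJ; lra.
Qed.

(** Tannery's theorem stated for finite partial sums, uniformly in their length: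
    in this form it applies both to series and to squared Sobolev norms. *)
Lemma tannery_core I (F : set_system I) {FF : Filter F}
    (f : I -> nat -> R) (a : nat -> R) : (forall j, 0 <= a j) -> summ a ->
  (\forall i \near F, forall j, f i j <= a j) ->
  (forall j e, 0 < e -> \forall i \near F, f i j <= e) ->
  forall e, 0 < e -> \forall i \near F, forall N, (forall j, 0 <= f i j) ->
    \sum_(j < N) f i j <= e.
Proof.
move=> a0 sa fa f0 e e0.
have e2 : 0 < e / 2 by rewrite divr_gt0.
have [J tail] := summ_tail a0 sa e2.
have head : \forall i \near F, \sum_(j < J) f i j <= e / 2.
  elim: J {tail} (e / 2) e2 => [|J IH] d d0.
    by apply: nearW => i; rewrite big_ord0 ltW.
  have d2 : 0 < d / 2 by rewrite divr_gt0.
  near=> i; rewrite big_ord_recr/= [leRHS](splitr d) lerD//; near: i.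
  - exact: IH.
  - exact: f0.
near=> i => N fi0.
apply: (@le_trans _ _ (\sum_(j < J + N) f i j)).
  rewrite addnC big_split_ord/= lerDl; exact: sumr_ge0.
rewrite big_split_ord/= [leRHS](splitr e) lerD//.
- by near: i.
- apply: le_trans (tail N); apply: ler_sum => j _.
  by move: (J + j)%N; near: i.
Unshelve. all: by end_near. Qed.

Definition csum (f : nat -> R[i]) : R[i] := climn (fun N => \sum_(j < N) f j).

Lemma csum_eq f l : ccvg \oo (fun N => \sum_(j < N) f j) l -> csum f = l.
Proof. exact: ccvg_climn. Qed.

Lemma dominated_cvg (f a : nat -> R) : (forall j, `|f j| <= a j) -> summ a ->
  cvgn (fun N => \sum_(j < N) f j).
Proof.
move=> fa [C aC].
have -> : (fun N => \sum_(j < N) f j) = series f.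
  by apply/funext => N; rewrite /series/= big_mkord.
apply: normed_cvg; apply: nondecreasing_is_cvgn.
  by apply: nondecreasing_series => n _ _; exact: normr_ge0.
exists C => _ [n _ <-]; apply: le_trans (aC n).
by rewrite [leLHS]big_mkord; apply: ler_sum => j _; exact: fa.
Qed.

Definition cdom (f : nat -> R[i]) := summ (fun j => normc (f j)).

Lemma cdomP f a : (forall j, normc (f j) <= a j) -> summ a -> cdom f.
Proof.
move=> fa [C aC]; exists C => N; apply: le_trans (aC N).
by apply: ler_sum => j _.
Qed.

Lemma csum_cvg f : cdom f -> ccvg \oo (fun N => \sum_(j < N) f j) (csum f).
Proof.
move=> fd.
have cr := dominated_cvg (fun j => ler_Re_normc (f j)) fd.
have ci := dominated_cvg (fun j => ler_Im_normc (f j)) fd.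
rewrite /csum /climn; apply: ccvg_ReIm => /=.
- by rewrite (funext (fun N => Re_sum _ _ _)).
- by rewrite (funext (fun N => Im_sum _ _ _)).
Qed.

Lemma csum_normc_le f (c : R) : (forall N, \sum_(j < N) normc (f j) <= c) ->
  normc (csum f) <= c.
Proof.
move=> fc; have fd : cdom f by exists c.
apply: (ccvg_normc_le (csum_cvg fd)); apply: nearW => N.
exact: le_trans (normc_sum _ _ _) (fc N).
Qed.

Lemma csumD f g : cdom f -> cdom g ->
  csum (fun j => f j + g j) = csum f + csum g.
Proof.
move=> fd gd; apply: csum_eq.
under eq_fun do rewrite big_split; exact: ccvgD (csum_cvg fd) (csum_cvg gd).
Qed.

Lemma csumZ c f : cdom f -> csum (fun j => c * f j) = c * csum f.
Proof.
move=> fd; apply: csum_eq.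
under eq_fun do rewrite -mulr_sumr; exact: ccvgZ (csum_cvg fd).
Qed.

Lemma cdomD f g : cdom f -> cdom g -> cdom (fun j => f j + g j).
Proof.
move=> [C fC] [D gD].
apply: (@cdomP _ (fun j => normc (f j) + normc (g j))).
  by move=> j; exact: normcD.
by exists (C + D) => N; rewrite big_split lerD.
Qed.

Lemma cdomZ c f : cdom f -> cdom (fun j => c * f j).
Proof.
move=> [C fC]; apply: (@cdomP _ (fun j => normc c * normc (f j))).
  by move=> j; rewrite normcM.
by exists (normc c * C) => N; rewrite -mulr_sumr ler_wpM2l ?normc_ge0.
Qed.

Lemma csum_recl (f : nat -> R[i]) : cdom f -> csum f = f 0%N + csum (fun j => f j.+1).
Proof.
move=> fd; have fd' : cdom (fun j => f j.+1).
  case: fd => C fC; exists C => L; apply: le_trans (fC L.+1).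
  by rewrite big_ord_recl /= lerDr normc_ge0.
apply: csum_eq.
have := ccvgD (ccvg_cst (F := \oo) (f 0%N)) (csum_cvg fd').
move=> /(_ _ _) H e e0; have [J _ HJ] := H e e0.
exists J.+1 => // -[//|L] /= JL; rewrite big_ord_recl /=.
exact: HJ.
Qed.

(** Tannery's theorem, from which both term by term differentiation and the
    continuity of operators for dominated limits are deduced. *)
Lemma csum_tannery I (F : set_system I) {FF : ProperFilter F}
    (f : I -> nat -> R[i]) (g : nat -> R[i]) (a : nat -> R) : summ a ->
  (\forall i \near F, forall j, normc (f i j) <= a j) ->
  (forall j, ccvg F (f ^~ j) (g j)) ->
  ccvg F (fun i => csum (f i)) (csum g).
Proof.
move=> sa fa fg.
have ga j : normc (g j) <= a j.
  by apply: (ccvg_normc_le (fg j)); apply: filterS fa => i; exact.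
have gd : cdom g := cdomP ga sa.
have sa2 : summ (fun j => 2 * a j).
  by case: sa => C aC; exists (2 * C) => N; rewrite -mulr_sumr ler_wpM2l.
have a0 j : 0 <= 2 * a j by rewrite mulr_ge0// (le_trans (normc_ge0 _) (ga j)).
have H := @tannery_core I F _ (fun i j => normc (f i j - g j)) _ a0 sa2.
move=> e e0; near=> i.
have fia : forall j, normc (f i j) <= a j by near: i.
have fd : cdom (f i) := cdomP fia sa.
have -> : csum (f i) - csum g = csum (fun j => f i j - g j).
  rewrite -mulN1r -csumZ// -csumD//; last exact: cdomZ.
  by congr csum; apply/funext => j; rewrite mulN1r.
apply: csum_normc_le => N.
have : forall j, 0 <= normc (f i j - g j) by move=> j; exact: normc_ge0.
move: N; near: i; apply: H => //.
apply: filterS fa => i fia j.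
by rewrite (le_trans (normcB _ _))// mulr2n mulrDl mul1r lerD.
Unshelve. all: by end_near. Qed.

(** The difference quotients converge term by term, and the mean value
    inequality dominates them. *)
Lemma csum_derive (f df : R -> nat -> R[i]) (a : nat -> R) (t : R) :
  (forall r j, is_cderive (f ^~ j) r (df r j)) -> summ a ->
  (forall r j, `|r - t| <= 1 -> normc (df r j) <= a j) ->
  (forall r, cdom (f r)) ->
  is_cderive (fun r => csum (f r)) t (csum (df t)).
Proof.
move=> fd sa dfa fdom; apply/is_cderiveP.
have sa2 : summ (fun j => 2 * a j).
  by case: sa => C aC; exists (2 * C) => N; rewrite -mulr_sumr ler_wpM2l.
have E (h : R) : (h^-1)%:C * (csum (f (h + t)) - csum (f t)) =
    csum (fun j => (h^-1)%:C * (f (h + t) j - f t j)).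
  have d1 : cdom (fun j => -1 * f t j) by exact: cdomZ.
  rewrite -mulN1r -csumZ// -csumD// -csumZ; last exact: cdomD.
  by congr csum; apply/funext => j; rewrite mulN1r.
rewrite (funext E).
apply: (csum_tannery sa2) => [|j]; last by have /is_cderiveP := fd t j.
near=> h => j; have h1 : `|h| <= 1 by near: h; exact: dnbhs0_le.
have h0 : h != 0 by near: h; exact: nbhs_dnbhs_neq.
have sd (r : R) : is_cderive (fun r => f (r + t) j) r (df (r + t) j).
  have [dr di] := fd (r + t) j.
  have ds : is_derive r (1 : R) (fun r : R => r + t) 1.
    rewrite -[X in is_derive _ _ _ X]addr0.
    exact: is_deriveD (is_derive_id _ _) (is_derive_cst _ _ _).
  split.
  - have := @is_derive1_comp R (fun r => complex.Re (f r j))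
      (fun r => r + t) r _ _ dr ds; by rewrite mulr1.
  - have := @is_derive1_comp R (fun r => complex.Im (f r j))
      (fun r => r + t) r _ _ di ds; by rewrite mulr1.
have := @cderive_lipschitz _ (fun r => f (r + t) j) (fun r => df (r + t) j)
  (a j) 1 h sd.
rewrite add0r => H; rewrite normcM normc_real normfV ler_pdivrMl ?normr_gt0//.
rewrite (mulrC `|h|); apply: H => // r r1; apply: dfa.
by rewrite addrK.
Unshelve. all: by end_near. Qed.

End DominatedSeries.

(** * Symmetric sums over the integers and moderate weights *)

Section SymmetricSums.
Context {R : realType}.
Implicit Types (f g : int -> R[i]) (a b : int -> R) (e r t h : R) (k m n p : int).

Definition zpart {V : nmodType} (f : int -> V) (N : nat) : V :=
  \sum_(i < N.*2.+1) f (i%:Z - N%:Z).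

(** Grouping the terms k and -k turns symmetric partial sums into those of an
    ordinary series. *)
Definition zfold {V : nmodType} (f : int -> V) (j : nat) : V :=
  if j is j'.+1 then f j'.+1%:Z + f (- j'.+1%:Z) else f 0.

Lemma zpartE (V : nmodType) (f : int -> V) N :
  zpart f N = \sum_(j < N.+1) zfold f j.
Proof.
elim: N => [|N IH]; first by rewrite /zpart !big_ord_recl !big_ord0.
rewrite big_ord_recr/= -IH /zpart doubleS big_ord_recl big_ord_recr/=.
rewrite addrCA; congr (_ + _).
  by apply: eq_bigr => i _; congr f; rewrite /bump/=; lia.
by rewrite addrC; congr (_ + _); congr f; rewrite /bump/=; lia.
Qed.

Definition zsumm (a : int -> R) := exists C, forall N, zpart a N <= C.

Definition zdom (f : int -> R[i]) := zsumm (fun k => normc (f k)).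

Lemma ler_zpart a b N : (forall k, a k <= b k) -> zpart a N <= zpart b N.
Proof. by move=> ab; apply: ler_sum. Qed.

Lemma zpartZ c a N : zpart (fun k => c * a k) N = c * zpart a N.
Proof. by rewrite /zpart mulr_sumr. Qed.

Lemma zpartD a b N : zpart (fun k => a k + b k) N = zpart a N + zpart b N.
Proof. by rewrite /zpart big_split. Qed.

Lemma summ_zfold a : (forall k, 0 <= a k) -> zsumm a -> summ (zfold a).
Proof.
move=> a0 [C aC]; exists C => -[|N]; last by rewrite -zpartE.
rewrite big_ord0 (le_trans _ (aC 0%N))//.
by apply: sumr_ge0.
Qed.

Lemma zdomP f a : (forall k, normc (f k) <= a k) -> zsumm a -> zdom f.
Proof.
by move=> fa [C aC]; exists C => N; apply: le_trans (aC N); exact: ler_zpart.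
Qed.

Lemma normc_zfold f j : normc (zfold f j) <= zfold (fun k => normc (f k)) j.
Proof. by case: j => [//|j] /=; exact: normcD. Qed.

Lemma cdom_zfold f : zdom f -> cdom (zfold f).
Proof.
move=> fd; apply: cdomP (normc_zfold f) _.
by apply: summ_zfold => // k; exact: normc_ge0.
Qed.

Lemma zsum_cvg_csum f : zdom f -> ccvg \oo (zpart f) (csum (zfold f)).
Proof.
move=> /cdom_zfold/csum_cvg fd e e0; have [J _ JN] := fd e e0.
by exists J => // N /= JleN; rewrite zpartE; apply: JN => /=; exact: leqW.
Qed.

Lemma zsum_fold f : zdom f -> zsum f = csum (zfold f).
Proof. by move=> /zsum_cvg_csum; exact: ccvg_climn. Qed.

Lemma zsum_cvg f : zdom f -> ccvg \oo (zpart f) (zsum f).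
Proof. by move=> fd; rewrite zsum_fold//; exact: zsum_cvg_csum. Qed.

Lemma zsum_eq f l : ccvg \oo (zpart f) l -> zsum f = l.
Proof. exact: ccvg_climn. Qed.

Lemma normc_zpart f N : normc (zpart f N) <= zpart (fun k => normc (f k)) N.
Proof. exact: normc_sum. Qed.

Lemma zsum_normc_le f (c : R) : (forall N, zpart (fun k => normc (f k)) N <= c) ->
  normc (zsum f) <= c.
Proof.
move=> fc; have fd : zdom f by exists c.
apply: (ccvg_normc_le (zsum_cvg fd)); apply: nearW => N.
exact: le_trans (normc_zpart _ _) (fc N).
Qed.

Lemma zsumD f g : zdom f -> zdom g -> zsum (fun k => f k + g k) = zsum f + zsum g.
Proof.
move=> fd gd; apply: zsum_eq.
rewrite (_ : zpart _ = fun N => zpart f N + zpart g N).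
  exact: ccvgD (zsum_cvg fd) (zsum_cvg gd).
by apply/funext => N; rewrite /zpart big_split.
Qed.

Lemma zsumZ (c : R[i]) f : zdom f -> zsum (fun k => c * f k) = c * zsum f.
Proof.
move=> fd; apply: zsum_eq.
rewrite (_ : zpart _ = fun N => c * zpart f N).
  exact: ccvgZ (zsum_cvg fd).
by apply/funext => N; rewrite /zpart mulr_sumr.
Qed.

Lemma zdomD f g : zdom f -> zdom g -> zdom (fun k => f k + g k).
Proof.
move=> [C fC] [D gD].
apply: (@zdomP _ (fun k => normc (f k) + normc (g k))).
  by move=> k; exact: normcD.
by exists (C + D) => N; rewrite zpartD lerD.
Qed.

Lemma zdomZ (c : R[i]) f : zdom f -> zdom (fun k => c * f k).
Proof.
move=> [C fC]; apply: (@zdomP _ (fun k => normc c * normc (f k))).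
  by move=> k; rewrite normcM.
by exists (normc c * C) => N; rewrite zpartZ ler_wpM2l ?normc_ge0.
Qed.

Lemma zpart_single (V : nmodType) (f : int -> V) k N :
  (forall n, n != k -> f n = 0) -> (`|k| <= N)%N -> zpart f N = f k.
Proof.
move=> f0 kN.
have iP : (absz (k + N%:Z)%R < N.*2.+1)%N by lia.
rewrite /zpart (bigD1 (Ordinal iP))//= big1 ?addr0.
  by congr f; lia.
move=> i /eqP ik; apply: f0; apply/eqP => E; apply: ik; apply/val_inj => /=; lia.
Qed.

Lemma zsum_single f k : (forall n, n != k -> f n = 0) -> zsum f = f k.
Proof.
move=> f0; apply: zsum_eq => e e0; exists `|k|%N => // N kN /=.
by rewrite (zpart_single f0)// subrr normc0 ltW.
Qed.

Lemma zsum_tannery I (F : set_system I) {FF : ProperFilter F}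
    (f : I -> int -> R[i]) g a : zsumm a ->
  (\forall i \near F, forall k, normc (f i k) <= a k) ->
  (forall k, ccvg F (f ^~ k) (g k)) ->
  ccvg F (fun i => zsum (f i)) (zsum g).
Proof.
move=> sa fa fg.
have ga k : normc (g k) <= a k.
  by apply: (ccvg_normc_le (fg k)); apply: filterS fa => i; exact.
have a0 k : 0 <= a k by exact: le_trans (normc_ge0 _) (ga k).
rewrite (zsum_fold (zdomP ga sa)).
suff H : ccvg F (fun i => csum (zfold (f i))) (csum (zfold g)).
  apply: ccvg_near_eq H; apply: filterS fa => i fia.
  by rewrite zsum_fold//; exact: zdomP fia sa.
apply: (csum_tannery (summ_zfold a0 sa)).
  apply: filterS fa => i fia j; apply: le_trans (normc_zfold _ _) _.
  by case: j => [|j] /=; rewrite ?lerD.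
by case=> [|j] /=; [exact: fg|exact: ccvgD].
Qed.

Lemma zsum_derive (f df : R -> int -> R[i]) a (t : R) :
  (forall r k, is_cderive (f ^~ k) r (df r k)) -> zsumm a ->
  (forall r k, `|r - t| <= 1 -> normc (df r k) <= a k) ->
  (forall r, zdom (f r)) ->
  is_cderive (fun r => zsum (f r)) t (zsum (df t)).
Proof.
move=> fd sa dfa fdom.
have tt : `|t - t| <= 1 by rewrite subrr normr0.
have a0 k : 0 <= a k by exact: le_trans (normc_ge0 _) (dfa t k tt).
rewrite (zsum_fold (zdomP (fun k => dfa t k tt) sa)).
have -> : (fun r => zsum (f r)) = (fun r => csum (zfold (f r))).
  by apply/funext => r; rewrite zsum_fold.
apply: (csum_derive (f := fun r => zfold (f r)) (df := fun r => zfold (df r))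
  _ (summ_zfold a0 sa)).
- by move=> r [|j] /=; [exact: fd|apply: is_cderiveD; exact: fd].
- move=> r j rt; apply: le_trans (normc_zfold _ _) _.
  by case: j => [|j] /=; rewrite ?lerD// dfa.
- by move=> r; exact: cdom_zfold.
Qed.

End SymmetricSums.

Section Weights.
Context {R : realType}.
Implicit Types (k m n p : int) (N : nat) (w : int -> R).

(** The weight usually written <k>. *)
Definition jb (k : int) : R := 1 + `|k|%:~R.

Lemma jb_ge1 k : 1 <= jb k.
Proof. by rewrite /jb lerDl ler0z. Qed.

Lemma jb_gt0 k : 0 < jb k.
Proof. exact: lt_le_trans ltr01 (jb_ge1 k). Qed.

Lemma jb_ge0 k : 0 <= jb k.
Proof. exact: ltW (jb_gt0 k). Qed.

Lemma jb0 : jb 0 = 1.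
Proof. by rewrite /jb normr0 addr0. Qed.

Lemma jbN k : jb (- k) = jb k.
Proof. by rewrite /jb normrN. Qed.

Lemma jbB m n : jb (m - n) = jb (n - m).
Proof. by rewrite -jbN opprB. Qed.

Lemma jb_le k m : (`|k| <= `|m|)%R -> jb k <= jb m.
Proof. by move=> km; rewrite lerD2l ler_int. Qed.

Lemma jbD m n : jb (m + n) <= jb m * jb n.
Proof.
have : (`|m + n|%:~R : R) <= `|m|%:~R + `|n|%:~R.
  by rewrite -intrD ler_int ler_normD.
have : (0 : R) <= `|m|%:~R * `|n|%:~R by rewrite mulr_ge0 ?ler0z.
rewrite /jb; lra.
Qed.

Lemma jb_split m n : jb n <= jb (m - n) * jb m.
Proof. by have := jbD (n - m) m; rewrite subrK jbB. Qed.

Lemma jbX_ge0 k N : 0 <= jb k ^+ N.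
Proof. exact: exprn_ge0 (jb_ge0 k). Qed.

Lemma jbX_gt0 k N : 0 < jb k ^+ N.
Proof. exact: exprn_gt0 (jb_gt0 k). Qed.

Lemma jbV_ge0 k N : 0 <= jb k ^- N.
Proof. by rewrite invr_ge0 jbX_ge0. Qed.

Lemma jbVX_le k M N : (M <= N)%N -> jb k ^- N <= jb k ^- M.
Proof. by move=> MN; rewrite lef_pV2 ?posrE ?jbX_gt0// ler_weXn2l// jb_ge1. Qed.

Lemma jbV_le1 k N : jb k ^- N <= 1.
Proof. by have := jbVX_le k (leq0n N); rewrite expr0 invr1. Qed.

(** As k / <k> is bounded, sums of <m - n>^-2 over n are bounded uniformly in m
    by telescoping, with no translation of the summation domain. *)
Lemma jbV2_telescope k :
  jb k ^- 2 <= 2 * ((k + 1)%:~R / jb (k + 1) - k%:~R / jb k).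
Proof.
have key (u : R) : 0 <= u -> (u + 1) ^- 2 <= 2 * ((u + 1) / (u + 2) - u / (u + 1)) /\
    (u + 2) ^- 2 <= 2 * ((u + 1) / (u + 2) - u / (u + 1)).
  move=> u0; have u1 : u + 1 != 0 by apply/eqP; lra.
  have u2 : u + 2 != 0 by apply/eqP; lra.
  have -> : 2 * ((u + 1) / (u + 2) - u / (u + 1)) = ((u + 1) * (u + 2) / 2)^-1.
    by field; rewrite u1 u2.
  have p1 : 0 < u + 1 by lra.
  have p2 : 0 < u + 2 by lra.
  have uu : 0 <= u * u by rewrite mulr_ge0.
  split; rewrite lef_pV2 ?posrE ?exprn_gt0 ?divr_gt0 ?mulr_gt0//.
  - have : (u + 1) ^+ 2 - (u + 1) * (u + 2) / 2 = (u * u + u) / 2 by field.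
    lra.
  - have : (u + 2) ^+ 2 - (u + 1) * (u + 2) / 2 = (u * u + 5 * u + 6) / 2 by field.
    lra.
case: k => [n|n].
- have [H _] := key n%:R (ler0n _ _).
  have -> : n%:Z + 1 = n.+1%:Z by lia.
  rewrite /jb !ger0_norm//.
  have -> : (n.+1%:Z)%:~R = n%:R + 1 :> R by rewrite natr1.
  rewrite (addrC 1 n%:~R).
  by have -> : 1 + (n%:R + 1) = n%:R + 2 :> R by ring.
- have [_ H] := key n%:R (ler0n _ _).
  rewrite NegzE; have -> : - n.+1%:Z + 1 = - n%:Z by lia.
  rewrite !jbN /jb !ger0_norm// !mulrNz.
  have -> : (n.+1%:Z)%:~R = n%:R + 1 :> R by rewrite natr1.
  have -> : 1 + (n%:R + 1) = n%:R + 2 :> R by ring.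
  by rewrite (addrC 1 n%:~R) !mulNr opprK (addrC (- _)).
Qed.

Lemma zpart_jbV2 m L : zpart (fun n => jb (m - n) ^- 2) L <= 4.
Proof.
pose g (i : nat) : R :=
  2 * ((m - (i%:Z - L%:Z) + 1)%:~R / jb (m - (i%:Z - L%:Z) + 1)).
apply: (@le_trans _ _ (\sum_(i < L.*2.+1) (g i - g i.+1))).
  apply: ler_sum => i _; apply: le_trans (jbV2_telescope _) _.
  rewrite /g mulrBr lerD2l lerN2.
  by have -> : m - (i.+1%:Z - L%:Z) + 1 = m - (i%:Z - L%:Z) :> int by lia.
have -> (K : nat) : \sum_(i < K) (g i - g i.+1) = g 0%N - g K.
  elim: K => [|K IH]; first by rewrite big_ord0 subrr.
  by rewrite big_ord_recr/= IH addrA subrK.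
have phi k : `|k%:~R / jb k : R| <= 1.
  rewrite normrM normfV (ger0_norm (jb_ge0 k)) ler_pdivrMr ?jb_gt0// mul1r.
  by rewrite /jb -intr_norm lerDr.
have := phi (m - (0%N%:Z - L%:Z) + 1); have := phi (m - (L.*2.+1%:Z - L%:Z) + 1).
by rewrite /g !ler_norml => /andP[? ?] /andP[? ?]; lra.
Qed.

(** Moderate weights vary polynomially with the distance.  Estimates uniform
    over all of them replace estimates in a scale of norms. *)
Definition moderate N (w : int -> R) :=
  (forall m, 0 <= w m) /\ forall m p, w p <= jb (m - p) ^+ N * w m.

Lemma moderate_ge0 N w m : moderate N w -> 0 <= w m.
Proof. by case. Qed.

Lemma moderate_cst N (c : R) : 0 <= c -> moderate N (fun=> c).
Proof.
move=> c0; split=> // m p.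
by rewrite -[leLHS]mul1r ler_wpM2r// exprn_ege1// jb_ge1.
Qed.

Lemma moderate1 : exists N, moderate N (fun=> 1 : R).
Proof. by exists 0%N; exact: moderate_cst. Qed.

Lemma moderate_le M N w : (M <= N)%N -> moderate M w -> moderate N w.
Proof.
move=> MN [w0 wM]; split=> // m p; apply: le_trans (wM m p) _.
by rewrite ler_wpM2r// ler_weXn2l// jb_ge1.
Qed.

Lemma moderateM M N v w : moderate M v -> moderate N w ->
  moderate (M + N) (fun k => v k * w k).
Proof.
move=> [v0 vM] [w0 wN]; split=> [m|m p]; first exact: mulr_ge0.
by rewrite exprD mulrACA ler_pM.
Qed.

Lemma moderateD N v w : moderate N v -> moderate N w ->
  moderate N (fun k => v k + w k).
Proof.
move=> [v0 vM] [w0 wN]; split=> [m|m p]; first exact: addr_ge0.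
by rewrite mulrDr lerD.
Qed.

Lemma moderateZ N (c : R) w : 0 <= c -> moderate N w ->
  moderate N (fun k => c * w k).
Proof. by move=> c0 wN; have := moderateM (moderate_cst 0 c0) wN. Qed.

Lemma moderate_jb N : moderate N (fun k => jb k ^+ N).
Proof.
split=> [m|m p]; first exact: jbX_ge0.
by rewrite -exprMn lerXn2r ?nnegrE ?mulr_ge0 ?jb_ge0// jb_split.
Qed.

Lemma moderate_jbV N n : moderate N (fun k => jb (k - n) ^- N).
Proof.
split=> [m|m p]; first exact: jbV_ge0.
rewrite ler_pdivlMr ?jbX_gt0// mulrC -ler_pdivlMr ?invr_gt0 ?jbX_gt0// invrK.
rewrite -exprMn lerXn2r ?nnegrE ?mulr_ge0 ?jb_ge0//.
have -> : m - n = (m - p) + (p - n) :> int by lia.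
exact: jbD.
Qed.

End Weights.

(** * Tame operators *)

Section TameOperators.
Context {R : realType}.
Implicit Types (k m n p : int) (N L : nat) (w g h : int -> R) (x y : zseq R).
Implicit Types (S T : zoperator R) (M : zmatrix R) (c : R[i]) (C K : R).

Definition bnd x w := forall k, normc (x k) <= w k.

(** Tempered sequences have polynomial growth: they contain every h^s, and A
    maps them to one another. *)
Definition tempered x := exists N w, moderate N w /\ bnd x w.

Lemma temperedP N w x : moderate N w -> bnd x w -> tempered x.
Proof. by move=> wN xw; exists N, w. Qed.

Lemma bndD x y v w : bnd x v -> bnd y w ->
  bnd (fun k => x k + y k) (fun k => v k + w k).
Proof. by move=> xv yw k; apply: le_trans (normcD _ _) _; exact: lerD. Qed.

Lemma bndZ c x w : bnd x w -> bnd (fun k => c * x k) (fun k => normc c * w k).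
Proof. by move=> xw k; rewrite normcM ler_wpM2l ?normc_ge0. Qed.

Lemma temperedD x y : tempered x -> tempered y -> tempered (fun k => x k + y k).
Proof.
move=> [N [v [vN xv]]] [N' [w [wN yw]]]; apply: temperedP (bndD xv yw).
by apply: (moderateD (moderate_le (leq_maxl N N') vN)
  (moderate_le (leq_maxr N N') wN)).
Qed.

Lemma temperedZ c x : tempered x -> tempered (fun k => c * x k).
Proof.
by move=> [N [w [wN xw]]]; apply: temperedP (moderateZ (normc_ge0 c) wN) (bndZ c xw).
Qed.

Lemma tempered0 : tempered (fun=> 0).
Proof. by apply: (temperedP (moderate_cst 0 (lexx 0))) => k; rewrite normc0. Qed.

Lemma tempered_sum I (r : seq I) (f : I -> zseq R) :
  (forall i, tempered (f i)) -> tempered (fun k => \sum_(i <- r) f i k).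
Proof.
move=> ft; elim: r => [|i r IH].
  by under eq_fun do rewrite big_nil; exact: tempered0.
by under eq_fun do rewrite big_cons; exact: temperedD.
Qed.

(** Operators of gain g, which send the weight w to g w; the gain <k>^2 is that
    of A, and <k>^-1 that of X.  In tame_bound the constant depends on the order
    N of the weight only.  Continuity for dominated pointwise limits makes the
    operator equal to its matrix (tame_kernel), while composition never needs
    an exchange of double sums. *)
Record tame g T : Prop := Tame {
  tame_gain : exists N, moderate N g;
  tame_lin : forall c x y, tempered x -> tempered y ->
    T (fun k => x k + c * y k) = (fun k => T x k + c * T y k);
  tame_bound : forall N, exists2 K, 0 <= K & forall w x, moderate N w -> bnd x w ->
    forall m, normc (T x m) <= K * g m * w m;
  tame_cont : forall N w (x : nat -> zseq R), moderate N w ->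
    (forall i, bnd (x i) w) -> (forall k, ccvg \oo (x ^~ k) 0) ->
    forall k, ccvg \oo (fun i => T (x i) k) 0 }.

Lemma tame_bnd g T N : tame g T -> exists2 K, 0 <= K &
  forall w x, moderate N w -> bnd x w -> bnd (T x) (fun m => K * g m * w m).
Proof. by move=> tT; have [K K0 TK] := tame_bound tT N; exists K. Qed.

Lemma moderate_gain g N N' (K : R) w : 0 <= K -> moderate N g -> moderate N' w ->
  moderate (N + N') (fun m => K * g m * w m).
Proof. by move=> K0 gN wN; exact: moderateM (moderateZ K0 gN) wN. Qed.

Lemma tame_tempered g T x : tame g T -> tempered x -> tempered (T x).
Proof.
move=> tT [N [w [wN xw]]]; have [M gM] := tame_gain tT.
have [K K0 TK] := tame_bnd N tT.
exact: temperedP (moderate_gain K0 gM wN) (TK _ _ wN xw).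
Qed.

Lemma tame0 g T : tame g T -> T (fun=> 0) = (fun=> 0).
Proof.
move=> tT; have := tame_lin tT (-1) tempered0 tempered0.
have -> : (fun k : int => (0 : R[i]) + -1 * 0) = (fun=> 0).
  by apply/funext => k; rewrite mulr0 addr0.
move=> E; apply/funext => k; have /(congr1 (@^~ k)) /= -> := E.
by rewrite mulN1r subrr.
Qed.

Lemma tameD_seq g T x y : tame g T -> tempered x -> tempered y ->
  T (fun k => x k + y k) = (fun k => T x k + T y k).
Proof.
move=> tT xt yt; have := tame_lin tT 1 xt yt.
by under eq_fun do rewrite mul1r; under [X in _ = X -> _]eq_fun do rewrite mul1r.
Qed.

Lemma tameZ_seq g T c x : tame g T -> tempered x ->
  T (fun k => c * x k) = (fun k => c * T x k).
Proof.
move=> tT xt; have := tame_lin tT c tempered0 xt; rewrite (tame0 tT).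
by under eq_fun do rewrite add0r; under [X in _ = X -> _]eq_fun do rewrite add0r.
Qed.

Lemma tameB_seq g T x y : tame g T -> tempered x -> tempered y ->
  T (fun k => x k - y k) = (fun k => T x k - T y k).
Proof.
move=> tT xt yt; have := tame_lin tT (-1) xt yt.
by under eq_fun do rewrite mulN1r; under [X in _ = X -> _]eq_fun do rewrite mulN1r.
Qed.

Lemma tame_sum g T I (r : seq I) (f : I -> zseq R) : tame g T ->
  (forall i, tempered (f i)) ->
  T (fun k => \sum_(i <- r) f i k) = (fun k => \sum_(i <- r) T (f i) k).
Proof.
move=> tT ft; elim: r => [|i r IH].
  rewrite (_ : (fun k => _) = (fun=> 0)); last by apply/funext => k; rewrite big_nil.
  by rewrite (tame0 tT); apply/funext => k; rewrite big_nil.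
rewrite (_ : (fun k => _) = (fun k => f i k + \sum_(j <- r) f j k)); last first.
  by apply/funext => k; rewrite big_cons.
rewrite (tameD_seq tT) ?IH//; last exact: tempered_sum.
by apply/funext => k; rewrite big_cons.
Qed.

Lemma tame_cvg g T N w (x : nat -> zseq R) y : tame g T -> moderate N w ->
  (forall i, bnd (x i) w) -> (forall k, ccvg \oo (x ^~ k) (y k)) ->
  forall k, ccvg \oo (fun i => T (x i) k) (T y k).
Proof.
move=> tT wN xw xy k.
have yw : bnd y w by move=> j; apply: (ccvg_normc_le (xy j)); apply: nearW => i; exact: xw.
have xt i := temperedP wN (xw i); have yt := temperedP wN yw.
apply/ccvg_sub.
have -> : (fun i => T (x i) k - T y k) = (fun i => T (fun k => x i k - y k) k).
  by apply/funext => i; rewrite (tameB_seq tT).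
apply: (tame_cont tT (moderateD wN wN)) => [i j|j].
  exact: le_trans (normcB _ _) (lerD (xw i j) (yw j)).
by apply/ccvg_sub; exact: xy.
Qed.

Lemma tame_eq g S T : (forall x, tempered x -> S x = T x) -> tame g S -> tame g T.
Proof.
move=> ST [gN lin bd ct]; split=> //.
- move=> c x y xt yt; rewrite -!ST ?lin//.
  by apply: temperedD => //; exact: temperedZ.
- move=> N; have [K K0 SK] := bd N; exists K => // w x wN xw.
  by rewrite -ST; [exact: SK|exact: temperedP wN xw].
- move=> N w x wN xw x0 k.
  rewrite (_ : (fun i => _) = (fun i => S (x i) k)); first exact: ct wN xw x0 k.
  by apply/funext => i; rewrite ST//; exact: temperedP wN (xw i).
Qed.

Lemma tame_strengthen g h T : (exists N, moderate N h) -> tame g T ->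
  (forall N, exists2 K, 0 <= K & forall w x, moderate N w -> bnd x w ->
    forall m, normc (T x m) <= K * h m * w m) -> tame h T.
Proof. by move=> hN [gN lin bd ct] hb; split. Qed.

Lemma tame_le g h T C : 0 <= C -> (exists N, moderate N h) ->
  (forall k, g k <= C * h k) -> tame g T -> tame h T.
Proof.
move=> C0 hN gh tT; apply: tame_strengthen (tT) _ => // N.
have [K K0 TK] := tame_bound tT N; exists (K * C); first exact: mulr_ge0.
move=> w x wN xw m; apply: le_trans (TK w x wN xw m) _.
by rewrite ler_wpM2r ?(moderate_ge0 _ wN)// -mulrA ler_wpM2l.
Qed.

Lemma tame_comp g h S T : tame g S -> tame h T ->
  tame (fun k => g k * h k) (S \o T).
Proof.
move=> tS tT; have [Ng gN] := tame_gain tS; have [Nh hN] := tame_gain tT.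
split.
- by exists (Ng + Nh)%N; exact: moderateM.
- move=> c x y xt yt /=.
  rewrite (tame_lin tT)// (tame_lin tS)//; exact: tame_tempered tT _.
- move=> N; have [K K0 TK] := tame_bnd N tT.
  have [K' K'0 SK] := tame_bnd (Nh + N) tS.
  exists (K' * K); first exact: mulr_ge0.
  move=> w x wN xw m /=.
  have := SK _ _ (moderate_gain K0 hN wN) (TK _ _ wN xw) m.
  by move=> H; apply: le_trans H _; rewrite le_eqVlt; apply/orP; left; apply/eqP; ring.
- move=> N w x wN xw x0 k /=; have [K K0 TK] := tame_bnd N tT.
  apply: (tame_cont tS (moderate_gain K0 hN wN)) => [i|j].
    exact: TK wN (xw i).
  exact: (tame_cont tT wN xw x0 j).
Qed.

Lemma tameD g S T : tame g S -> tame g T -> tame g (fun x k => S x k + T x k).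
Proof.
move=> tS tT; split.
- exact: tame_gain tS.
- move=> c x y xt yt; apply/funext => k.
  by rewrite (tame_lin tS)// (tame_lin tT)// mulrDr addrACA.
- move=> N; have [K K0 SK] := tame_bound tS N; have [K' K'0 TK] := tame_bound tT N.
  exists (K + K'); first exact: addr_ge0.
  move=> w x wN xw m; apply: le_trans (normcD _ _) _.
  by rewrite !mulrDl lerD ?SK ?TK.
- move=> N w x wN xw x0 k; rewrite -[X in ccvg _ _ X]addr0.
  exact: ccvgD (tame_cont tS wN xw x0 k) (tame_cont tT wN xw x0 k).
Qed.

Lemma tameZ g c T : tame g T -> tame g (scaleop c T).
Proof.
move=> tT; rewrite /scaleop; split.
- exact: tame_gain tT.
- move=> d x y xt yt; apply/funext => k.
  by rewrite (tame_lin tT)// mulrDr mulrCA.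
- move=> N; have [K K0 TK] := tame_bound tT N.
  exists (normc c * K); first by rewrite mulr_ge0 ?normc_ge0.
  by move=> w x wN xw m; rewrite normcM -!mulrA ler_wpM2l ?normc_ge0// mulrA TK.
- move=> N w x wN xw x0 k; rewrite -(mulr0 c).
  exact: ccvgZ (tame_cont tT wN xw x0 k).
Qed.

Lemma tameB g S T : tame g S -> tame g T -> tame g (fun x k => S x k - T x k).
Proof.
move=> tS tT; have := tameD tS (tameZ (-1) tT); apply: tame_eq => x _.
by apply/funext => k; rewrite /scaleop mulN1r.
Qed.

Lemma tame_id : tame (fun=> 1) (@id (zseq R)).
Proof.
split=> //.
- by exists 0%N; exact: moderate_cst.
- by move=> N; exists 1 => // w x wN xw m; rewrite !mul1r.
Qed.

Lemma kernel_zpart_le M m C N w x : 0 <= C -> moderate N w -> bnd x w ->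
  (forall n, normc (M m n) <= C * jb (m - n) ^- (N + 2)) ->
  forall L, zpart (fun n => normc (M m n * x n)) L <= 4 * C * w m.
Proof.
move=> C0 [w0 wN] xw MC L.
apply: (@le_trans _ _ (zpart (fun n => (C * w m) * jb (m - n) ^- 2) L)).
  apply: ler_zpart => n; rewrite normcM.
  apply: (@le_trans _ _ (C * jb (m - n) ^- (N + 2) * (jb (m - n) ^+ N * w m))).
    by apply: ler_pM; rewrite ?normc_ge0//; exact: le_trans (xw n) (wN m n).
  rewrite exprD le_eqVlt; apply/orP; left; apply/eqP.
  have := @jbX_gt0 R (m - n) N; have := @jbX_gt0 R (m - n) 2.
  move: (_ ^+ N) (_ ^+ 2) => a b b0 a0.
  by field; rewrite !gt_eqF.
rewrite zpartZ (_ : 4 * C * w m = C * w m * 4); last by ring.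
by rewrite ler_wpM2l ?zpart_jbV2// mulr_ge0.
Qed.

Definition kbound g M := forall N, exists2 C, 0 <= C &
  forall m n, normc (M m n) <= C * g m * jb (m - n) ^- N.

Lemma kbound_zpart_le g M N Ng : moderate Ng g -> kbound g M ->
  exists2 C, 0 <= C & forall w x, moderate N w -> bnd x w ->
    forall m L, zpart (fun n => normc (M m n * x n)) L <= C * g m * w m.
Proof.
move=> [g0 _] /(_ (N + 2)%N) [C C0 MC]; exists (4 * C); first exact: mulr_ge0.
move=> w x wN xw m L.
by rewrite -(mulrA 4); apply: kernel_zpart_le (MC m) _; rewrite ?mulr_ge0.
Qed.

Lemma kbound_zdom g M x m : (exists N, moderate N g) -> kbound g M -> tempered x ->
  zdom (fun n => M m n * x n).
Proof.
move=> [Ng gN] MC [N [w [wN xw]]]; have [C C0 H] := kbound_zpart_le N gN MC.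
by exists (C * g m * w m); exact: H.
Qed.

(** Off-diagonal decay of order N + 2 pays for the variation of the weight,
    and leaves <m - n>^-2 for the summation. *)
Lemma tame_matact g M : (exists N, moderate N g) -> kbound g M ->
  tame g (matact M).
Proof.
move=> gN MC; split=> //.
- move=> c x y xt yt; apply/funext => m; rewrite /matact.
  have xd := kbound_zdom m gN MC xt; have yd := kbound_zdom m gN MC yt.
  rewrite -zsumZ// -zsumD//; last exact: zdomZ.
  by congr zsum; apply/funext => n; ring.
- move=> N; have [Ng gNg] := gN.
  have [C C0 H] := kbound_zpart_le N gNg MC; exists C => // w x wN xw m.
  by apply: zsum_normc_le; exact: H.
- move=> N w x wN xw x0 m.
  have -> : 0 = zsum (fun=> 0) :> R[i] by rewrite (zsum_single (k := 0)).
  have [Ng gNg] := gN; have [C C0 H] := kbound_zpart_le N gNg MC.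
  apply: (@zsum_tannery _ _ \oo _ (fun i n => M m n * x i n) (fun=> 0)
    (fun n => normc (M m n * (w n)%:C))).
  + exists (C * g m * w m) => L; apply: (H _ _ wN).
    by move=> k; rewrite normc_real ger0_norm// (moderate_ge0 _ wN).
  + apply: nearW => i k; rewrite !normcM ler_wpM2l ?normc_ge0//.
    by rewrite normc_real ger0_norm ?xw// (moderate_ge0 _ wN).
  + by move=> k; rewrite -(mulr0 (M m k)); exact: ccvgZ.
Qed.

Definition zdelta n : zseq R := fun k => (k == n)%:R.

Lemma bnd_zdelta N n : bnd (zdelta n) (fun k => jb (k - n) ^- N).
Proof.
move=> k; rewrite /zdelta; case: eqP => [->|_].
  by rewrite normc1 subrr jb0 expr1n invr1.
by rewrite normc0 jbV_ge0.
Qed.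

Lemma tempered_zdelta n : tempered (zdelta n).
Proof. exact: temperedP (moderate_jbV 0 n) (bnd_zdelta 0 n). Qed.

(** The basis vector at n is bounded by the weight <k - n>^-N for every N, and
    the bound on its image is the decay of the column. *)
Lemma tame_kbound g T : tame g T -> kbound g (fun m n => T (zdelta n) m).
Proof.
move=> tT N; have [K K0 TK] := tame_bound tT N; exists K => // m n.
exact: TK (moderate_jbV N n) (bnd_zdelta N n) m.
Qed.

(** Finite sums commute with the operator by linearity, and the symmetric
    partial sums are dominated by the weight, so that continuity applies. *)
Lemma tame_superposition g T N w (f : int -> zseq R) : tame g T -> moderate N w ->
  (forall k L, zpart (fun n => normc (f n k)) L <= w k) ->
  forall m, T (fun k => zsum (fun n => f n k)) m = zsum (fun n => T (f n) m).
Proof.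
move=> tT wN fw m; apply/esym/zsum_eq.
have fd k : zdom (fun n => f n k) by exists (w k).
have ft n : tempered (f n).
  apply: (temperedP wN) => k; apply: le_trans (fw k `|n|%N).
  have nP : (absz (n + `|n|%N%:Z)%R < (`|n|%N).*2.+1)%N by lia.
  rewrite /zpart (bigD1 (Ordinal nP))//=.
  have -> : (absz (n + `|n|%N%:Z)%R)%:Z - `|n|%N%:Z = n by lia.
  by rewrite lerDl; apply: sumr_ge0 => i _; exact: normc_ge0.
have -> : zpart (fun n => T (f n) m) =
    (fun L => T (fun k => zpart (fun n => f n k) L) m).
  by apply/funext => L; rewrite /zpart (tame_sum _ tT).
apply: (tame_cvg tT wN) => [L k|k]; last exact: zsum_cvg.
exact: le_trans (normc_zpart _ _) (fw k L).
Qed.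

(** Superposition of the columns, since x is the sum of x n times the basis
    vector at n. *)
Lemma tame_kernel g T x m : tame g T -> tempered x ->
  T x m = zsum (fun n => T (zdelta n) m * x n).
Proof.
move=> tT [N [w [wN xw]]].
pose f n : zseq R := fun k => x n * zdelta n k.
have fs k : forall n, n != k -> f n k = 0.
  by move=> n /negPf nk; rewrite /f /zdelta eq_sym nk mulr0.
have -> : T x m = T (fun k => zsum (fun n => f n k)) m.
  congr (T _ m); apply/funext => k; rewrite (zsum_single (fs k)).
  by rewrite /f /zdelta eqxx mulr1.
rewrite (tame_superposition tT wN) => [|k L].
  congr zsum; apply/funext => n.
  by rewrite /f (tameZ_seq _ tT) 1?mulrC//; exact: tempered_zdelta.
have [kL|Lk] := leqP `|k| L.
  rewrite (zpart_single (k := k))//.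
    by rewrite /f /zdelta eqxx mulr1.
  by move=> n /(fs k) ->; rewrite normc0.
rewrite /zpart big1 ?(moderate_ge0 _ wN)// => i _.
rewrite fs ?normc0//; apply/eqP => E.
by have := ltn_ord i; lia.
Qed.

Lemma cdom_bnd_sum (f : nat -> zseq R) w :
  (forall k L, \sum_(j < L) normc (f j k) <= w k) -> forall j, bnd (f j) w.
Proof.
move=> fw j k; apply: le_trans (fw k j.+1); rewrite big_ord_recr/= lerDr.
by apply: sumr_ge0 => i _; exact: normc_ge0.
Qed.

Lemma tame_csum g T N w (f : nat -> zseq R) : tame g T -> moderate N w ->
  (forall k L, \sum_(j < L) normc (f j k) <= w k) ->
  forall m, T (fun k => csum (fun j => f j k)) m = csum (fun j => T (f j) m).
Proof.
move=> tT wN fw m; apply/esym/csum_eq.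
have ft j : tempered (f j) := temperedP wN (cdom_bnd_sum fw j).
have -> : (fun L => \sum_(j < L) T (f j) m) =
    (fun L => T (fun k => \sum_(j < L) f j k) m).
  by apply/funext => L; rewrite (tame_sum _ tT).
apply: (tame_cvg tT wN) => [L k|k].
  exact: le_trans (normc_sum _ _ _) (fw k L).
by apply: csum_cvg; exists (w k).
Qed.

Lemma tame_filter_cvg g T I (F : set_system I) {FF : ProperFilter F} N w
    (y : I -> zseq R) x k : tame g T -> moderate N w ->
  (forall i, tempered (y i)) -> (\forall i \near F, bnd (y i) w) ->
  (forall n, ccvg F (y ^~ n) (x n)) -> ccvg F (fun i => T (y i) k) (T x k).
Proof.
move=> tT wN yt yw yx.
have xw : bnd x w.
  by move=> n; apply: (ccvg_normc_le (yx n)); apply: filterS yw => i; exact.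
rewrite (tame_kernel _ tT (temperedP wN xw)).
rewrite (_ : (fun i => _) = (fun i => zsum (fun n => T (zdelta n) k * y i n))).
  have wt : tempered (fun n => (w n)%:C).
    by apply: (temperedP wN) => n; rewrite normc_real ger0_norm// (moderate_ge0 _ wN).
  apply: (zsum_tannery (kbound_zdom k (tame_gain tT) (tame_kbound tT) wt)).
    apply: filterS yw => i yiw n; rewrite !normcM ler_wpM2l ?normc_ge0//.
    by rewrite normc_real ger0_norm// (moderate_ge0 _ wN).
  by move=> n; exact: ccvgZ.
by apply/funext => i; exact: tame_kernel tT (yt i).
Qed.

End TameOperators.

(** * Sobolev norms of sequences *)

Section SobolevNorms.
Context {R : realType}.
Implicit Types (k m n p : int) (N L : nat) (w : int -> R) (x y : zseq R).
Implicit Types (M : zmatrix R) (C D s c e r t : R) (a b u : int -> R).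

Lemma zpart_esum a : (forall k, 0 <= a k) -> forall c,
  (\esum_(k in [set: int]) (a k)%:E <= c%:E)%E <-> forall L, zpart a L <= c.
Proof.
move=> a0 c.
pose zbox L := [seq i%:Z - L%:Z | i <- iota 0 L.*2.+1].
have zboxE L : zpart a L = \sum_(k \in [set` zbox L]) a k.
  rewrite -fsbig_seq; last first.
    by rewrite map_inj_uniq ?iota_uniq// => i j /addIr[].
  rewrite /zpart big_map -[in RHS](subn0 L.*2.+1) -/(index_iota 0 _).
  by rewrite big_mkord.
split=> [H L|H].
- rewrite -lee_fin; apply: le_trans H; apply: esum_ge.
  exists [set` zbox L]; first by split=> //; exact: finite_seq.
  by rewrite fsumEFin; [rewrite zboxE|exact: finite_seq].
- apply: ge_ereal_sup => _ [A [finA _] <-].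
  move/finite_fsetP : (finA) => [X AX].
  pose L := (\max_(k <- finmap.enum_fset X) `|k|)%N.
  apply: (@le_trans _ _ (\sum_(k \in [set` zbox L]) (a k)%:E)%E); last first.
    by rewrite fsumEFin; [rewrite -zboxE lee_fin|exact: finite_seq].
  apply: lee_fsum_nneg_subset => //; first exact: finite_seq.
    move=> k; rewrite AX !inE/= => kX; apply/mapP.
    have kL : (`|k| <= L)%N by exact: (leq_bigmax_seq _ kX).
    exists (absz (k + L%:Z)%R); last by lia.
    by rewrite mem_iota; lia.
  by move=> k _; rewrite lee_fin.
Qed.

(** Cauchy-Schwarz for weights of total mass at most 4, which is the bound of
    zpart_jbV2: expand the sum of alpha_i (S / 4 - y_i)^2, where S is the sum on
    the left. *)
Lemma weighted_sqr_sum_le I (q : seq I) (alpha y : I -> R) :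
  (forall i, 0 <= alpha i) -> \sum_(i <- q) alpha i <= 4 ->
  (\sum_(i <- q) alpha i * y i) ^+ 2 <= 4 * \sum_(i <- q) alpha i * y i ^+ 2.
Proof.
move=> a0 a4; set S := \sum_(i <- q) _ * _; set B := \sum_(i <- q) _ * _.
have : 0 <= \sum_(i <- q) alpha i * (S / 4 - y i) ^+ 2.
  by apply: sumr_ge0 => i _; rewrite mulr_ge0// sqr_ge0.
have -> : \sum_(i <- q) alpha i * (S / 4 - y i) ^+ 2 =
    (S / 4) ^+ 2 * (\sum_(i <- q) alpha i) - S / 2 * S + B.
  rewrite /S /B !mulr_sumr -sumrB -big_split/=; apply: eq_bigr => i _.
  by field.
have : (S / 4) ^+ 2 * (\sum_(i <- q) alpha i) <= (S / 4) ^+ 2 * 4.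
  by rewrite ler_wpM2l// sqr_ge0.
by rewrite exprMn expr2; lra.
Qed.

(** The summand of the square of the h^s norm. *)
Definition hsq s x k : R := (jb k) `^ (2 * s) * normc (x k) ^+ 2.

Lemma hsq_ge0 s x k : 0 <= hsq s x k.
Proof. by rewrite mulr_ge0 ?powR_ge0// sqr_ge0. Qed.

Lemma hsqE s x k : hsq s x k = ((jb k) `^ s * normc (x k)) ^+ 2.
Proof.
by rewrite exprMn /hsq mulrC (mulrC 2) powRrM -[in X in _ `^ X]/(2%:R) powR_mulrn ?powR_ge0// mulrC.
Qed.

Lemma hnorm_le s x c : 0 <= c -> (hnorm s x <= c%:E)%E <->
  forall L, zpart (hsq s x) L <= c ^+ 2.
Proof.
move=> c0; rewrite -(zpart_esum (hsq_ge0 s x)).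
have e0 : (0 <= \esum_(k in [set: int]) (hsq s x k)%:E)%E.
  by apply: esum_ge0 => k _; rewrite lee_fin hsq_ge0.
rewrite /hnorm -/(hsq s x).
rewrite (_ : (\esum_(k in [set: int]) _)%E =
   (\esum_(k in [set: int]) (hsq s x k)%:E)%E)//.
move: e0; case: (\esum_(k in _) _)%E => [u||]//= u0.
- rewrite lee_fin in u0; rewrite !lee_fin powR12_sqrt//.
  have -> : (u <= c ^+ 2) = (Num.sqrt u <= c).
    by rewrite -{1}(sqr_sqrtr u0) ler_sqr ?nnegrE ?sqrtr_ge0.
  by split.
- by rewrite (_ : (2^-1 == 0 :> R) = false) ?invr_eq0 ?pnatr_eq0//; split.
Qed.

Lemma hnorm_ge0 s x : (0 <= hnorm s x)%E.
Proof. exact: poweR_ge0. Qed.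

Lemma in_hsP s x : in_hs s x ->
  exists2 c, hnorm s x = c%:E & 0 <= c /\ forall L, zpart (hsq s x) L <= c ^+ 2.
Proof.
rewrite /in_hs/=; have := hnorm_ge0 s x.
have := @hnorm_le s x; case: (hnorm s x) => [c||]//= H.
rewrite lee_fin => c0 _; exists c => //; split=> //.
by apply/H.
Qed.

Lemma in_hs_le s x c : 0 <= c -> (forall L, zpart (hsq s x) L <= c ^+ 2) -> in_hs s x.
Proof.
move=> c0 /(hnorm_le _ _ c0) H; rewrite /in_hs/=.
by apply: le_lt_trans H _; exact: ltry.
Qed.

Lemma zpart_incr a L L' : (forall k, 0 <= a k) -> (L <= L')%N ->
  zpart a L <= zpart a L'.
Proof.
move=> a0 /subnKC <-; rewrite !zpartE -addSn big_split_ord/= lerDl.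
by apply: sumr_ge0 => -[[|j] ?] _ /=; rewrite ?addr_ge0//; case: (_ + _)%N => [|i];
  rewrite /= ?addr_ge0.
Qed.

Lemma le_zpart_at a k L : (forall k, 0 <= a k) -> (`|k| <= L)%N -> a k <= zpart a L.
Proof.
move=> a0 kL; have iP : (absz (k + L%:Z)%R < L.*2.+1)%N by lia.
rewrite /zpart (bigD1 (Ordinal iP))//=.
have -> : (absz (k + L%:Z)%R)%:Z - L%:Z = k by lia.
by rewrite lerDl; apply: sumr_ge0.
Qed.

Lemma in_hs_bnd s x : 0 <= s -> in_hs s x -> exists2 c, 0 <= c & bnd x (fun=> c).
Proof.
move=> s0 /in_hsP[c _ [c0 xc]]; exists c => // k.
rewrite -ler_sqr ?nnegrE ?normc_ge0//.
apply: le_trans (xc `|k|%N); apply: le_trans (le_zpart_at (hsq_ge0 s x) (leqnn _)).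
rewrite /hsq -[leLHS]mul1r ler_wpM2r ?sqr_ge0// -[leLHS](powRr0 (jb k)).
by apply: ler_powR; [exact: jb_ge1|rewrite mulr_ge0].
Qed.

Lemma in_hs_tempered s x : 0 <= s -> in_hs s x -> tempered x.
Proof.
by move=> s0 /(in_hs_bnd s0)[c c0 xc]; exact: temperedP (moderate_cst 0 c0) xc.
Qed.

Lemma in_hs0 s x : 0 <= s -> in_hs s x -> in_hs 0 x.
Proof.
move=> s0 /in_hsP[c _ [c0 xc]]; apply: (in_hs_le c0) => L.
apply: le_trans (xc L); apply: ler_zpart => k.
rewrite /hsq ler_wpM2r ?sqr_ge0//; apply: ler_powR; first exact: jb_ge1.
by rewrite mulr0 mulr_ge0.
Qed.

(** Schur test.  The dominating sequence b is the same for all matrices with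
    the given decay; this uniformity is what yields continuity in time of the
    flows in l^2, by domination. *)
Lemma kernel_hsq_dominated N s x C c : 0 <= s -> s <= N%:R -> 0 <= C ->
  (forall L, zpart (hsq s x) L <= c ^+ 2) ->
  exists2 b, (forall L, zpart b L <= (4 * C * c) ^+ 2) &
    forall M m, (forall n, normc (M m n) <= C * jb (m - n) ^- (N + 2)) ->
      hsq s (matact M x) m <= b m.
Proof.
move=> s0 sN C0 xc.
pose u n := hsq s x n; have u0 n : 0 <= u n := hsq_ge0 s x n.
pose a m n : R := jb (m - n) ^- 2 * u n.
have a0 m n : 0 <= a m n by rewrite mulr_ge0// jbV_ge0.
have au m n : a m n <= u n by rewrite -[leRHS]mul1r ler_wpM2r// jbV_le1.
have am L m : zpart (a m) L <= c ^+ 2.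
  by apply: le_trans (xc L); exact: ler_zpart.
pose v m := zsum (fun n => (a m n)%:C).
have ad m : zdom (fun n => (a m n)%:C).
  exists (c ^+ 2) => L; apply: le_trans (am L m).
  by apply: ler_zpart => n; rewrite normc_real ger0_norm.
have normc_part m L : normc (zpart (fun n => (a m n)%:C) L) = zpart (a m) L.
  rewrite /zpart -rmorph_sum normc_real ger0_norm//.
  by apply: sumr_ge0.
have av m L : zpart (a m) L <= normc (v m).
  apply/ler_addgt0Pl => e e0.
  have [J _ HJ] := zsum_cvg (ad m) e0.
  apply: (@le_trans _ _ (zpart (a m) (maxn L J))).
    by apply: zpart_incr => //; exact: leq_maxl.
  rewrite -normc_part; set z := zpart _ _.
  rewrite -[z](subrK (v m)) (le_trans (normcD _ _))// lerD2r.
  by apply: HJ => /=; exact: leq_maxr.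
(* The double sum is exchanged on finite blocks only, for a row length K such
     that each of the finitely many rows is within d of its limit. *)
have va L : zpart (fun m => normc (v m)) L <= 4 * c ^+ 2.
  apply/ler_addgt0Pl => e e0.
  have [d d0 dL] : exists2 d : R, 0 < d & d *+ L.*2.+1 <= e.
    exists (e / L.*2.+1%:R); first by rewrite divr_gt0.
    by rewrite -[leLHS]mulr_natr -mulrA mulVf ?mulr1 ?pnatr_eq0.
  have H : \forall K \near \oo, forall i : 'I_(L.*2.+1),
      normc (v (i%:Z - L%:Z)) <= zpart (a (i%:Z - L%:Z)) K + d.
    apply: filter_forall => i.
    have := zsum_cvg (ad (i%:Z - L%:Z)) d0; apply: filterS => K HK.
    rewrite -normc_part -/(v _) in HK *.
    rewrite -lerBlDl; apply: le_trans HK.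
    rewrite normc_distC lerBlDr.
    by rewrite -{1}[v _](subrK (zpart (fun n => (a (i%:Z - L%:Z) n)%:C) K)) normcD.
  have [K _ /(_ K (leqnn K)) {}H] := H.
  apply: (@le_trans _ _ (zpart (fun m => zpart (a m) K + d) L)).
    by apply: ler_sum => i _; exact: H.
  rewrite zpartD addrC; apply: lerD.
    by rewrite /zpart sumr_const card_ord.
  rewrite /zpart exchange_big/=.
  apply: (@le_trans _ _ (zpart (fun n => 4 * u n) K)).
    apply: ler_sum => j _; rewrite /a -mulr_suml ler_wpM2r//.
    apply: le_trans (zpart_jbV2 (j%:Z - K%:Z) L).
    by apply: ler_sum => i _; rewrite jbB.
  by rewrite zpartZ ler_wpM2l.
exists (fun m => 4 * C ^+ 2 * normc (v m)) => [L|M m Mm].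
  rewrite zpartZ (_ : (4 * C * c) ^+ 2 = 4 * C ^+ 2 * (4 * c ^+ 2)); last by ring.
  by rewrite ler_wpM2l// mulr_ge0// sqr_ge0.
have [w wN xw] : exists2 w, moderate N w & bnd x w.
  exists (fun=> `|c|); first exact: moderate_cst.
  move=> k; rewrite -ler_sqr ?nnegrE ?normc_ge0// real_normK ?num_real//.
  apply: le_trans (xc `|k|%N).
  apply: le_trans (le_zpart_at (hsq_ge0 s x) (leqnn _)).
  rewrite /hsq -[leLHS]mul1r ler_wpM2r ?sqr_ge0// -[leLHS](powRr0 (jb k)).
  by apply: ler_powR; [exact: jb_ge1|rewrite mulr_ge0].
have Md : zdom (fun n => M m n * x n).
  by exists (4 * C * w m); exact: kernel_zpart_le wN xw Mm.
pose q := (jb m) `^ s.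
have q0 : 0 < q by rewrite powR_gt0// jb_gt0.
have key L : q * normc (zpart (fun n => M m n * x n) L) <=
    Num.sqrt (4 * C ^+ 2 * normc (v m)).
  have qz : 0 <= q * normc (zpart (fun n => M m n * x n) L) by rewrite mulr_ge0 ?normc_ge0 ?ltW.
  rewrite -(ger0_norm qz) -sqrtr_sqr ler_wsqrtr//.
  pose y n := (jb n) `^ s * normc (x n).
  have H : q * normc (zpart (fun n => M m n * x n) L) <=
      C * \sum_(i < L.*2.+1) jb (m - (i%:Z - L%:Z)) ^- 2 * y (i%:Z - L%:Z).
    apply: (@le_trans _ _ (q * zpart (fun n => normc (M m n * x n)) L)).
      by rewrite ler_wpM2l ?normc_zpart// ltW.
    rewrite /zpart !mulr_sumr; apply: ler_sum => i _.
    move: (_ - _) => n; rewrite /y normcM.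
    have qn : q <= jb (m - n) ^+ N * (jb n) `^ s.
      apply: (@le_trans _ _ ((jb (m - n) * jb n) `^ s)).
        apply: ge0_ler_powR; rewrite ?nnegrE ?mulr_ge0 ?jb_ge0//.
        by have := jbD (R := R) (m - n) n; rewrite subrK.
      rewrite powRM ?jb_ge0// ler_wpM2r ?powR_ge0// -powR_mulrn ?jb_ge0//.
      by apply: ler_powR => //; exact: jb_ge1.
    apply: (@le_trans _ _ ((jb (m - n) ^+ N * (jb n) `^ s) *
        (C * jb (m - n) ^- (N + 2) * normc (x n)))).
      apply: ler_pM => //; [exact: ltW| |].
      - by rewrite mulr_ge0 ?normc_ge0.
      - by rewrite ler_wpM2r ?normc_ge0.
    rewrite exprD le_eqVlt; apply/orP; left; apply/eqP.
    have := @jbX_gt0 R (m - n) N; have := @jbX_gt0 R (m - n) 2.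
    move: (_ ^+ N) (_ ^+ 2) => A B B0 A0.
    by field; rewrite !gt_eqF.
  apply: (@le_trans _ _ ((C * \sum_(i < L.*2.+1)
      jb (m - (i%:Z - L%:Z)) ^- 2 * y (i%:Z - L%:Z)) ^+ 2)).
    by rewrite lerXn2r ?nnegrE//; exact: le_trans qz H.
  rewrite exprMn (_ : 4 * C ^+ 2 * _ = C ^+ 2 * (4 * normc (v m))); last by ring.
  rewrite ler_wpM2l ?sqr_ge0//.
  apply: le_trans (weighted_sqr_sum_le (fun i : 'I_(L.*2.+1) => y (i%:Z - L%:Z)) _ _) _.
  - by move=> i; exact: jbV_ge0.
  - exact: zpart_jbV2.
  rewrite ler_wpM2l//; apply: le_trans (av m L); apply: ler_sum => i _.
  by rewrite /a /u hsqE.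
rewrite hsqE -/q.
rewrite -[leRHS](@sqr_sqrtr R) ?mulr_ge0 ?sqr_ge0 ?normc_ge0//.
rewrite lerXn2r ?nnegrE ?sqrtr_ge0 ?mulr_ge0 ?normc_ge0 ?(ltW q0)//.
rewrite -ler_pdivlMl// mulrC; apply: (ccvg_normc_le (zsum_cvg Md)).
by apply: nearW => L; rewrite ler_pdivlMr// mulrC.
Qed.

Lemma kernel_hnorm_le N s M x C : 0 <= s -> s <= N%:R -> 0 <= C ->
  (forall m n, normc (M m n) <= C * jb (m - n) ^- (N + 2)) -> in_hs s x ->
  (hnorm s (matact M x) <= (4 * C)%:E * hnorm s x)%E.
Proof.
move=> s0 sN C0 MC /in_hsP[c -> [c0 xc]].
have [b bc Mb] := kernel_hsq_dominated s0 sN C0 xc.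
rewrite -EFinM; apply/hnorm_le; first by rewrite !mulr_ge0.
move=> L; apply: le_trans (bc L); apply: ler_zpart => m; exact: Mb.
Qed.

(** Dominated convergence for the h^s norm. *)
Lemma hnorm_cvg0 I (F : set_system I) {FF : Filter F} (y : I -> zseq R) b s c :
  (forall L, zpart b L <= c) -> (\forall i \near F, forall k, hsq s (y i) k <= b k) ->
  (forall k, 0 <= b k) -> (forall k, ccvg F (y ^~ k) 0) ->
  hnorm s (y i) @[i --> F] --> 0%E.
Proof.
move=> bc yb b0 y0.
have near_le e : 0 < e -> \forall i \near F, (hnorm s (y i) <= e%:E)%E.
  move=> e0; have e2 : 0 < e ^+ 2 by rewrite exprn_gt0.
  have zb0 j : 0 <= zfold b j by case: j => [|j] /=; rewrite ?addr_ge0.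
  have zb : summ (zfold b) by apply: summ_zfold => //; exists c.
  have H := @tannery_core R I F _ (fun i => zfold (hsq s (y i))) _ zb0 zb.
  near=> i; apply/hnorm_le; first exact: ltW.
  move=> L; rewrite zpartE.
  have : forall j, 0 <= zfold (hsq s (y i)) j.
    by case=> [|j] /=; rewrite ?addr_ge0 ?hsq_ge0.
  move: L.+1; near: i; apply: H => //.
  - by apply: filterS yb => i yib [|j] /=; rewrite ?lerD.
  - have single k d : 0 < d -> \forall i \near F, hsq s (y i) k <= d.
      move=> d0; pose q := (jb k : R) `^ s.
      have q0 : 0 < q by rewrite powR_gt0// jb_gt0.
      have dq : 0 < Num.sqrt d / q by rewrite divr_gt0// sqrtr_gt0.
      have := y0 k _ dq; apply: filterS => i; rewrite subr0 => yi.
      rewrite hsqE -/q -[leRHS](@sqr_sqrtr R) ?(ltW d0)//.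
      rewrite lerXn2r ?nnegrE ?sqrtr_ge0 ?mulr_ge0 ?normc_ge0 ?(ltW q0)//.
      by rewrite mulrC -ler_pdivlMr.
    move=> [|j] d d0 /=; first exact: single.
    have d2 : 0 < d / 2 by rewrite divr_gt0.
    near=> i; rewrite [leRHS](splitr d) lerD//; near: i; exact: single.
apply/fine_cvgP; split.
  apply: filterS (near_le 1 ltr01) => i yi; rewrite fin_numE.
  by move: (hnorm_ge0 s (y i)) yi; case: (hnorm s (y i)).
apply/cvgrPdist_le => e e0; apply: filterS (near_le e e0) => i.
have := hnorm_ge0 s (y i); rewrite /=; case: (hnorm s (y i)) => [u||]//=.
by rewrite !lee_fin sub0r normrN => u0; rewrite ger0_norm.
Unshelve. all: by end_near. Qed.

End SobolevNorms.

(** * Exponentials of bounded operators *)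

Section Exponential.
Context {R : realType}.
Implicit Types (k m n p : int) (N L i j : nat) (g w : int -> R) (x y : zseq R).
Implicit Types (T : zoperator R) (c : R[i]) (a K : R).

Definition bounded_op T := tame (fun=> 1) T.

Lemma bounded_bnd T N : bounded_op T -> exists2 K, 0 <= K & forall w x,
  moderate N w -> bnd x w -> bnd (T x) (fun m => K * w m).
Proof.
move=> /tame_bound/(_ N)[K K0 TK]; exists K => // w x wN xw m.
by have := TK w x wN xw m; rewrite mulr1.
Qed.

Lemma bounded_comp S T : bounded_op S -> bounded_op T -> bounded_op (S \o T).
Proof.
by move=> bS bT; have := tame_comp bS bT; under eq_fun do rewrite mulr1.
Qed.

Lemma bounded_iter T j : bounded_op T -> bounded_op (iter j T).
Proof.
by move=> bT; elim: j => [|j IH]; [exact: tame_id|exact: bounded_comp bT IH].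
Qed.

Lemma bounded_gain g T N : moderate N g -> (forall k, g k <= 1) -> tame g T ->
  bounded_op T.
Proof.
move=> gN g1; apply: (tame_le ler01); last by move=> k; rewrite mul1r.
by exists 0%N; exact: moderate_cst.
Qed.

Lemma iter_bnd T N K w x j :
  (forall w x, moderate N w -> bnd x w -> bnd (T x) (fun m => K * w m)) ->
  0 <= K -> moderate N w -> bnd x w -> bnd (iter j T x) (fun m => K ^+ j * w m).
Proof.
move=> TK K0 wN xw; elim: j => [|j IH] m /=; first by rewrite mul1r.
rewrite exprS -mulrA; apply: TK IH m.
by apply: moderateZ; rewrite ?exprn_ge0.
Qed.

Lemma exp_sum_le a N : 0 <= a -> \sum_(j < N) a ^+ j / j`!%:R <= expR a.
Proof.
move=> a0; have := nondecreasing_cvgn_le _ (is_cvg_series_exp_coeff a) N.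
rewrite /series/= big_mkord; apply.
by apply: nondecreasing_series => n _ _; exact: exp_coeff_ge0.
Qed.

Definition exp_term T x k j : R[i] := (j`!%:R)^-1 * iter j T x k.

Lemma expopE T x k : expop T x k = csum (exp_term T x k).
Proof. by []. Qed.

Lemma normc_fact j : normc ((j`!%:R : R[i])^-1) = (j`!%:R)^-1.
Proof. by rewrite normcV normc_nat. Qed.

Lemma exp_term_le T N K w x k j :
  (forall w x, moderate N w -> bnd x w -> bnd (T x) (fun m => K * w m)) ->
  0 <= K -> moderate N w -> bnd x w ->
  normc (exp_term T x k j) <= w k * (K ^+ j / j`!%:R).
Proof.
move=> TK K0 wN xw; rewrite /exp_term normcM normc_fact mulrA mulrC.
by rewrite ler_wpM2r ?invr_ge0// mulrC; exact: iter_bnd TK K0 wN xw k.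
Qed.

Lemma summ_exp (b K : R) : 0 <= b -> 0 <= K -> summ (fun j => b * (K ^+ j / j`!%:R)).
Proof.
by move=> b0 K0; exists (b * expR K) => N; rewrite -mulr_sumr ler_wpM2l// exp_sum_le.
Qed.

Lemma exp_term_cdom T x k : bounded_op T -> tempered x -> cdom (exp_term T x k).
Proof.
move=> bT [N [w [wN xw]]]; have [K K0 TK] := bounded_bnd N bT.
apply: cdomP (fun j => exp_term_le k j TK K0 wN xw) _.
exact: summ_exp (moderate_ge0 k wN) K0.
Qed.

Lemma bounded_expop T : bounded_op T -> bounded_op (expop T).
Proof.
move=> bT; split.
- by exists 0%N; exact: moderate_cst.
- move=> c x y xt yt; apply/funext => k; rewrite !expopE.
  rewrite -csumZ; last exact: exp_term_cdom.
  rewrite -csumD; [|exact: exp_term_cdom|apply: cdomZ; exact: exp_term_cdom].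
  congr csum; apply/funext => j; rewrite /exp_term.
  by rewrite (tame_lin (bounded_iter j bT))//; ring.
- move=> N; have [K K0 TK] := bounded_bnd N bT.
  exists (expR K); first exact: expR_ge0.
  move=> w x wN xw k; rewrite mulr1 expopE; apply: csum_normc_le => L.
  apply: (@le_trans _ _ (w k * \sum_(j < L) K ^+ j / j`!%:R)).
    rewrite mulr_sumr; apply: ler_sum => j _; exact: exp_term_le TK K0 wN xw.
  by rewrite mulrC ler_wpM2r ?exp_sum_le// (moderate_ge0 k wN).
- move=> N w x wN xw x0 k; have [K K0 TK] := bounded_bnd N bT.
  have -> : 0 = csum (fun=> 0) :> R[i].
    apply/esym/csum_eq; under eq_fun do rewrite big1//.
    exact: ccvg_cst.
  apply: (@csum_tannery _ _ \oo _ (fun i => exp_term T (x i) k) (fun=> 0) _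
    (summ_exp (moderate_ge0 k wN) K0)).
  + by apply: nearW => i j; exact: exp_term_le TK K0 wN (xw i).
  + move=> j; rewrite -(mulr0 ((j`!%:R)^-1)); apply: ccvgZ.
    exact: (tame_cont (bounded_iter j bT) wN xw x0 k).
Qed.

(** The terms of the exponential series of index j + 2 are iterates of T applied
    to the image of T o T, whose gain they keep. *)
Lemma expop_second_order T (g : int -> R) (M : nat) : bounded_op T ->
  moderate M g -> tame g (T \o T) ->
  tame g (fun x k => expop T x k - x k - T x k).
Proof.
move=> bT gM tTT.
have bE := bounded_expop bT.
apply: tame_strengthen (tameB (tameB bE tame_id) bT) _; first by exists M.
move=> N; have [K2 K20 TT] := tame_bnd N tTT.
have [K K0 TK] := bounded_bnd (M + N) bT.
exists (K2 * expR K); first by rewrite mulr_ge0// expR_ge0.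
move=> w x wN xw k.
have xt := temperedP wN xw.
have w'N := moderate_gain K20 gM wN.
have H : ccvg \oo (fun L => \sum_(j < L) exp_term T x k j.+2)
    (expop T x k - x k - T x k).
  move=> e /(csum_cvg (exp_term_cdom k bT xt)) [J _ HJ]; exists J => // L /= JL.
  have := HJ L.+2 (leqW (leqW JL)).
  rewrite /= 2!big_ord_recl /= /exp_term /= !fact0 /= (_ : 1`! = 1%N)// !invr1 !mul1r.
  by rewrite -!expopE /= => Hle; apply: le_trans Hle; rewrite le_eqVlt;
    apply/orP; left; apply/eqP; congr normc; rewrite /bump/=; ring.
apply: (ccvg_normc_le H); apply: nearW => L.
apply: le_trans (normc_sum _ _ _) _.
have -> : K2 * expR K * g k * w k = (K2 * g k * w k) * expR K by ring.
apply: (@le_trans _ _ ((K2 * g k * w k) * \sum_(j < L) K ^+ j / j`!%:R)).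
  rewrite mulr_sumr; apply: ler_sum => j _.
  rewrite /exp_term normcM normc_fact.
  have -> : iter j.+2 T x = iter j T ((T \o T) x) by rewrite -!iterSr.
  have := iter_bnd j TK K0 w'N (TT _ _ wN xw) k.
  move=> Hi.
  have -> : K2 * g k * w k * (K ^+ j / j`!%:R) =
      j`!%:R^-1 * (K ^+ j * (K2 * g k * w k)) by ring.
  apply: ler_pM; rewrite ?normc_ge0 ?invr_ge0//.
  rewrite lef_pV2 ?posrE ?ltr0n ?fact_gt0// ler_nat !factS.
  by rewrite -[leqLHS]mul1n mulnA leq_mul.
by rewrite ler_wpM2l ?exp_sum_le// (moderate_ge0 k w'N).
Qed.

Lemma iter_scaleop T c j x : bounded_op T -> tempered x ->
  iter j (scaleop c T) x = (fun k => c ^+ j * iter j T x k).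
Proof.
move=> bT xt; elim: j => [|j IH]; first by apply/funext => k; rewrite mul1r.
rewrite iterS IH /scaleop (tameZ_seq _ bT); last first.
  exact: tame_tempered (bounded_iter j bT) xt.
by apply/funext => k; rewrite mulrA exprS.
Qed.

(** The Cauchy product of the series of exp(c) and exp(-c): the antidiagonal of
    index n > 0 vanishes by the binomial formula for (c - c)^n. *)
Lemma triangular_exp c N (z : nat -> R[i]) : (0 < N)%N ->
  \sum_(i < N) \sum_(j < N - i) (i`!%:R)^-1 * c ^+ i *
    ((j`!%:R)^-1 * (- c) ^+ j) * z (i + j)%N = z 0%N.
Proof.
case: N => // N _; elim: N => [|N IH].
  by rewrite !big_ord_recl !big_ord0 /= fact0 invr1 !expr0 !mul1r !addr0.
under eq_bigr => i _ do rewrite (subSn (leq_ord i)) big_ord_recr /=.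
rewrite big_split /= big_ord_recr /= subnn big_ord0 addr0 IH.
rewrite -[RHS]addr0; congr (_ + _).
have E i : (i <= N.+1)%N -> (i`!%:R)^-1 * c ^+ i *
   (((N.+1 - i)`!%:R)^-1 * (- c) ^+ (N.+1 - i)) * z (i + (N.+1 - i))%N =
   (N.+1`!%:R)^-1 * z N.+1 * (((- c) ^+ (N.+1 - i) * c ^+ i) *+ 'C(N.+1, i)).
  move=> iN; rewrite subnKC// -mulr_natr.
  have := bin_fact iN => /(congr1 (fun n : nat => n%:R : R[i])).
  rewrite !natrM => <-.
  have f1 : (i`!%:R : R[i]) != 0 by rewrite pnatr_eq0 -lt0n fact_gt0.
  have f2 : ((N.+1 - i)`!%:R : R[i]) != 0 by rewrite pnatr_eq0 -lt0n fact_gt0.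
  have f3 : ('C(N.+1, i)%:R : R[i]) != 0 by rewrite pnatr_eq0 -lt0n bin_gt0.
  by field; rewrite f1 f2 f3.
transitivity (\sum_(i < N.+2) (N.+1`!%:R)^-1 * z N.+1 *
    (((- c) ^+ (N.+1 - i) * c ^+ i) *+ 'C(N.+1, i))).
  by apply: eq_bigr => i _; apply: E; exact: leq_ord.
by rewrite -mulr_sumr -exprDn addNr expr0n mulr0.
Qed.

(** The truncation of the outer series to M terms is evaluated, in its term i, at
    the inner series truncated to M - i terms.  These triangular truncations
    are exactly equal to x, and they converge to the composition by
    domination. *)
Lemma expop_cancel T c x : bounded_op T -> tempered x ->
  expop (scaleop c T) (expop (scaleop (- c) T) x) = x.
Proof.
move=> bT xt.
have bTN := tameZ (- c) bT; have bTc := tameZ c bT.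
set y := expop (scaleop (- c) T) x.
have [N [w [wN xw]]] := xt.
have [K K0 TK] := bounded_bnd N bTN.
pose Y M : zseq R := fun k => \sum_(j < M) exp_term (scaleop (- c) T) x k j.
have Yw M : bnd (Y M) (fun k => expR K * w k).
  move=> k; apply: le_trans (normc_sum _ _ _) _.
  apply: (@le_trans _ _ (w k * \sum_(j < M) K ^+ j / j`!%:R)).
    rewrite mulr_sumr; apply: ler_sum => j _; exact: exp_term_le TK K0 wN xw.
  by rewrite mulrC ler_wpM2r ?exp_sum_le// (moderate_ge0 k wN).
have w'N := moderateZ (expR_ge0 K) wN.
have Yy k : ccvg \oo (Y ^~ k) (y k).
  by apply: csum_cvg; exact: exp_term_cdom.
have [K' K'0 TK'] := bounded_bnd N bTc.
apply/funext => k.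
pose f M i : R[i] := if (i < M)%N then exp_term (scaleop c T) (Y (M - i)%N) k i else 0.
have f1 : ccvg \oo (fun M => csum (f M)) (expop (scaleop c T) y k).
  rewrite expopE.
  apply: (csum_tannery (summ_exp (moderate_ge0 k w'N) K'0)).
    apply: nearW => M i; rewrite /f; case: ifP => _.
      exact: exp_term_le TK' K'0 w'N (Yw _).
    rewrite normc0 mulr_ge0 ?(moderate_ge0 _ w'N)// divr_ge0 ?exprn_ge0//.
  move=> i; rewrite /f.
  have H : ccvg \oo (fun M => exp_term (scaleop c T) (Y M) k i)
      (exp_term (scaleop c T) y k i).
    by apply: ccvgZ; exact: tame_cvg (bounded_iter i bTc) w'N Yw Yy k.
  move=> e /H [J _ HJ]; exists (i.+1 + J)%N => // M /= JM.
  have -> : (i < M)%N by apply: leq_trans JM; rewrite ltnS leq_addr.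
  by apply: HJ => /=; rewrite leq_subRL; [apply: leq_trans JM; rewrite leq_add2r|
    apply: leq_trans JM; rewrite (leq_trans (leqnSn i))// leq_addr].
have f2 : ccvg \oo (fun M => csum (f M)) (x k).
  move=> e e0; exists 1%N => // M /= M1.
  suff -> : csum (f M) = x k by rewrite subrr normc0 ltW.
  apply: csum_eq => d d0; exists M => // L /= ML.
  suff -> : \sum_(j < L) f M j = x k by rewrite subrr normc0 ltW.
  rewrite -(subnKC ML) big_split_ord /= [X in _ + X]big1 ?addr0; last first.
    by move=> i _; rewrite /f ltnNge leq_addr.
  rewrite -[RHS](triangular_exp c (fun j => iter j T x k) M1).
  apply: eq_bigr => i _; rewrite /f ltn_ord /exp_term.
  have Yt : tempered (Y (M - i)%N) := temperedP w'N (Yw _).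
  rewrite (iter_scaleop _ _ bT Yt) /Y (tame_sum _ (bounded_iter i bT)); last first.
    move=> j; rewrite /exp_term; apply: temperedZ.
    exact: tame_tempered (bounded_iter _ bTN) xt.
  rewrite mulrA mulr_sumr; apply: eq_bigr => j _.
  rewrite /exp_term (iter_scaleop _ _ bT xt).
  have it := tame_tempered (bounded_iter j bT) xt.
  rewrite (tameZ_seq _ (bounded_iter i bT)); last exact: temperedZ.
  by rewrite (tameZ_seq _ (bounded_iter i bT))// iterD !mulrA.
exact: ccvg_unique f1 f2.
Qed.

End Exponential.

(** * Decay of Fourier coefficients *)

Section FourierDecay.
Context {R : realType}.
Notation mu := (@lebesgue_measure R).
Implicit Types (f g F G V : R -> R) (x a b : R) (k m n p : int).

Lemma is_derive_continuous f g : (forall x, is_derive x (1 : R) f (g x)) ->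
  continuous f.
Proof.
by move=> fg x; apply: differentiable_continuous; apply/derivable1_diffP; have [] := fg x.
Qed.

Lemma continuous_integrable f a b : continuous f -> mu.-integrable `[a, b] (EFin \o f).
Proof.
move=> cf; apply: continuous_compact_integrable; first exact: segment_compact.
exact: continuous_subspaceT.
Qed.

Lemma integration_by_parts_global F G f g a b : a < b ->
  (forall x, is_derive x (1 : R) F (f x)) -> (forall x, is_derive x (1 : R) G (g x)) ->
  continuous f -> continuous g ->
  \int[mu]_(x in `[a, b]) (F x * g x) =
    (F b * G b - F a * G a) - \int[mu]_(x in `[a, b]) (f x * G x).
Proof.
move=> ab Ff Gg cf cg.
have LR (H h : R -> R) : (forall x, is_derive x (1 : R) H (h x)) ->
    derivable_oo_LRcontinuous H a b.
  move=> Hh; have cH := is_derive_continuous Hh; split.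
  - by move=> x _; have [] := Hh x.
  - exact: cvg_at_right_filter (cH a).
  - exact: cvg_at_left_filter (cH b).
apply: Rintegration_by_parts => //.
- exact: continuous_subspaceT.
- exact: LR Ff.
- by move=> x _; rewrite derive1E; have [_ ->] := Ff x.
- exact: continuous_subspaceT.
- exact: LR Gg.
- by move=> x _; rewrite derive1E; have [_ ->] := Gg x.
Qed.

Lemma smooth_is_derive f x : smooth f -> is_derive x (1 : R) f (derive1 f x).
Proof. by move=> /(_ 0%N x) df; apply: DeriveDef => //; rewrite derive1E. Qed.

Lemma smooth_derive1 f : smooth f -> smooth (derive1 f).
Proof. by move=> sf n x; have := sf n.+1 x; rewrite /derive1n iterSr. Qed.

Lemma smooth_continuous f : smooth f -> continuous f.
Proof. by move=> sf; apply: is_derive_continuous => x; exact: smooth_is_derive. Qed.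

(** Periodicity is inherited by the derivative because the difference quotients
    are periodic. *)
Lemma torus_fun_derive1 f : torus_fun f -> torus_fun (derive1 f).
Proof.
move=> tf x; rewrite /derive1; congr (lim _).
rewrite (_ : (fun h : R => _) = (fun h => h^-1 *: (f (h + x) - f x)))//.
by apply/funext => h; rewrite addrA !tf.
Qed.

Lemma cexpi_period k : cexpi (k%:~R * (2 * pi)) = 1 :> R[i].
Proof.
have c2pi : cexpi (2 * pi) = 1 :> R[i].
  by rewrite /cexpi mulrC -[pi * 2]/(pi * 2%:R) mulr_natr cos2pi sin2pi.
have natcase (n : nat) : cexpi (n%:R * (2 * pi)) = 1 :> R[i].
  elim: n => [|n IH]; first by rewrite mul0r cexpi0.
  by rewrite -natr1 mulrDl cexpiD IH mul1r mul1r c2pi.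
case: k => n; first exact: natcase.
rewrite NegzE mulrNz mulNr.
by have := cexpiN (n.+1%:R * (2 * pi) : R); rewrite natcase mulr1.
Qed.

Lemma cos_period k : cos (k%:~R * (2 * pi)) = 1 :> R.
Proof. by have /(congr1 (@complex.Re R)) := cexpi_period k. Qed.

Lemma sin_period k : sin (k%:~R * (2 * pi)) = 0 :> R.
Proof. by have /(congr1 (@complex.Im R)) := cexpi_period k. Qed.

Definition cosint f k := \int[mu]_(x in `[0, 2 * pi]) (cos (k%:~R * x) * f x).
Definition sinint f k := \int[mu]_(x in `[0, 2 * pi]) (sin (k%:~R * x) * f x).

Let twopi_gt0 : 0 < 2 * pi :> R.
Proof. by rewrite mulr_gt0// pi_gt0. Qed.

Lemma is_derive_cosk (c x : R) :
  is_derive x (1 : R) (fun r => cos (c * r)) (- sin (c * x) * c).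
Proof. exact: is_derive1_comp (is_derive_cos _) (is_derive1_mull c x). Qed.

Lemma is_derive_sink (c x : R) :
  is_derive x (1 : R) (fun r => sin (c * r)) (cos (c * x) * c).
Proof. exact: is_derive1_comp (is_derive_sin _) (is_derive1_mull c x). Qed.

Lemma continuous_cosk (c : R) : continuous (fun r : R => cos (c * r)).
Proof. exact: is_derive_continuous (is_derive_cosk c). Qed.

Lemma continuous_sink (c : R) : continuous (fun r : R => sin (c * r)).
Proof. exact: is_derive_continuous (is_derive_sink c). Qed.

Lemma continuous_mul f g : continuous f -> continuous g ->
  continuous (fun x => f x * g x).
Proof. by move=> cf cg x; apply: cvgM; [exact: cf|exact: cg]. Qed.

(** Integration by parts over a period: the boundary terms vanish. *)
Lemma cosint_parts f k : smooth f -> torus_fun f ->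
  sinint (derive1 f) k = - (k%:~R * cosint f k).
Proof.
move=> sf tf; have sf' := smooth_derive1 sf.
have cf := smooth_continuous sf; have cf' := smooth_continuous sf'.
have := @integration_by_parts_global (fun r => sin (k%:~R * r)) f
  (fun r => cos (k%:~R * r) * k%:~R) (derive1 f) 0 (2 * pi) twopi_gt0
  (is_derive_sink _) (fun x => smooth_is_derive x sf).
rewrite sin_period mulr0 sin0 !mul0r subrr sub0r => H.
rewrite {1}/sinint H//; last first.
  by apply: continuous_mul; [exact: continuous_cosk|exact: cst_continuous].
congr (- _); rewrite /cosint -RintegralZl//; last first.
  by apply: continuous_integrable; apply: continuous_mul => //; exact: continuous_cosk.
by apply: eq_Rintegral => x _; rewrite mulrAC mulrC mulrA.
Qed.

Lemma sinint_parts f k : smooth f -> torus_fun f ->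
  cosint (derive1 f) k = k%:~R * sinint f k.
Proof.
move=> sf tf; have sf' := smooth_derive1 sf.
have cf := smooth_continuous sf; have cf' := smooth_continuous sf'.
have := @integration_by_parts_global (fun r => cos (k%:~R * r)) f
  (fun r => - sin (k%:~R * r) * k%:~R) (derive1 f) 0 (2 * pi) twopi_gt0
  (is_derive_cosk _) (fun x => smooth_is_derive x sf).
have f2 : f (2 * pi) = f 0 by have := tf 0; rewrite add0r.
rewrite cos_period mulr0 cos0 !mul1r f2 subrr sub0r => H.
rewrite {1}/cosint H//; last first.
  apply: continuous_mul; last exact: cst_continuous.
  by move=> x; apply: cvgN; exact: continuous_sink.
rewrite /sinint -RintegralZl//; last first.
  by apply: continuous_integrable; apply: continuous_mul => //; exact: continuous_sink.
rewrite -[LHS]mulN1r -RintegralZl//; last first.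
  apply: continuous_integrable; apply: continuous_mul => //.
  apply: continuous_mul; last exact: cst_continuous.
  by move=> x; apply: cvgN; exact: continuous_sink.
by apply: eq_Rintegral => x _; ring.
Qed.

(** Each integration by parts gains a factor 1 / k, and the derivative of f
    satisfies the same hypotheses as f. *)
Lemma trig_integral_decay N f : smooth f -> torus_fun f ->
  exists2 C, 0 <= C & forall k,
    `|cosint f k| <= C * jb k ^- N /\ `|sinint f k| <= C * jb k ^- N.
Proof.
elim: N f => [|N IH] f sf tf.
  have cf := smooth_continuous sf.
  have cnf : continuous (fun x => `|f x|).
    by move=> x; apply: cvg_norm; exact: cf.
  have bound (h : R -> R) : continuous h -> (forall x, `|h x| <= 1) ->
      `|\int[mu]_(x in `[0, 2 * pi]) (h x * f x)| <=
        \int[mu]_(x in `[0, 2 * pi]) `|f x|.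
    move=> ch h1.
    apply: le_trans (le_normr_Rintegral _ _) _ => //.
      by apply: continuous_integrable; exact: continuous_mul.
    apply: le_Rintegral => //.
    - apply: (@continuous_integrable (fun x => `|h x * f x|)) => x.
      by apply: cvg_norm; exact: continuous_mul.
    - exact: continuous_integrable.
    - by move=> x _; rewrite normrM -[leRHS]mul1r ler_wpM2r.
  exists (\int[mu]_(x in `[0, 2 * pi]) `|f x|).
    by apply: Rintegral_ge0 => x _.
  move=> k; rewrite expr0 invr1 mulr1; split; apply: bound.
  - exact: continuous_cosk.
  - by move=> x; rewrite ler_norml cos_geN1 cos_le1.
  - exact: continuous_sink.
  - by move=> x; rewrite ler_norml sin_geN1 sin_le1.
have [C C0 HC] := IH _ (smooth_derive1 sf) (torus_fun_derive1 tf).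
have [C' C'0 HC'] := IH f sf tf.
exists (C' + 2 * C); first by rewrite addr_ge0// mulr_ge0.
move=> k; have [k0|k0] := eqVneq k 0.
  rewrite k0 jb0 expr1n invr1 mulr1.
  have := HC' 0; rewrite jb0 expr1n invr1 mulr1 => -[c s].
  by split; [apply: le_trans c _|apply: le_trans s _]; rewrite lerDl mulr_ge0.
have kR : (1 : R) <= `|k%:~R| by rewrite -intr_norm (ler_int R 1); lia.
have step (u v : R) : `|v| <= C * jb k ^- N -> `|v| = `|k%:~R| * `|u| ->
    `|u| <= (C' + 2 * C) * jb k ^- N.+1.
  move=> vC vu.
  have u1 : `|u| <= 2 * (C * jb k ^- N) / jb k.
    rewrite ler_pdivlMr ?jb_gt0//.
    have : `|u| * jb k <= 2 * (`|k%:~R| * `|u|).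
      rewrite /jb intr_norm mulrDr mulr1.
      have : 1 * `|u| <= `|k%:~R| * `|u| by rewrite ler_wpM2r.
      lra.
    by move=> /le_trans; apply; rewrite -vu ler_pM2l.
  apply: le_trans u1 _; rewrite exprS invfM mulrDl.
  have : 0 <= C' * ((jb k)^-1 * jb k ^- N) :> R.
    by rewrite !mulr_ge0 ?invr_ge0 ?jb_ge0 ?jbX_ge0.
  lra.
split.
- apply: step (HC k).2 _; rewrite cosint_parts// normrN normrM//.
- apply: step (HC k).1 _; rewrite sinint_parts// normrM//.
Qed.

Lemma fourierE V k : continuous V ->
  fourier V k = ((2 * pi)^-1)%:C * (cosint V k +i* - sinint V k).
Proof.
move=> cV; rewrite /fourier /cintegral; congr (_ * (_ +i* _)).
- by apply: eq_Rintegral => x _ /=; rewrite cosN mulr0 subr0.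
- rewrite /sinint -mulN1r -RintegralZl//; last first.
    by apply: continuous_integrable; apply: continuous_mul => //; exact: continuous_sink.
  by apply: eq_Rintegral => x _ /=; rewrite sinN mulr0 add0r mulN1r mulNr.
Qed.

Lemma fourier_decay V N : torus_fun V -> smooth V ->
  exists2 C, 0 <= C & forall k, normc (fourier V k) <= C * jb k ^- N.
Proof.
move=> tV sV; have [C C0 HC] := trig_integral_decay N sV tV.
exists ((2 * pi)^-1 * (C + C)).
  by rewrite mulr_ge0 ?addr_ge0// invr_ge0 ltW.
move=> k; rewrite fourierE; last exact: smooth_continuous.
rewrite normcM normc_real ger0_norm ?invr_ge0 ?(ltW twopi_gt0)//.
rewrite -mulrA ler_wpM2l ?invr_ge0 ?(ltW twopi_gt0)//.
apply: le_trans (normc_le_ReIm _) _; rewrite /= normrN mulrDl.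
by have [c s] := HC k; exact: lerD.
Qed.

End FourierDecay.

(** * The operators A, B, X, Z and R *)

Section SchrodingerOperators.
Context {R : realType}.
Variable V : R -> R.
Hypotheses (V_torus : torus_fun V) (V_smooth : smooth V).
Implicit Types (k m n p : int) (N : nat) (g : int -> R) (x y : zseq R).
Implicit Types (T : zoperator R).

Let jbV_moderate : exists N, moderate N (fun k => (jb k)^-1 : R).
Proof.
exists 1%N; have := @moderate_jbV R 1 0.
by rewrite (_ : (fun k => _) = (fun k => (jb k)^-1))//; apply/funext => k; rewrite subr0.
Qed.

Lemma opAE x m : opA x m = (`|m| ^+ 2)%:~R * x m.
Proof.
rewrite /opA /matact (zsum_single (k := m)); first by rewrite /matA eqxx mulr1.
by move=> n /negPf nm; rewrite /matA eq_sym nm mulr0 mul0r.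
Qed.

Lemma sqr_le_jb m : ((`|m| ^+ 2)%:~R : R) <= jb m ^+ 2.
Proof.
rewrite rmorphXn /= lerXn2r ?nnegrE ?jb_ge0 ?ler0z// /jb lerDr//.
Qed.

Lemma tame_opA : tame (fun k => jb k ^+ 2) (@opA R).
Proof.
apply: tame_matact; first by exists 2%N; exact: moderate_jb.
move=> N; exists 1 => // m n; rewrite mul1r /matA.
have [->|_] := eqVneq m n.
  rewrite subrr jb0 expr1n invr1 !mulr1 normc_int ger0_norm ?sqr_le_jb//.
by rewrite mulr0 normc0 mulr_ge0 ?jbX_ge0 ?jbV_ge0.
Qed.

Lemma kbound_matB : kbound (fun=> 1) (matB V).
Proof.
move=> N; have [C C0 HC] := fourier_decay N V_torus V_smooth.
by exists C => // m n; rewrite mulr1; exact: HC.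
Qed.

Lemma bounded_opB : bounded_op (opB V).
Proof. exact: tame_matact (moderate1 (R := R)) kbound_matB. Qed.

Lemma kbound_matZ : kbound (fun=> 1) (matZ V).
Proof.
move=> N; have [C C0 HC] := kbound_matB N.
exists C => // m n; rewrite /matZ; case: ifP => _; first exact: HC.
by rewrite normc0 mulr1 mulr_ge0 ?jbV_ge0.
Qed.

Lemma bounded_opZ : bounded_op (opZ V).
Proof. exact: tame_matact (moderate1 (R := R)) kbound_matZ. Qed.

Lemma jb_sum m n : jb m <= jb (m + n) * jb (m - n) :> R.
Proof.
apply: le_trans (jbD (m + n) (m - n)); apply: jb_le.
have -> : m + n + (m - n) = m + m :> int by lia.
by lia.
Qed.

(** The denominator is i(m - n)(m + n).  As m <> n and m <> -n, the first factor
    is at least 1, and <m> <= 2 |m + n| <m - n>: the loss of <m - n> is harmless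
    and the gain is 1 / <m>. *)
Lemma kbound_matX : kbound (fun k => (jb k)^-1) (matX V).
Proof.
move=> N.
have [C C0 HC] := fourier_decay N.+1 V_torus V_smooth.
exists (2 * C); first by rewrite mulr_ge0.
move=> m n; rewrite /matX; case: ifPn => [_|].
  by rewrite normc0 !mulr_ge0 ?invr_ge0 ?jb_ge0 ?jbX_ge0.
rewrite negb_or => /andP[mn mNn].
rewrite normcM normcV (normcM 'i%C) normc_i mul1r normc_int.
have -> : `|m| ^+ 2 - `|n| ^+ 2 = (m - n) * (m + n) :> int.
  by rewrite !real_normK ?num_real//; ring.
rewrite intrM normrM.
have d1 : (1 : R) <= `|(m - n)%:~R|.
  by rewrite -intr_norm (ler_int R 1); move/eqP: mn; lia.
have s1 : (1 : R) <= `|(m + n)%:~R|.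
  by rewrite -intr_norm (ler_int R 1); move/eqP: mNn; lia.
have sj : jb m <= 2 * `|(m + n)%:~R : R| * jb (m - n).
  apply: le_trans (jb_sum m n) _; rewrite ler_wpM2r ?jb_ge0//.
  by rewrite /jb intr_norm; lra.
apply: (@le_trans _ _ (C * jb (m - n) ^- N.+1 * (2 * jb (m - n) / jb m))).
  apply: ler_pM; rewrite ?normc_ge0 ?invr_ge0 ?mulr_ge0//.
  rewrite invf_ple ?posrE; last 2 first.
  - by rewrite mulr_gt0// (lt_le_trans ltr01).
  - by rewrite divr_gt0 ?mulr_gt0 ?jb_gt0.
  rewrite invf_div ler_pdivrMr ?mulr_gt0 ?jb_gt0//.
  apply: le_trans sj _.
  have -> : `|(m - n)%:~R| * `|(m + n)%:~R| * (2 * jb (m - n)) =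
    `|(m - n)%:~R| * (2 * `|(m + n)%:~R| * jb (m - n)) :> R by ring.
  rewrite -[leLHS]mul1r ler_wpM2r ?mulr_ge0 ?jb_ge0//.
rewrite exprS le_eqVlt; apply/orP; left; apply/eqP.
have := @jbX_gt0 R (m - n) N; have := @jb_gt0 R (m - n); have := @jb_gt0 R m.
move: (@jb R (m - n) ^+ N) (@jb R (m - n)) (@jb R m) => a b c c0 b0 a0.
by field; rewrite !gt_eqF.
Qed.

Lemma tame_opX : tame (fun k => (jb k)^-1) (opX V).
Proof. exact: tame_matact jbV_moderate kbound_matX. Qed.

Definition commA T : zoperator R := fun x k => opA (T x) k - T (opA x) k.

(** The entries of T are multiplied by (m - n)(m + n), which is at most
    2 <m> <m - n>^2; off-diagonal decay absorbs <m - n>^2, so that only one power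
    of <m> is lost instead of two. *)
Lemma tame_commA g T : tame g T -> tame (fun k => jb k * g k) (commA T).
Proof.
move=> tT; have [Ng gN] := tame_gain tT.
pose M m n : R[i] := (`|m| ^+ 2 - `|n| ^+ 2)%:~R * T (zdelta n) m.
apply: (@tame_eq _ _ (matact M)).
  move=> x xt; apply/funext => m; rewrite /commA /matact opAE.
  have Ax := tame_tempered tame_opA xt.
  rewrite !(tame_kernel _ tT)//.
  have kd y : tempered y -> zdom (fun n => T (zdelta n) m * y n).
    by apply: kbound_zdom (tame_kbound tT); exists Ng.
  rewrite -zsumZ; last exact: kd.
  rewrite -mulN1r -zsumZ; last exact: kd.
  rewrite -zsumD; [|by apply: zdomZ; exact: kd|by apply: zdomZ; exact: kd].
  by congr zsum; apply/funext => n; rewrite /M opAE intrB; ring.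
apply: tame_matact.
  exists (1 + Ng)%N; apply: moderateM => //.
  exact: (moderate_jb 1).
move=> N; have [C C0 HC] := tame_kbound tT (N + 2)%N.
exists (2 * C); first by rewrite mulr_ge0.
move=> m n; rewrite /M normcM normc_int.
have -> : `|m| ^+ 2 - `|n| ^+ 2 = (m - n) * (m + n) :> int.
  by rewrite !real_normK ?num_real//; ring.
rewrite intrM normrM.
have g0 : 0 <= g m := moderate_ge0 m gN.
apply: (@le_trans _ _ ((jb (m - n) * (2 * jb m * jb (m - n))) *
    (C * g m * jb (m - n) ^- (N + 2)))).
  apply: ler_pM; rewrite ?mulr_ge0 ?normc_ge0//.
  apply: ler_pM; rewrite ?normr_ge0// -intr_norm; first by rewrite /jb lerDr.
  apply: (@le_trans _ _ (2 * jb m + jb (m - n) - 1)).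
    rewrite /jb; have : (`|m + n|%:~R : R) <= 2 * `|m|%:~R + `|m - n|%:~R.
      by rewrite -(intrM R 2) -intrD ler_int; lia.
    lra.
  have := @jb_ge1 R m; have := @jb_ge1 R (m - n).
  move: (jb m) (jb (m - n)) => a b b1 a1.
  have : 0 <= (a - 1) * (b - 1) by rewrite mulr_ge0 ?subr_ge0.
  have : 0 <= a * (b - 1) by rewrite mulr_ge0 ?subr_ge0//; lra.
  lra.
rewrite exprD le_eqVlt; apply/orP; left; apply/eqP.
have := @jbX_gt0 R (m - n) N; have := @jb_gt0 R (m - n).
move: (@jb R (m - n) ^+ N) (@jb R (m - n)) (@jb R m) => a b c b0 a0.
by field; rewrite !gt_eqF.
Qed.

(** The operator iX. *)
Let T := scaleop 'i%C (opX V).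

Let tT : tame (fun k => (jb k)^-1) T.
Proof. exact: tameZ tame_opX. Qed.

Let bounded_jbV1 T' : tame (fun k => (jb k)^-1) T' -> bounded_op T'.
Proof.
have [N] := jbV_moderate; move=> jN; apply: (bounded_gain jN) => k.
by have := @jbV_le1 R k 1.
Qed.

Lemma bounded_opX : bounded_op (opX V).
Proof. exact: bounded_jbV1 tame_opX. Qed.

Lemma bounded_expiX : bounded_op (expiX V).
Proof. by apply: bounded_expop; apply: tameZ; exact: bounded_opX. Qed.

Lemma bounded_expNiX : bounded_op (expNiX V).
Proof. by apply: bounded_expop; apply: tameZ; exact: bounded_opX. Qed.

Lemma expiXK x : tempered x -> expNiX V (expiX V x) = x.
Proof.
have := @expop_cancel R (opX V) (- 'i%C) x bounded_opX.
by rewrite opprK.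
Qed.

Lemma expNiXK x : tempered x -> expiX V (expNiX V x) = x.
Proof. exact: expop_cancel bounded_opX. Qed.

(** The remainder of second order of exp(iX). *)
Let G : zoperator R := fun x k => expiX V x k - x k - T x k.

Let tG : tame (fun k => (jb k)^-1 * (jb k)^-1) G.
Proof.
have [N jN] := jbV_moderate.
apply: (@expop_second_order _ _ _ (N + N)).
- exact: bounded_jbV1.
- exact: moderateM.
- exact: tame_comp tT tT.
Qed.

(** The homological equation that dictates the choice of X. *)
Let commT x k : tempered x -> commA T x k = opB V x k - opZ V x k.
Proof.
move=> xt; have Ax := tame_tempered tame_opA xt.
have Xd y : tempered y -> zdom (fun n => matX V k n * y n).
  exact: kbound_zdom jbV_moderate kbound_matX.
have Bd : zdom (fun n => matB V k n * x n) :=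
  kbound_zdom k (moderate1 (R := R)) kbound_matB xt.
have Zd : zdom (fun n => matZ V k n * x n) :=
  kbound_zdom k (moderate1 (R := R)) kbound_matZ xt.
rewrite /commA opAE /T /scaleop /opX /opB /opZ /matact -[in RHS]mulN1r.
rewrite -(zsumZ (-1)) // -zsumD//; last exact: zdomZ.
rewrite mulrA -(zsumZ _ (Xd _ xt)) -mulNr -(zsumZ _ (Xd _ Ax)).
rewrite -zsumD; [|by apply: zdomZ; exact: Xd|by apply: zdomZ; exact: Xd].
congr zsum; apply/funext => n; rewrite opAE /matX /matZ.
have [_|] := boolP (_ || _); first by ring.
rewrite negb_or => /andP[kn kNn].
have d0 : (`|k| ^+ 2 - `|n| ^+ 2)%:~R != 0 :> R[i].
  rewrite intr_eq0 !real_normK ?num_real//.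
  have -> : k ^+ 2 - n ^+ 2 = (k - n) * (k + n) :> int by ring.
  by rewrite mulf_neq0// ?subr_eq0 ?addr_eq0.
have i0 : 'i%C != 0 :> R[i] by rewrite -normc_eq0 normc_i oner_eq0.
rewrite /matB; move: d0; rewrite intrB => d0.
move: ((`|k| ^+ 2)%:~R : R[i]) ((`|n| ^+ 2)%:~R : R[i]) d0 => u v d0.
by field; rewrite i0 d0.
Qed.

(** What remains of exp(iX)(A + B) - (A + Z)exp(iX) after the terms of order
    zero cancel. *)
Let Q : zoperator R := fun x k =>
  T (opB V x) k - commA G x k + G (opB V x) k - opZ V (T x) k - opZ V (G x) k.

Let tQ : tame (fun k => (jb k)^-1) Q.
Proof.
have bB := bounded_opB; have bZ := bounded_opZ.
have j1 k : (jb k)^-1 <= 1 :> R by have := @jbV_le1 R k 1.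
have j0 k : 0 <= (jb k)^-1 :> R by rewrite invr_ge0 jb_ge0.
have le1 g S : tame g S -> (forall k, g k <= (jb k)^-1) -> tame (fun k => (jb k)^-1) S.
  by move=> tS gj; apply: tame_le ler01 jbV_moderate _ tS => k; rewrite mul1r.
apply: tameB; [apply: tameB; [apply: tameD; [apply: tameB|]|]|].
- by apply: le1 (tame_comp tT bB) _ => k; rewrite mulr1.
- apply: le1 (tame_commA tG) _ => k.
  by rewrite mulrA mulfV ?mul1r// gt_eqF// jb_gt0.
- by apply: le1 (tame_comp tG bB) _ => k; rewrite mulr1 -[leRHS]mul1r ler_wpM2r.
- by apply: le1 (tame_comp bZ tT) _ => k; rewrite mul1r.
- by apply: le1 (tame_comp bZ tG) _ => k; rewrite mul1r -[leRHS]mul1r ler_wpM2r.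
Qed.

Let expiX_intertwine x : tempered x ->
  expiX V (fun k => opA x k + opB V x k) =
  (fun k => opA (expiX V x) k + opZ V (expiX V x) k + Q x k).
Proof.
move=> xt.
have Ax := tame_tempered tame_opA xt.
have Bx := tame_tempered bounded_opB xt.
have Tx := tame_tempered tT xt.
have Gx := tame_tempered tG xt.
have EE y k : expiX V y k = y k + T y k + G y k by rewrite /G; ring.
have EEx : expiX V x = (fun k => (x k + T x k) + G x k) by apply/funext => k.
apply/funext => k; rewrite (tameD_seq bounded_expiX)// !EE.
have xTx := temperedD xt Tx.
rewrite EEx opAE (tameD_seq bounded_opZ)// (tameD_seq bounded_opZ)//.
have := commT k xt; rewrite /commA opAE => /(congr1 (fun z => z + opZ V x k)).
rewrite subrK => <-.
rewrite /Q /commA !opAE.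
move: (opZ V (T x) k) (opZ V (G x) k) (T (opA x) k) (G (opA x) k)
  (T (opB V x) k) (G (opB V x) k) (T x k) (G x k) (opZ V x k) => *.
by ring.
Qed.

(** In exp(iX)(A + B)exp(-iX) the operator A + Z is moved to the left of exp(iX),
    where exp(iX)exp(-iX) = 1 makes it cancel with the subtracted A + Z. *)
Lemma opRE x : tempered x -> opR V x = Q (expNiX V x).
Proof.
move=> xt; have ex := tame_tempered bounded_expNiX xt.
apply/funext => k.
have -> : opR V x k = expiX V (fun k => opA (expNiX V x) k + opB V (expNiX V x) k) k
   - (opA x k + opZ V x k) by [].
rewrite expiX_intertwine// expNiXK//; ring.
Qed.

Lemma tame_opR : tame (fun k => (jb k)^-1) (opR V).
Proof.
apply: (@tame_eq _ _ (Q \o expNiX V)); first by move=> x xt; rewrite opRE.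
by have := tame_comp tQ bounded_expNiX; under eq_fun do rewrite mulr1.
Qed.

End SchrodingerOperators.

(** * Gronwall inequality and Dyson series *)

Section Dynamics.
Context {R : realType}.
Implicit Types (k m n p : int) (N L j : nat) (w lam : int -> R) (x : zseq R).
Implicit Types (T P : zoperator R) (M : zmatrix R) (c : R[i]) (C K B b r t tau : R).
Implicit Types (y : R -> zseq R).

Lemma ler_norm_near r t : `|r - t| <= 1 -> `|r| <= `|t| + 1.
Proof.
move=> rt; rewrite -[X in `|X|](subrKC t) (le_trans (ler_normD _ _))//.
by rewrite lerD2l.
Qed.

(** A real diagonal part, possibly unbounded, plus an operator P that will be
    bounded. *)
Definition gen lam P : zoperator R := fun x k => (lam k)%:C * x k + P x k.

(** The modulus of y is that of cexpi (- lam k * t) * y t k, from whose derivative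
    the diagonal part disappears.  For 8 K tau <= 1 the mean value inequality
    improves an a priori bound b w to (b / 4 + 2 C tau) w, and iteration leaves
    4 C tau w, whatever the initial bound. *)
Lemma gronwall lam P N K w y (src : R -> zseq R) C tau :
  (forall w x, moderate N w -> bnd x w -> bnd (P x) (fun m => K * w m)) ->
  0 <= K -> moderate N w -> 0 <= C -> 0 <= tau -> 8 * K * tau <= 1 ->
  (forall t k, is_cderive (y ^~ k) t ('i%C * gen lam P (y t) k + src t k)) ->
  (forall k, y 0 k = 0) ->
  (forall t, `|t| <= tau -> bnd (src t) (fun k => C * w k)) ->
  (exists2 B, 0 <= B & forall t, `|t| <= tau -> bnd (y t) (fun k => B * w k)) ->
  forall t, `|t| <= tau -> bnd (y t) (fun k => 4 * C * tau * w k).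
Proof.
move=> PK K0 wN C0 tau0 Ktau dy y0 sC [B B0 yB].
have w0 k : 0 <= w k := moderate_ge0 k wN.
have step b : 0 <= b -> (forall t, `|t| <= tau -> bnd (y t) (fun k => b * w k)) ->
    forall t, `|t| <= tau -> bnd (y t) (fun k => (b / 4 + 2 * C * tau) * w k).
  move=> b0 yb t tt k.
  pose z r := cexpi (- lam k * r) * y r k.
  pose dz r := cexpi (- lam k * r) * ('i%C * P (y r) k + src r k).
  have dzE r : is_cderive z r (dz r).
    apply: is_cderive_eq (is_cderiveM (is_cderive_cexpi (- lam k) r) (dy r k)) _.
    by rewrite /dz /gen rmorphN; ring.
  have dzle r : `|r| <= tau -> normc (dz r) <= (K * b + C) * w k.
    move=> rt; rewrite /dz normcM normc_cexpi mul1r (le_trans (normcD _ _))//.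
    rewrite mulrDl lerD ?sC// normcM normc_i mul1r -mulrA.
    by apply: (PK _ _ _ (yb r rt)); exact: moderateZ.
  have := cderive_lipschitz dzE dzle tt.
  rewrite /z mulr0 cexpi0 y0 mulr0 subr0 normcM normc_cexpi mul1r => H.
  apply: le_trans H _.
  apply: (@le_trans _ _ (2 * ((K * b + C) * w k) * tau)).
    by rewrite ler_wpM2l// !mulr_ge0// addr_ge0// mulr_ge0.
  have -> : 2 * ((K * b + C) * w k) * tau =
    (8 * K * tau * b / 4 + 2 * C * tau) * w k by field.
  rewrite ler_wpM2r// lerD2r ler_wpM2r ?invr_ge0//.
  by rewrite -[leRHS]mul1r ler_wpM2r.
have iter_step (n : nat) : forall t, `|t| <= tau ->
    bnd (y t) (fun k => (B / 2 ^+ n + 4 * C * tau) * w k).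
  elim: n => [|n IH] t tt k.
    apply: le_trans (yB t tt k) _.
    by rewrite expr0 divr1 ler_wpM2r// lerDl !mulr_ge0.
  have Bn : 0 <= B / 2 ^+ n by rewrite divr_ge0 ?exprn_ge0.
  have Ct : 0 <= C * tau by rewrite mulr_ge0.
  have bn : 0 <= B / 2 ^+ n + 4 * C * tau by rewrite addr_ge0// -mulrA mulr_ge0.
  apply: le_trans (step _ bn IH t tt k) _; rewrite ler_wpM2r//.
  rewrite exprS invfM (mulrCA B); move: (B / 2 ^+ n) Bn => b b0; lra.
move=> t tt k; apply/ler_addgt0Pl => e e0.
have [n Hn] : exists n : nat, B * w k / 2 ^+ n <= e.
  have q0 : 0 <= B * w k / e by rewrite divr_ge0 ?mulr_ge0 ?(ltW e0).
  exists (Num.bound (B * w k / e)); rewrite ler_pdivrMr ?exprn_gt0//.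
  rewrite -ler_pdivrMl// mulrC; apply: le_trans (ltW (archi_boundP q0)) _.
  by rewrite -natrX ler_nat ltnW// ltn_expl.
apply: le_trans (iter_step n t tt k) _.
by rewrite mulrDl lerD2r mulrAC.
Qed.

(** A time that is admissible in gronwall for the constant K, and at most 1. *)
Definition gronwall_time K := (8 * (K + 1))^-1.

Lemma gronwall_time_gt0 K : 0 <= K -> 0 < gronwall_time K.
Proof. by move=> K0; rewrite invr_gt0 mulr_gt0// ltr_wpDl. Qed.

Lemma gronwall_time_le K t : 0 <= K -> `|t| <= gronwall_time K ->
  `|t| <= 1 /\ 8 * K * `|t| <= 1.
Proof.
move=> K0 tK; have K1 : 0 < 8 * (K + 1) by rewrite mulr_gt0// ltr_wpDl.
split; first by apply: le_trans tK _; rewrite invf_le1//; lra.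
apply: (@le_trans _ _ (8 * K * gronwall_time K)).
  by rewrite ler_wpM2l// mulr_ge0.
by rewrite ler_pdivrMr// mul1r ler_pM2l// lerDl.
Qed.

Definition primitive (f : R -> R[i]) : R -> R[i] :=
  xget (fun=> 0) [set F | F 0 = 0 /\ forall t, is_cderive F t (f t)].

Lemma primitiveP (f : R -> R[i]) : (forall t, ccvg (nbhs t) f (f t)) ->
  primitive f 0 = 0 /\ forall t, is_cderive (primitive f) t (f t).
Proof.
move=> cf; have [F F0 dF] := ccvg_primitive cf.
rewrite /primitive; exact: (@xgetPex _ (fun=> 0) [set F | F 0 = 0 /\ _]
  (ex_intro _ F (conj F0 dF))).
Qed.

Section Dyson.
Variables (lam : int -> R) (P : zoperator R).
Hypothesis bP : bounded_op P.

Definition interaction t x : zseq R :=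
  fun k => cexpi (- lam k * t) * P (fun n => cexpi (lam n * t) * x n) k.

(** The j-th Picard increment in the interaction picture. *)
Fixpoint dyson x j : R -> zseq R :=
  if j is j'.+1 then
    fun t k => primitive (fun r => 'i%C * interaction r (dyson x j' r) k) t
  else fun=> x.

Lemma normc_phase (a : R) (z : R[i]) : normc (cexpi a * z) = normc z.
Proof. by rewrite normcM normc_cexpi mul1r. Qed.

Lemma tempered_phase (a : int -> R) x : tempered x ->
  tempered (fun n => cexpi (a n) * x n).
Proof.
by move=> [N [w [wN xw]]]; apply: (temperedP wN) => k; rewrite normc_phase.
Qed.

Lemma interaction_bnd N K w x t :
  (forall w x, moderate N w -> bnd x w -> bnd (P x) (fun m => K * w m)) ->
  moderate N w -> bnd x w -> bnd (interaction t x) (fun m => K * w m).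
Proof.
move=> PK wN xw k; rewrite /interaction normc_phase; apply: PK wN _ k => n.
by rewrite normc_phase.
Qed.

(** The bound by (2 K |t|)^j / j! is integrated from one index to the next; the
    continuity of the integrand, which is needed for the primitive to exist,
    follows from the previous bound by domination. *)
Lemma dyson_spec x j : tempered x ->
  [/\ forall t k, ccvg (nbhs t) (dyson x j ^~ k) (dyson x j t k),
      forall N K w, (forall w x, moderate N w -> bnd x w ->
          bnd (P x) (fun m => K * w m)) -> 0 <= K -> moderate N w -> bnd x w ->
        forall t, bnd (dyson x j t) (fun k => (2 * K * `|t|) ^+ j / j`!%:R * w k) &
      forall t k, ccvg (nbhs t) (fun r => 'i%C * interaction r (dyson x j r) k)
        ('i%C * interaction t (dyson x j t) k)].
Proof.
move=> xt; have [N0 [w0 [w0N xw0]]] := xt.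
have [K0 K00 PK0] := bounded_bnd N0 bP.
have phase_cvg (a t : R) : ccvg (nbhs t) (fun r => cexpi (a * r)) (cexpi (a * t)).
  exact: is_cderive_continuous (is_cderive_cexpi a t).
have third : forall i,
    (forall t k, ccvg (nbhs t) (dyson x i ^~ k) (dyson x i t k)) ->
    (forall t, bnd (dyson x i t) (fun k => (2 * K0 * `|t|) ^+ i / i`!%:R * w0 k)) ->
    forall t k, ccvg (nbhs t) (fun r => 'i%C * interaction r (dyson x i r) k)
        ('i%C * interaction t (dyson x i t) k).
  move=> i ci bi t k; apply: ccvgZ; apply: ccvgM; first exact: phase_cvg.
  pose w k := (2 * K0 * (`|t| + 1)) ^+ i / i`!%:R * w0 k.
  have cK r : 0 <= (2 * K0 * `|r|) ^+ i / i`!%:R.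
    by rewrite divr_ge0 ?exprn_ge0 ?mulr_ge0.
  have wN : moderate N0 w.
    by apply: moderateZ => //; rewrite divr_ge0 ?exprn_ge0 ?mulr_ge0.
  apply: (tame_filter_cvg k bP wN).
  - move=> r; apply: tempered_phase.
    exact: temperedP (moderateZ (cK r) w0N) (bi r).
  - near=> r => n; rewrite normc_phase; apply: le_trans (bi r n) _.
    rewrite /w ler_wpM2r ?(moderate_ge0 _ w0N)// ler_wpM2r ?invr_ge0//.
    rewrite lerXn2r ?nnegrE ?mulr_ge0 ?addr_ge0// ler_wpM2l ?mulr_ge0//.
    have -> : r = t - (t - r) by ring.
    rewrite (le_trans (ler_normB _ _))// lerD2l.
    by near: r; apply: cvgr_dist_le => //; exact: cvg_id.
  - by move=> n; apply: ccvgM; [exact: phase_cvg|exact: ci].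
elim: j => [|j [ci bi ti]].
  have b0 N K w : (forall w x, moderate N w -> bnd x w ->
          bnd (P x) (fun m => K * w m)) -> 0 <= K -> moderate N w -> bnd x w ->
        forall t, bnd (dyson x 0 t) (fun k => (2 * K * `|t|) ^+ 0 / 0`!%:R * w k).
    by move=> _ _ _ xw t k; rewrite expr0 fact0 divr1 mul1r.
  have c0 t k : ccvg (nbhs t) (dyson x 0 ^~ k) (dyson x 0 t k) by exact: ccvg_cst.
  by split=> //; apply: third => //; exact: b0 PK0 _ _ _.
have dj k t : is_cderive (dyson x j.+1 ^~ k) t ('i%C * interaction t (dyson x j t) k).
  by have [_] := primitiveP (fun t => ti t k); exact.
have d0 k : dyson x j.+1 0 k = 0 by have [] := primitiveP (fun t => ti t k).
have cj t k : ccvg (nbhs t) (dyson x j.+1 ^~ k) (dyson x j.+1 t k).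
  exact: is_cderive_continuous (dj k t).
have bj N K w : (forall w x, moderate N w -> bnd x w ->
          bnd (P x) (fun m => K * w m)) -> 0 <= K -> moderate N w -> bnd x w ->
        forall t, bnd (dyson x j.+1 t)
          (fun k => (2 * K * `|t|) ^+ j.+1 / j.+1`!%:R * w k).
  move=> PK K1 wN xw t k.
  (* Comparison with q r^(j+1) / (j+1); the factor 2 of the mean value
     inequality is the reason for 2 K in the bound. *)
  pose q : R := K * (2 * K) ^+ j / j`!%:R * w k.
  have := @cderive_dist_le R (dyson x j.+1 ^~ k)
    (fun r => 'i%C * interaction r (dyson x j r) k)
    (fun r => q / j.+1%:R * r ^+ j.+1) (fun r => q * r ^+ j) t (dj k).
  rewrite d0 subr0 expr0n mulr0 subr0.
  have -> : 2 * (q / j.+1%:R * `|t| ^+ j.+1) =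
      (2 * K * `|t|) ^+ j.+1 / j.+1`!%:R * w k.
    rewrite /q factS natrM.
    rewrite (exprMn _ _ `|t|) (exprS (2 * K)).
    have f1 : (j`!%:R : R) != 0 by rewrite pnatr_eq0 -lt0n fact_gt0.
    have f2 : (j.+1%:R : R) != 0 by rewrite pnatr_eq0.
    move: ((2 * K) ^+ j) (`|t| ^+ j.+1) (j`!%:R : R) (j.+1%:R : R) f1 f2 => u v f g f1 f2.
    by field; rewrite f1 f2.
  apply.
  - move=> r _.
    have /(_ _ (is_derive_id r (1:R))) := @is_deriveX R R id j.+1 r (1:R).
    rewrite exprfctE => H.
    apply: is_derive_eq (@is_deriveZ R R R _ (q / j.+1%:R) r (1:R) _ H) _.
    rewrite /= [X in _ *: X]mulr1.
    by rewrite [_ *: _]mulrA divfK// pnatr_eq0.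
  - move=> r rt; rewrite normcM normc_i mul1r.
    have cK : 0 <= (2 * K * `|r|) ^+ j / j`!%:R.
      by rewrite divr_ge0 ?exprn_ge0 ?mulr_ge0.
    apply: le_trans (interaction_bnd r PK (moderateZ cK wN)
      (bi N K w PK K1 wN xw r) k) _.
    rewrite le_eqVlt; apply/orP; left; apply/eqP; rewrite /q exprMn; ring.
by split=> //; apply: third => //; exact: bj PK0 _ _ _.
Unshelve. all: by end_near. Qed.

End Dyson.

End Dynamics.

(** * Propagators *)

Section Propagator.
Context {R : realType}.
Variables (lam : int -> R) (P : zoperator R).
Hypothesis bP : bounded_op P.
Implicit Types (k m n p : int) (N L j : nat) (w : int -> R) (x : zseq R).
Implicit Types (C K B b r t tau T : R) (y : R -> zseq R).

(** The sum of the Dyson series, brought back from the interaction picture. *)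
Definition evol x t : zseq R :=
  fun k => cexpi (lam k * t) * csum (fun j => dyson lam P x j t k).

Lemma dyson_sum_le x N K w :
  (forall w x, moderate N w -> bnd x w -> bnd (P x) (fun m => K * w m)) ->
  0 <= K -> moderate N w -> bnd x w ->
  forall t k L, \sum_(j < L) normc (dyson lam P x j t k) <= expR (2 * K * `|t|) * w k.
Proof.
move=> PK K0 wN xw t k L.
apply: (@le_trans _ _ ((\sum_(j < L) (2 * K * `|t|) ^+ j / j`!%:R) * w k)).
  rewrite mulr_suml; apply: ler_sum => j _.
  have [_ bj _] := dyson_spec lam bP j (temperedP wN xw).
  exact: bj PK K0 wN xw t k.
by rewrite ler_wpM2r ?(moderate_ge0 _ wN)// exp_sum_le// !mulr_ge0.
Qed.

Lemma dyson_cdom x t k : tempered x -> cdom (fun j => dyson lam P x j t k).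
Proof.
move=> [N [w [wN xw]]]; have [K K0 PK] := bounded_bnd N bP.
by exists (expR (2 * K * `|t|) * w k); exact: dyson_sum_le PK K0 wN xw t k.
Qed.

Lemma evol_bnd x N K w :
  (forall w x, moderate N w -> bnd x w -> bnd (P x) (fun m => K * w m)) ->
  0 <= K -> moderate N w -> bnd x w ->
  forall t, bnd (evol x t) (fun k => expR (2 * K * `|t|) * w k).
Proof.
move=> PK K0 wN xw t k; rewrite /evol normc_phase.
by apply: csum_normc_le; exact: dyson_sum_le PK K0 wN xw t k.
Qed.

Lemma dysonS x j k : tempered x ->
  dyson lam P x j.+1 0 k = 0 /\ forall t, is_cderive (dyson lam P x j.+1 ^~ k) t
    ('i%C * interaction lam P t (dyson lam P x j t) k).
Proof.
move=> xt; have [_ _ ci] := dyson_spec lam bP j xt.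
exact: (primitiveP (fun t => ci t k)).
Qed.

Lemma evol0 x : tempered x -> evol x 0 = x.
Proof.
move=> xt; apply/funext => k; rewrite /evol mulr0 cexpi0 mul1r.
rewrite csum_recl /=; last exact: dyson_cdom.
rewrite (_ : (fun j => _) = (fun=> 0)).
  rewrite (csum_eq (l := 0)) ?addr0//.
  by under eq_fun do rewrite big1//; exact: ccvg_cst.
by apply/funext => j; have [] := dysonS j k xt.
Qed.

Lemma evol_derive x t k : tempered x ->
  is_cderive (evol x ^~ k) t ('i%C * gen lam P (evol x t) k).
Proof.
move=> xt; have [N [w [wN xw]]] := xt; have [K K0 PK] := bounded_bnd N bP.
have w0 n : 0 <= w n := moderate_ge0 n wN.
pose f r j := dyson lam P x j r k.
pose df r j := if j is j'.+1
  then 'i%C * interaction lam P r (dyson lam P x j' r) k else 0.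
pose T := `|t| + 1.
have T0 : 0 <= T by rewrite addr_ge0.
pose a j := if j is j'.+1 then K * w k * ((2 * K * T) ^+ j' / j'`!%:R) else 0.
have sa : summ a.
  exists (K * w k * expR (2 * K * T)) => -[|L].
    by rewrite big_ord0 !mulr_ge0 ?expR_ge0.
  rewrite big_ord_recl add0r -mulr_sumr ler_wpM2l ?mulr_ge0// exp_sum_le//.
  by rewrite !mulr_ge0.
have fd r j : is_cderive (f ^~ j) r (df r j).
  case: j => [|j]; first exact: is_cderive_cst.
  by have [_] := dysonS j k xt; exact.
have dfa r j : `|r - t| <= 1 -> normc (df r j) <= a j.
  move=> rt; case: j => [|j]; first by rewrite normc0.
  rewrite /df /a normcM normc_i mul1r.
  have [_ bj _] := dyson_spec lam bP j xt.
  have c0 : 0 <= (2 * K * `|r|) ^+ j / j`!%:R.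
    by rewrite divr_ge0 ?exprn_ge0 ?mulr_ge0.
  apply: le_trans (interaction_bnd lam r PK (moderateZ c0 wN) (bj _ _ _ PK K0 wN xw r) k) _.
  rewrite -(mulrA K) ler_wpM2l// mulrC ler_wpM2l// ler_wpM2r ?invr_ge0//.
  rewrite lerXn2r ?nnegrE ?mulr_ge0// ler_wpM2l ?mulr_ge0//.
  have -> : r = (r - t) + t by ring.
  by rewrite (le_trans (ler_normD _ _))// /T addrC lerD2l.
have fdom r : cdom (f r) by exact: dyson_cdom.
have dU : is_cderive (fun r => csum (f r)) t
    ('i%C * interaction lam P t (fun n => csum (fun j => dyson lam P x j t n)) k).
  apply: is_cderive_eq (csum_derive fd sa dfa fdom) _.
  have tt : `|t - t| <= 1 by rewrite subrr normr0.
  rewrite csum_recl; last exact: cdomP (fun j => dfa t j tt) sa.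
  rewrite /df add0r /interaction.
  have -> : (fun n => cexpi (lam n * t) * csum (fun j => dyson lam P x j t n)) =
      (fun n => csum (fun j => cexpi (lam n * t) * dyson lam P x j t n)).
    by apply/funext => n; rewrite csumZ//; exact: dyson_cdom.
  have cK : 0 <= expR (2 * K * `|t|) by exact: expR_ge0.
  have fle n L : \sum_(j < L) normc (cexpi (lam n * t) * dyson lam P x j t n)
      <= expR (2 * K * `|t|) * w n.
    under eq_bigr do rewrite normc_phase.
    exact: dyson_sum_le PK K0 wN xw t n L.
  rewrite (tame_csum bP (moderateZ cK wN) fle) mulrA -csumZ.
    by congr csum; apply/funext => j; rewrite mulrA.
  exists (K * (expR (2 * K * `|t|) * w k)) => L.
  apply: (@le_trans _ _ (\sum_(j < L) K * ((2 * K * `|t|) ^+ j / j`!%:R * w k))).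
    apply: ler_sum => j _.
    have [_ bj _] := dyson_spec lam bP j xt.
    have c0 : 0 <= (2 * K * `|t|) ^+ j / j`!%:R.
      by rewrite divr_ge0 ?exprn_ge0 ?mulr_ge0.
    apply: (PK _ _ (moderateZ c0 wN)) => n; rewrite normc_phase.
    exact: bj PK K0 wN xw t n.
  rewrite -mulr_sumr ler_wpM2l// -mulr_suml ler_wpM2r// exp_sum_le//.
  by rewrite !mulr_ge0.
apply: is_cderive_eq (is_cderiveM (is_cderive_cexpi (lam k) t) dU) _.
rewrite /gen /evol /interaction mulNr.
have H := cexpiN (lam k * t).
transitivity ('i%C * ((lam k)%:C * (cexpi (lam k * t) * csum (f t))) +
  'i%C * (cexpi (- (lam k * t)) * cexpi (lam k * t)) *
   P (fun n => cexpi (lam n * t) * csum (fun j => dyson lam P x j t n)) k).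
  by ring.
by rewrite H /f; ring.
Qed.

(** The columns of the propagator are the solutions issued from basis vectors. *)
Definition propker t : zmatrix R := fun m n => evol (zdelta n) t m.

Definition prop t : zoperator R := matact (propker t).

(** Rapid off-diagonal decay of the entries, locally uniform in time: the
    Dyson bound with the weight <k - n>^-N. *)
Lemma propker_le N T : exists2 C, 0 <= C & forall t, `|t| <= T ->
  forall m n, normc (propker t m n) <= C * jb (m - n) ^- N.
Proof.
have [K K0 PK] := bounded_bnd N bP.
exists (expR (2 * K * T)) => [|t tT m n]; first exact: expR_ge0.
apply: le_trans (evol_bnd PK K0 (moderate_jbV N n) (bnd_zdelta N n) t m) _.
by rewrite ler_wpM2r ?jbV_ge0// ler_expR ler_wpM2l// mulr_ge0.
Qed.

Lemma kbound_propker t : kbound (fun=> 1) (propker t).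
Proof.
move=> N; have [C C0 HC] := propker_le N `|t|; exists C => // m n.
by rewrite mulr1 HC.
Qed.

Lemma bounded_prop t : bounded_op (prop t).
Proof. exact: tame_matact (moderate1 (R := R)) (kbound_propker t). Qed.

Lemma prop_bnd N T : exists2 C, 0 <= C & forall t, `|t| <= T -> forall w x,
  moderate N w -> bnd x w -> bnd (prop t x) (fun k => C * w k).
Proof.
have [C C0 HC] := propker_le (N + 2) T.
exists (4 * C); first by rewrite mulr_ge0.
move=> t tT w x wN xw m; apply: zsum_normc_le.
exact: kernel_zpart_le C0 wN xw (HC t tT m).
Qed.

Lemma prop0 x : prop 0 x = x.
Proof.
apply/funext => m; rewrite /prop /matact (zsum_single (k := m)).
  by rewrite /propker evol0 ?/zdelta ?eqxx ?mul1r//; exact: tempered_zdelta.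
move=> n nm; rewrite /propker evol0; last exact: tempered_zdelta.
by rewrite /zdelta eq_sym (negPf nm) mul0r.
Qed.

(** Superposition of the equations of the columns. *)
Lemma prop_gen t x k : tempered x ->
  zsum (fun n => 'i%C * gen lam P (propker t ^~ n) k * x n) =
  'i%C * gen lam P (prop t x) k.
Proof.
move=> xt; have [N [w [wN xw]]] := xt.
have [C C0 HC] := kbound_zpart_le N (moderate_cst 0 (@ler01 R)) (kbound_propker t).
have w'N := moderateZ C0 wN.
have sup k0 L : zpart (fun n => normc (propker t k0 n * x n)) L <= C * w k0.
  by have := HC _ _ wN xw k0 L; rewrite mulr1.
have ct n : tempered (propker t ^~ n).
  have [D D0 HD] := kbound_propker t 0.
  by apply: temperedP (moderateZ D0 (moderate_cst 0 (@ler01 R))) _ => m;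
    have := HD m n; rewrite !mulr1 expr0 invr1 mulr1.
have Pcol n : P (fun m => propker t m n * x n) k = P (propker t ^~ n) k * x n.
  rewrite (_ : (fun m => _) = (fun m => x n * propker t m n)); last first.
    by apply/funext => m; rewrite mulrC.
  by rewrite (tameZ_seq _ bP)// mulrC.
have d1 : zdom (fun n => propker t k n * x n) by exists (C * w k); exact: sup.
have d2 : zdom (fun n => P (propker t ^~ n) k * x n).
  have [K K0 PK] := bounded_bnd (N + 2) bP.
  have [D D0 HD] := kbound_propker t (N + 2)%N.
  exists (4 * (K * D) * w k) => L.
  apply: (kernel_zpart_le (M := fun m n => P (propker t ^~ n) m)) wN xw _ L => //.
    exact: mulr_ge0.
  move=> n; rewrite -mulrA; apply: (PK (fun m => D * jb (m - n) ^- (N + 2))).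
    by apply: moderateZ => //; exact: moderate_jbV.
  by move=> m; have := HD m n; rewrite mulr1.
rewrite (_ : (fun n => _) = (fun n => 'i%C * ((lam k)%:C * (propker t k n * x n) +
   P (propker t ^~ n) k * x n))); last first.
  by apply/funext => n; rewrite /gen; ring.
rewrite zsumZ; last by apply: zdomD => //; exact: zdomZ.
rewrite zsumD//; last exact: zdomZ.
rewrite zsumZ// /gen; congr (_ * (_ + _)).
rewrite /prop /matact (tame_superposition bP w'N)//.
by congr zsum; apply/funext => n.
Qed.

End Propagator.

(** * Differentiation of operators and flows *)

Section TermwiseDerivative.
Context {R : realType}.
Implicit Types (k m n p : int) (N L : nat) (w : int -> R) (x : zseq R).
Implicit Types (C K B b r t tau : R) (y dy : R -> zseq R) (M dM : R -> zmatrix R).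

(** Leibniz rule for a matrix and a sequence that both depend on time. *)
Lemma matact_derive M dM y dy N w C k t : moderate N w -> 0 <= C ->
  (forall r n, is_cderive (fun r => M r k n) r (dM r k n)) ->
  (forall r n, is_cderive (y ^~ n) r (dy r n)) ->
  (forall r, `|r - t| <= 1 -> [/\ bnd (y r) w, bnd (dy r) w,
    forall n, normc (M r k n) <= C * jb (k - n) ^- (N + 2) &
    forall n, normc (dM r k n) <= C * jb (k - n) ^- (N + 2)]) ->
  (forall r, zdom (fun n => M r k n * y r n)) ->
  is_cderive (fun r => matact (M r) (y r) k) t
    (zsum (fun n => dM t k n * y t n) + zsum (fun n => M t k n * dy t n)).
Proof.
move=> wN C0 Md yd bds My.
have tt : `|t - t| <= 1 by rewrite subrr normr0.
have [yw dyw Mw dMw] := bds t tt.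
have w0 n : 0 <= w n := moderate_ge0 n wN.
have d1 : zdom (fun n => dM t k n * y t n).
  by exists (4 * C * w k); exact: kernel_zpart_le C0 wN yw dMw.
have d2 : zdom (fun n => M t k n * dy t n).
  by exists (4 * C * w k); exact: kernel_zpart_le C0 wN dyw Mw.
rewrite -zsumD//.
pose a n := C * jb (k - n) ^- (N + 2) * w n.
have a0 n : 0 <= a n by rewrite !mulr_ge0 ?jbV_ge0.
have sa : zsumm (fun n => 2 * a n).
  exists (2 * (4 * C * w k)) => L; rewrite zpartZ ler_wpM2l//.
  apply: le_trans (kernel_zpart_le (M := fun m n => (C * jb (m - n) ^- (N + 2))%:C)
    (m := k) (x := fun n => (w n)%:C) C0 wN _ _ L).
  - apply: ler_zpart => n; rewrite normcM !normc_real !ger0_norm//.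
    by rewrite mulr_ge0 ?jbV_ge0.
  - by move=> n; rewrite normc_real ger0_norm.
  - by move=> n; rewrite normc_real ger0_norm// mulr_ge0 ?jbV_ge0.
apply: (zsum_derive (f := fun r n => M r k n * y r n)
  (df := fun r n => dM r k n * y r n + M r k n * dy r n) _ sa) => //.
- by move=> r n; apply: is_cderiveM; [exact: Md|exact: yd].
- move=> r n /bds[yr dyr Mr dMr].
  rewrite (le_trans (normcD _ _))// mulr2n mulrDl mul1r lerD// normcM.
  + by apply: ler_pM; rewrite ?normc_ge0 ?dMr ?yr.
  + by apply: ler_pM; rewrite ?normc_ge0 ?Mr ?dyr.
Qed.

(** A domination near each time, under which operators commute with time
    derivatives. *)
Definition loc_dominated y dy t := exists N w, moderate N w /\
  forall r, `|r - t| <= 1 -> bnd (y r) w /\ bnd (dy r) w.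

Lemma loc_dominated_tempered y dy t : loc_dominated y dy t -> tempered (y t) /\ tempered (dy t).
Proof.
move=> [N [w [wN H]]]; have [|yw dyw] := H t; first by rewrite subrr normr0.
by split; apply: temperedP wN _.
Qed.

Lemma tame_derive g T y dy t k : tame g T ->
  (forall r n, is_cderive (y ^~ n) r (dy r n)) ->
  (forall t, loc_dominated y dy t) ->
  is_cderive (fun r => T (y r) k) t (T (dy t) k).
Proof.
move=> tT yd ld.
have yt r : tempered (y r) by have [] := loc_dominated_tempered (ld r).
have dyt r : tempered (dy r) by have [] := loc_dominated_tempered (ld r).
have [N [w [wN H]]] := ld t.
have [C C0 HC] := tame_kbound tT (N + 2)%N.
have [Ng gN] := tame_gain tT.
have Cg : 0 <= C * g k by rewrite mulr_ge0// (moderate_ge0 k gN).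
rewrite (_ : (fun r => _) = (fun r => matact (fun m n => T (zdelta n) m) (y r) k)).
  rewrite (tame_kernel _ tT)//.
  apply: is_cderive_eq (matact_derive (dM := fun r m n => 0) wN Cg _ yd _ _) _.
  - by move=> r n; exact: is_cderive_cst.
  - move=> r /H[yr dyr]; split=> //.
    by move=> n; rewrite normc0 mulr_ge0// jbV_ge0.
  - move=> r; apply: kbound_zdom (tame_kbound tT) (yt r); by exists Ng.
  - rewrite (zsum_single (k := 0)) ?mul0r ?add0r//.
    by move=> n _; rewrite mul0r.
by apply/funext => r; exact: tame_kernel tT (yt r).
Qed.

Variables (lam : int -> R) (P : zoperator R).
Hypothesis bP : bounded_op P.

Lemma gen_bnd x N K w : (forall w x, moderate N w -> bnd x w ->
    bnd (P x) (fun m => K * w m)) -> moderate N w -> bnd x w ->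
  bnd (fun k => 'i%C * gen lam P x k) (fun k => (`|lam k| + K) * w k).
Proof.
move=> PK wN xw k; rewrite normcM normc_i mul1r (le_trans (normcD _ _))//.
rewrite mulrDl lerD//; last exact: PK wN xw k.
by rewrite normcM normc_real ler_wpM2l.
Qed.

Lemma propker_derive t m n :
  is_cderive (fun r => propker lam P r m n) t
    ('i%C * gen lam P (propker lam P t ^~ n) m).
Proof. exact: evol_derive bP _ _ _ (tempered_zdelta n). Qed.

Lemma prop_derive y dy t k :
  (forall r n, is_cderive (y ^~ n) r (dy r n)) ->
  (forall t, loc_dominated y dy t) ->
  is_cderive (fun r => prop lam P r (y r) k) t
    ('i%C * gen lam P (prop lam P t (y t)) k + prop lam P t (dy t) k).
Proof.
move=> yd ld.
have yt r : tempered (y r) by have [] := loc_dominated_tempered (ld r).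
have [N [w [wN H]]] := ld t.
have [C C0 HC] := propker_le lam bP (N + 2) (`|t| + 1).
have [K K0 PK] := bounded_bnd (N + 2) bP.
pose D := C + (`|lam k| + K) * C.
have q0 : 0 <= (`|lam k| + K) * C by rewrite mulr_ge0// addr_ge0.
have D0 : 0 <= D by rewrite addr_ge0.
apply: is_cderive_eq (matact_derive
  (dM := fun r m n => 'i%C * gen lam P (propker lam P r ^~ n) m) wN D0 _ yd _ _) _.
- by move=> r n; exact: propker_derive.
- move=> r /[dup] /ler_norm_near rt /H[yr dyr]; split=> // n.
    apply: le_trans (HC r rt k n) _.
    by rewrite ler_wpM2r ?jbV_ge0// lerDl.
  have colw : bnd (propker lam P r ^~ n) (fun m => C * jb (m - n) ^- (N + 2)).
    by move=> m; exact: HC.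
  apply: le_trans (gen_bnd PK (moderateZ C0 (moderate_jbV _ n)) colw k) _.
  by rewrite mulrA ler_wpM2r ?jbV_ge0// lerDr.
- move=> r; apply: kbound_zdom (kbound_propker lam bP r) (yt r).
  by exists 0%N; exact: moderate_cst.
- by rewrite prop_gen.
Qed.

Lemma prop_cst_derive x t k : tempered x ->
  is_cderive (fun r => prop lam P r x k) t ('i%C * gen lam P (prop lam P t x) k).
Proof.
move=> xt; apply: is_cderive_eq (prop_derive (y := fun=> x) (dy := fun=> fun=> 0) _ _ _ _) _.
- by move=> r n; exact: is_cderive_cst.
- move=> r; have [N [w [wN xw]]] := xt; exists N, w; split=> // s _; split=> //.
  by move=> n; rewrite normc0 (moderate_ge0 n wN).
- by rewrite (tame0 (bounded_prop lam bP t)) addr0.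
Qed.

(** The equation bounds the time derivative by the solution, up to the size of
    the diagonal part; this is where polynomial growth of lam is used. *)
Lemma prop_loc_dominated x t N w (lN : nat) : moderate N w -> bnd x w ->
  (forall k, `|lam k| <= jb k ^+ lN) ->
  loc_dominated (fun r => prop lam P r x)
    (fun r k => 'i%C * gen lam P (prop lam P r x) k) t.
Proof.
move=> wN xw lamN.
have [C C0 HC] := prop_bnd lam bP N (`|t| + 1).
have [K K0 PK] := bounded_bnd N bP.
have CwN := moderateZ C0 wN.
exists (N + (lN + N))%N, (fun k => C * w k + (1 + K) * jb k ^+ lN * (C * w k)).
have K1 : 0 <= 1 + K by rewrite addr_ge0.
split.
  apply: moderateD; first exact: moderate_le (leq_addr _ _) CwN.
  apply: moderate_le (leq_addl _ _) _.
  exact: moderate_gain K1 (moderate_jb lN) CwN.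
move=> r rt.
have pw := HC r (ler_norm_near rt) w x wN xw.
have p0 k : 0 <= C * w k := moderate_ge0 k CwN.
split=> k.
  by apply: le_trans (pw k) _; rewrite lerDl !mulr_ge0// ?jbX_ge0 ?(moderate_ge0 _ wN).
apply: le_trans (gen_bnd PK CwN pw k) _.
apply: (@le_trans _ _ ((1 + K) * jb k ^+ lN * (C * w k))); last by rewrite lerDr.
rewrite ler_wpM2r// mulrDl mul1r lerD// -[leLHS]mulr1 ler_wpM2l//.
by rewrite exprn_ege1// jb_ge1.
Qed.

Section Solutions.
Variable H : zoperator R.
Hypothesis HE : forall x, tempered x -> H x = gen lam P x.

(** Only continuity in l^2 needs an argument: the squared moduli of the
    differences are dominated by a summable sequence that does not depend on
    the time, by the uniformity in kernel_hsq_dominated. *)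
Lemma prop_is_solution x : in_hs 0 x -> is_solution H x (fun t => prop lam P t x).
Proof.
move=> xs; have xt := in_hs_tempered (lexx 0) xs.
have hs t : in_hs 0 (prop lam P t x).
  have [C C0 HC] := propker_le lam bP (0 + 2) `|t|.
  have := kernel_hnorm_le (N := 0) (lexx 0) (lexx 0) C0 (HC t (lexx _)) xs.
  move=> /le_lt_trans; apply; move: xs; rewrite /in_hs/=.
  have := hnorm_ge0 0 x; case: (hnorm 0 x) => [c||]//= _ _.
  by rewrite -EFinM ltry.
split=> //.
- exact: prop0.
- move=> t; have [C C0 HC] := propker_le lam bP (0 + 2) (`|t| + 1).
  have [c _ [c0 xc]] := in_hsP xs.
  have CC0 : 0 <= C + C by rewrite addr_ge0.
  have [b bc Hb] := kernel_hsq_dominated (N := 0) (lexx 0) (lexx 0) CC0 xc.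
  have diff r : (fun k => prop lam P r x k - prop lam P t x k) =
      matact (fun m n => propker lam P r m n - propker lam P t m n) x.
    apply/funext => m; rewrite /prop /matact.
    have kd s : zdom (fun n => propker lam P s m n * x n).
      apply: kbound_zdom (kbound_propker lam bP s) xt.
      by exists 0%N; exact: moderate_cst.
    rewrite -mulN1r -zsumZ// -zsumD//; last exact: zdomZ.
    by congr zsum; apply/funext => n; rewrite mulN1r mulrBl.
  have near1 : \forall r \near t, `|r - t| <= 1.
    near=> r; rewrite distrC; near: r.
    by apply: cvgr_dist_le => //; exact: cvg_id.
  have hb r k : `|r - t| <= 1 ->
      hsq 0 (fun k => prop lam P r x k - prop lam P t x k) k <= b k.
    move=> rt; rewrite diff; apply: Hb => n; rewrite mulrDl.
    apply: le_trans (normcB _ _) _; by apply: lerD; apply: HC; [exact: ler_norm_near|rewrite lerDl].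
  apply: (hnorm_cvg0 bc).
  + by apply: filterS near1 => r rt k; exact: hb.
  + move=> k; apply: le_trans (hb t k _); first exact: hsq_ge0.
    by rewrite subrr normr0.
  + move=> k; apply/ccvg_sub; exact: is_cderive_continuous (prop_cst_derive t k xt).
- move=> t k; rewrite HE; last exact: tame_tempered (bounded_prop lam bP t) xt.
  exact: prop_cst_derive.
Unshelve. all: by end_near. Qed.

(** Continuity in l^2 bounds all coordinates near each time, and compactness of
    a time interval makes the bound uniform. *)
Lemma solution_locally_bounded x u T : is_solution H x u ->
  exists2 B, 0 <= B & forall t, `|t| <= T -> bnd (u t) (fun=> B).
Proof.
move=> [u0 uh ucont ud].
have := @segment_compact R (- T) T.
move=> /compact_near_coveringP /(_ R +oo (fun B r => bnd (u r) (fun=> B)) _).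
move=> Hc; have [|B0 [_ HB]] := Hc _.
  move=> t _.
  have [c c0 uc] := in_hs_bnd (lexx 0) (uh t).
  near=> r B => /= k.
  have : (hnorm 0 (fun k => u r k - u t k)%R <= 1%:E)%E.
    near: r; have /fine_cvgP[] := ucont t.
    move=> fin /cvgrPdist_le /(_ 1 ltr01); apply: filterS2 fin => r fin /=.
    rewrite sub0r normrN ger0_norm; last by apply: fine_ge0; exact: hnorm_ge0.
    by move=> h1; rewrite -(fineK fin) lee_fin.
  move=> /(hnorm_le _ _ ler01) Hle.
  have : normc (u r k - u t k) <= 1.
    rewrite -ler_sqr ?nnegrE ?normc_ge0//.
    apply: le_trans (Hle `|k|%N); apply: le_trans (le_zpart_at (hsq_ge0 0 _) (leqnn _)).
    by rewrite /hsq mulr0 powRr0 mul1r.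
  move=> d1; have -> : u r k = (u r k - u t k) + u t k by ring.
  apply: le_trans (normcD _ _) _.
  apply: (@le_trans _ _ (1 + c)); first exact: lerD d1 (uc k).
  by near: B; apply: nbhs_pinfty_ge; exact: num_real.
exists (Num.max B0 0 + 1); first by rewrite addr_ge0// le_max lexx orbT.
move=> t tT; apply: HB.
  by rewrite (@le_lt_trans _ _ (Num.max B0 0)) ?ltrDl// le_max lexx.
by rewrite /= in_itv /= -ler_norml.
Unshelve. all: by end_near. Qed.

(** Gronwall for the difference of two solutions, with the weight 1. *)
Lemma solution_unique : exists2 tau, 0 < tau & forall x u v,
  is_solution H x u -> is_solution H x v -> forall t, `|t| <= tau -> u t = v t.
Proof.
have [K K0 PK] := bounded_bnd 0 bP.
exists (gronwall_time K); first exact: gronwall_time_gt0.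
move=> x u v us vs t tt.
have [Bu Bu0 uB] := solution_locally_bounded `|t| us.
have [Bv Bv0 vB] := solution_locally_bounded `|t| vs.
case: us => [u0 uh _ ud]; case: vs => [v0 vh _ vd].
have ut r : tempered (u r) := in_hs_tempered (lexx 0) (uh r).
have vt r : tempered (v r) := in_hs_tempered (lexx 0) (vh r).
have [_ K8] := gronwall_time_le K0 tt.
have PB r : P (fun k => u r k - v r k) = fun k => P (u r) k - P (v r) k.
  exact: tameB_seq bP (ut r) (vt r).
apply/funext => k; apply/eqP; rewrite -subr_eq0 -normc_eq0 eq_le normc_ge0 andbT.
have -> : 0 = 4 * 0 * `|t| * 1 :> R by rewrite mulr0 !mul0r.
apply: (gronwall (lam := lam) (y := fun r k => u r k - v r k)
  (src := fun=> fun=> 0) PK K0 (moderate_cst 0 (@ler01 R)) (lexx 0) (normr_ge0 t) K8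
  _ _ _ _ (lexx _)).
- move=> r n; apply: is_cderive_eq (is_cderiveB (ud r n) (vd r n)) _.
  by rewrite !HE// /gen PB; ring.
- by move=> n; rewrite u0 v0 subrr.
- by move=> r _ n; rewrite normc0 mul0r.
- exists (Bu + Bv); first exact: addr_ge0.
  move=> r rT n; rewrite mulr1; apply: le_trans (normcB _ _) _.
  by apply: lerD; [exact: uB|exact: vB].
Qed.

(** The flow is the value of the solution, which exists and is unique on a
    short time interval. *)
Lemma flowE : exists2 tau, 0 < tau & forall t, `|t| < tau -> forall x, in_hs 0 x ->
  flow H t x = prop lam P t x.
Proof.
have [tau tau0 uniq] := solution_unique; exists tau => // t tt x xs.
have sol := prop_is_solution xs.
have fs : is_solution H x (xget (fun _ _ => 0) [set u | is_solution H x u]).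
  exact: (@xgetPex _ (fun _ _ => 0) [set u | is_solution H x u] (ex_intro _ _ sol)).
exact: uniq fs sol t (ltW tt).
Qed.

End Solutions.

End TermwiseDerivative.

(** * Lie splitting *)

Section LieSplitting.
Context {R : realType}.
Variable V : R -> R.
Hypotheses (V_torus : torus_fun V) (V_smooth : smooth V).
Implicit Types (k m n p : int) (N : nat) (w : int -> R) (x y z : zseq R).
Implicit Types (T : zoperator R) (C K B b s r t tau : R).

Let bZ : bounded_op (opZ V) := bounded_opZ V_torus V_smooth.
Let bB : bounded_op (opB V) := bounded_opB V_torus V_smooth.
Let bE : bounded_op (expiX V) := bounded_expiX V_torus V_smooth.
Let bE' : bounded_op (expNiX V) := bounded_expNiX V_torus V_smooth.
Let tR := tame_opR V_torus V_smooth.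

Lemma tame_jbV_bounded T : tame (fun k => (jb k)^-1) T -> bounded_op T.
Proof.
move=> tT; apply: tame_le ler01 _ _ tT; first by exists 0%N; exact: moderate_cst.
by move=> k; rewrite mul1r; have := @jbV_le1 R k 1.
Qed.

Let bR : bounded_op (opR V) := tame_jbV_bounded tR.

Definition lamA k : R := (`|k| ^+ 2)%:~R.

Lemma lamA_le k : `|lamA k| <= jb k ^+ 2.
Proof. by rewrite ger0_norm ?sqr_le_jb// ler0z exprn_ge0. Qed.

Lemma opA_lamA x k : opA x k = (lamA k)%:C * x k.
Proof. by rewrite opAE /lamA rmorph_int. Qed.

Let ZR : zoperator R := fun x k => opZ V x k + opR V x k.
Let bZR : bounded_op ZR := tameD bZ bR.

Let SF := prop lamA (opZ V).
Let SR := prop (fun=> 0 : R) (opR V).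
Let S := prop lamA ZR.
Let SAB := prop lamA (opB V).

(** The commutator of A + Z with R. *)
Let comm_FR : zoperator R := fun x k =>
  commA (opR V) x k + (opZ V (opR V x) k - opR V (opZ V x) k).

Let bounded_comm_FR : bounded_op comm_FR.
Proof.
apply: tameD.
  have := tame_commA tR; apply: tame_le ler01 _ _.
    by exists 0%N; exact: moderate_cst.
  by move=> k; rewrite mul1r mulfV// gt_eqF// jb_gt0.
apply: tameB; exact: bounded_comp.
Qed.

Let genFE x : gen lamA (opZ V) x = fun k => opA x k + opZ V x k.
Proof. by apply/funext => k; rewrite /gen opA_lamA. Qed.

Let gen_tempered P x : bounded_op P -> tempered x -> tempered (gen lamA P x).
Proof.
move=> bP xt; rewrite (_ : gen lamA P x = fun k => opA x k + P x k).
  apply: temperedD; first exact: tame_tempered tame_opA xt.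
  exact: tame_tempered bP xt.
by apply/funext => k; rewrite /gen opA_lamA.
Qed.

Let prop_ld P x t : bounded_op P -> tempered x -> loc_dominated
  (fun r => prop lamA P r x) (fun r k => 'i%C * gen lamA P (prop lamA P r x) k) t.
Proof. move=> bP [N [w [wN xw]]]. exact (prop_loc_dominated bP t wN xw lamA_le). Qed.

(** SF_t R z - R SF_t z vanishes at 0 and solves the equation of A + Z with source
    i [A + Z, R] SF_t z, which is bounded. *)
Lemma commutator_estimate N : exists2 C, 0 <= C & exists2 tau, 0 < tau &
  forall t w z, `|t| <= tau -> moderate N w -> bnd z w ->
    bnd (fun k => SF t (opR V z) k - opR V (SF t z) k) (fun k => C * `|t| * w k).
Proof.
have [KZ KZ0 HKZ] := bounded_bnd N bZ.
have [KR KR0 HKR] := bounded_bnd N bR.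
have [KD KD0 HKD] := bounded_bnd N bounded_comm_FR.
have [CF CF0 HCF] := prop_bnd lamA bZ N 1.
exists (4 * (KD * CF)); first by rewrite !mulr_ge0.
exists (gronwall_time KZ); first exact: gronwall_time_gt0.
move=> t w z tt wN zw.
have [t1 tK] := gronwall_time_le KZ0 tt.
have zt := temperedP wN zw.
have Rzt := tame_tempered bR zt.
have SFt r x : tempered x -> tempered (SF r x).
  exact: tame_tempered (bounded_prop lamA bZ r).
pose y r k := SF r (opR V z) k - opR V (SF r z) k.
pose src r k := 'i%C * comm_FR (SF r z) k.
apply: (gronwall (lam := lamA) (y := y) (src := src) HKZ KZ0 wN _ _ tK _ _ _ _ (lexx _)).
- exact: mulr_ge0.
- exact: normr_ge0.
- move=> r k.
  have dR := tame_derive r k bR (fun r n => prop_cst_derive lamA bZ r n zt)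
    (fun r => prop_ld r bZ zt).
  apply: is_cderive_eq (is_cderiveB (prop_cst_derive lamA bZ r k Rzt) dR) _.
  have gt := gen_tempered bZ (SFt r z zt).
  have yE : opZ V (y r) k = opZ V (SF r (opR V z)) k - opZ V (opR V (SF r z)) k.
    by rewrite (tameB_seq bZ (SFt r _ Rzt))//; exact: tame_tempered bR (SFt r z zt).
  have SFz := SFt r z zt.
  have RgE : opR V (gen lamA (opZ V) (SF r z)) k =
      opR V (opA (SF r z)) k + opR V (opZ V (SF r z)) k.
    rewrite genFE (tameD_seq bR)//; first exact: tame_tempered tame_opA SFz.
    exact: tame_tempered bZ SFz.
  rewrite (tameZ_seq _ bR gt) RgE.
  rewrite [in RHS]/gen yE /src /comm_FR /commA /y !opA_lamA /gen -/(SF r).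
  move: (opZ V (SF r (opR V z)) k) (opZ V (opR V (SF r z)) k)
    (opR V (opA (SF r z)) k) (opR V (opZ V (SF r z)) k)
    (SF r (opR V z) k) (opR V (SF r z) k) => *.
  by ring.
- by move=> k; rewrite /y /SF !(prop0 lamA bZ) subrr.
- move=> r rt k; rewrite normcM normc_i mul1r -mulrA.
  have CwN := moderateZ CF0 wN.
  exact: HKD CwN (HCF r (le_trans rt t1) w z wN zw) k.
- exists (CF * KR + KR * CF); first by rewrite addr_ge0// mulr_ge0.
  move=> r rt k; apply: le_trans (normcB _ _) _; rewrite mulrDl lerD// -mulrA.
  + exact: HCF (le_trans rt t1) _ _ (moderateZ KR0 wN) (HKR _ _ wN zw) k.
  + exact: HKR (moderateZ CF0 wN) (HCF r (le_trans rt t1) w z wN zw) k.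
Qed.

(** S_t z - SF_t SR_t z vanishes at 0 and solves the equation of A + Z + R with
    source - i (SF_t R - R SF_t) SR_t z, which is O(t). *)
Lemma lie_local_error N : exists2 C, 0 <= C & exists2 tau, 0 < tau &
  forall t w z, `|t| <= tau -> moderate N w -> bnd z w ->
    bnd (fun k => S t z k - SF t (SR t z) k) (fun k => C * t ^+ 2 * w k).
Proof.
have [C C0 [tau1 tau10 HC]] := commutator_estimate N.
have [K K0 HK] := bounded_bnd N bZR.
have [CF CF0 HCF] := prop_bnd lamA bZ N 1.
have [CR CR0 HCR] := prop_bnd (fun=> 0 : R) bR N 1.
have [CS CS0 HCS] := prop_bnd lamA bZR N 1.
exists (4 * (C * CR)); first by rewrite !mulr_ge0.
exists (Num.min tau1 (gronwall_time K)).
  by rewrite lt_min tau10 gronwall_time_gt0.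
move=> t w z; rewrite le_min => /andP[ttau tt] wN zw.
have [t1 tK] := gronwall_time_le K0 tt.
have zt := temperedP wN zw.
have SFt r x : tempered x -> tempered (SF r x).
  exact: tame_tempered (bounded_prop lamA bZ r).
have SRt r : tempered (SR r z).
  exact: tame_tempered (bounded_prop (fun=> 0 : R) bR r) zt.
have St r : tempered (S r z).
  exact: tame_tempered (bounded_prop lamA bZR r) zt.
have SRw r : `|r| <= `|t| -> bnd (SR r z) (fun k => CR * w k).
  by move=> rt; exact: HCR (le_trans rt t1) _ _ wN zw.
have CRN := moderateZ CR0 wN.
pose y r k := S r z k - SF r (SR r z) k.
pose src r k := - 'i%C * (SF r (opR V (SR r z)) k - opR V (SF r (SR r z)) k).
have -> : (fun k => 4 * (C * CR) * t ^+ 2 * w k) =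
    (fun k => 4 * (C * CR * `|t|) * `|t| * w k).
  apply/funext => k; rewrite -(real_normK (num_real t)) expr2; ring.
apply: (gronwall (lam := lamA) (y := y) (src := src) HK K0 wN _ _ tK _ _ _ _ (lexx _)).
- by rewrite !mulr_ge0.
- exact: normr_ge0.
- move=> r k.
  have dSR := prop_cst_derive (fun=> 0 : R) bR _ _ zt.
  have ldSR r' := prop_loc_dominated bR r' (lN := 0) wN zw
    (fun k => (_ : `|0 : R| <= jb k ^+ 0)).
  have dSF := prop_derive lamA bZ r k (fun r n => dSR r n) _.
  apply: is_cderive_eq (is_cderiveB (prop_cst_derive lamA bZR r k zt) (dSF _)) _.
    by move=> r'; apply: ldSR => // n; rewrite normr0 expr0.
  have g0 : gen (fun=> 0 : R) (opR V) (SR r z) = opR V (SR r z).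
    by apply/funext => n; rewrite /gen mul0r add0r.
  have RSR := tame_tempered bR (SRt r).
  rewrite -/(SR r) g0 (tameZ_seq _ (bounded_prop lamA bZ r) RSR).
  have yE : ZR (y r) k = ZR (S r z) k - ZR (SF r (SR r z)) k.
    by rewrite (tameB_seq bZR (St r) (SFt r _ (SRt r))).
  rewrite [in RHS]/gen yE /src /y /gen -/(SF r) -/(S r) /ZR.
  move: (opZ V (S r z) k) (opR V (S r z) k) (opZ V (SF r (SR r z)) k)
    (opR V (SF r (SR r z)) k) (SF r (opR V (SR r z)) k) (S r z k)
    (SF r (SR r z) k) => *.
  by ring.
- by move=> k; rewrite /y /S /SF /SR (prop0 lamA bZR) (prop0 _ bR) (prop0 lamA bZ) subrr.
- move=> r rt k; rewrite normcM normc_opp normc_i mul1r.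
  apply: le_trans (HC r _ _ (le_trans rt ttau) CRN (SRw r rt) k) _.
  have -> : C * CR * `|t| * w k = C * `|t| * (CR * w k) by ring.
  by rewrite ler_wpM2r ?(moderate_ge0 _ CRN)// ler_wpM2l.
- exists (CS + CF * CR); first by rewrite addr_ge0// mulr_ge0.
  move=> r rt k; apply: le_trans (normcB _ _) _; rewrite mulrDl lerD//.
    exact: HCS (le_trans rt t1) _ _ wN zw k.
  by rewrite -mulrA; exact: HCF (le_trans rt t1) _ _ CRN (SRw r rt) k.
Qed.

(** A + Z + R = exp(iX)(A + B)exp(-iX) by definition of R. *)
Lemma conjugated_generator z : tempered z ->
  expNiX V (gen lamA ZR z) = gen lamA (opB V) (expNiX V z).
Proof.
move=> zt; have ez := tame_tempered bE' zt.
rewrite (_ : gen lamA ZR z =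
    expiX V (fun k => opA (expNiX V z) k + opB V (expNiX V z) k)); last first.
  apply/funext => k; rewrite /gen /ZR -opA_lamA.
  have -> : opR V z k = expiX V (fun k => opA (expNiX V z) k + opB V (expNiX V z) k) k
    - (opA z k + opZ V z k) by [].
  ring.
rewrite (expiXK V_torus V_smooth); last first.
  by apply: temperedD; [exact: tame_tempered tame_opA ez|exact: tame_tempered bB ez].
by apply/funext => k; rewrite /gen opA_lamA.
Qed.

(** Both sides solve the equation of A + B with the same initial value. *)
Lemma conjugated_flow N : exists2 tau, 0 < tau & forall t w x, `|t| <= tau ->
  moderate N w -> bnd x w -> SAB t x = expNiX V (S t (expiX V x)).
Proof.
have [K K0 HK] := bounded_bnd N bB.
have [CE CE0 HCE] := bounded_bnd N bE.
have [CE' CE'0 HCE'] := bounded_bnd N bE'.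
exists (gronwall_time K); first exact: gronwall_time_gt0.
move=> t w x tt wN xw.
have [_ tK] := gronwall_time_le K0 tt.
have [CB CB0 HCB] := prop_bnd lamA bB N `|t|.
have [CS CS0 HCS] := prop_bnd lamA bZR N `|t|.
have xt := temperedP wN xw.
have Ext := tame_tempered bE xt.
have St r : tempered (S r (expiX V x)).
  exact: tame_tempered (bounded_prop lamA bZR r) Ext.
have SABt r : tempered (SAB r x).
  exact: tame_tempered (bounded_prop lamA bB r) xt.
pose y r k := SAB r x k - expNiX V (S r (expiX V x)) k.
suff H : bnd (y t) (fun k => 4 * 0 * `|t| * w k).
  apply/funext => k; apply/eqP; rewrite -subr_eq0 -normc_eq0 eq_le normc_ge0 andbT.
  by have := H k; rewrite mulr0 !mul0r.
apply: (gronwall (lam := lamA) (y := y) (src := fun=> fun=> 0) HK K0 wN (lexx _)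
  _ tK _ _ _ _ (lexx _)).
- exact: normr_ge0.
- move=> r k.
  have dE := tame_derive r k bE' (fun r n => prop_cst_derive lamA bZR r n Ext)
    (fun r => prop_ld r bZR Ext).
  apply: is_cderive_eq (is_cderiveB (prop_cst_derive lamA bB r k xt) dE) _.
  have gt := gen_tempered bZR (St r).
  have yE : opB V (y r) k = opB V (SAB r x) k - opB V (expNiX V (S r (expiX V x))) k.
    by rewrite (tameB_seq bB (SABt r))//; exact: tame_tempered bE' (St r).
  rewrite (tameZ_seq _ bE' gt) (conjugated_generator (St r)).
  rewrite [in RHS]/gen yE /y /gen -/(SAB r).
  by ring.
- by move=> k; rewrite /y /SAB /S (prop0 lamA bB) (prop0 lamA bZR)
    (expiXK V_torus V_smooth xt) subrr.
- by move=> r _ k; rewrite normc0 mul0r.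
- exists (CB + CE' * (CS * CE)); first by rewrite addr_ge0// !mulr_ge0.
  move=> r rt k; apply: le_trans (normcB _ _) _; rewrite mulrDl lerD//.
    exact: HCB rt _ _ wN xw k.
  have EN := moderateZ CE0 wN.
  rewrite -!mulrA; apply: (HCE' _ _ (moderateZ CS0 EN)).
  exact: HCS rt _ _ EN (HCE _ _ wN xw).
Qed.

Lemma operator_hnorm_le T N C s x : bounded_op T -> 0 <= C -> 0 <= s -> s <= N%:R ->
  (forall m n, normc (T (zdelta n) m) <= C * jb (m - n) ^- (N + 2)) -> in_hs s x ->
  (hnorm s (T x) <= (4 * C)%:E * hnorm s x)%E.
Proof.
move=> bT C0 s0 sN HC xs.
rewrite (_ : T x = matact (fun m n => T (zdelta n) m) x).
  exact: kernel_hnorm_le s0 sN C0 HC xs.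
by apply/funext => m; exact: tame_kernel bT (in_hs_tempered s0 xs).
Qed.

Lemma exists_nat_ge s : exists N, s <= N%:R.
Proof.
exists (Num.bound `|s|); apply: le_trans (ler_norm s) _.
exact/ltW/archi_boundP/normr_ge0.
Qed.

Lemma bounded_op_hnorm_le T s : bounded_op T -> 0 <= s -> exists2 C, 0 <= C &
  forall x, in_hs s x -> (hnorm s (T x) <= C%:E * hnorm s x)%E.
Proof.
move=> bT s0; have [N sN] := exists_nat_ge s.
have [C C0 HC] := tame_kbound bT (N + 2)%N.
exists (4 * C) => [|x xs]; first by rewrite mulr_ge0.
by apply: operator_hnorm_le sN _ xs => // m n; have := HC m n; rewrite mulr1.
Qed.

Lemma in_hs_hnorm_le C s x y : in_hs s x -> (hnorm s y <= C%:E * hnorm s x)%E ->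
  in_hs s y.
Proof.
move=> /in_hsP[c cE _] yx; rewrite /in_hs/=; apply: le_lt_trans yx _.
by rewrite cE -EFinM ltry.
Qed.

(** The error operator is estimated on basis vectors with the weights
    <k - n>^-(N+2), that is, on its entries. *)
Lemma lie_error_hnorm s : 0 <= s -> exists2 C, 0 <= C & exists2 tau, 0 < tau &
  forall t x, `|t| <= tau -> in_hs s x ->
  (hnorm s (fun k => (S t x k - SF t (SR t x) k)%R) <= (C * t ^+ 2)%:E * hnorm s x)%E.
Proof.
move=> s0; have [N sN] := exists_nat_ge s.
have [C C0 [tau tau0 HC]] := lie_local_error (N + 2).
exists (4 * C); first by rewrite mulr_ge0.
exists tau => // t x tt xs.
have bT : bounded_op (fun x k => S t x k - SF t (SR t x) k).
  apply: tameB; first exact: bounded_prop.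
  apply: bounded_comp; exact: bounded_prop.
rewrite -mulrA; apply: (operator_hnorm_le bT _ s0 sN _ xs).
  by rewrite mulr_ge0// sqr_ge0.
move=> m n; exact: HC tt (moderate_jbV _ n) (bnd_zdelta _ n) m.
Qed.

Let HfullE x : (opA + opZ V + opR V)%R x = gen lamA ZR x.
Proof.
by apply/funext => k; rewrite /gen /ZR -opA_lamA; exact/esym/addrA.
Qed.

Let HFE x : (opA + opZ V)%R x = gen lamA (opZ V) x.
Proof. by apply/funext => k; rewrite /gen -opA_lamA. Qed.

Let HABE x : (opA + opB V)%R x = gen lamA (opB V) x.
Proof. by apply/funext => k; rewrite /gen -opA_lamA. Qed.

Let HRE x : opR V x = gen (fun=> 0 : R) (opR V) x.
Proof. by apply/funext => k; rewrite /gen mul0r add0r. Qed.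

Lemma split_flowE s : 0 <= s -> exists2 tau, 0 < tau & forall t x, `|t| < tau ->
  in_hs s x -> flow (opA + opZ V)%R t (flow (opR V) t x) = SF t (SR t x).
Proof.
move=> s0.
have [tau1 tau10 H1] := flowE bZ (fun x _ => HFE x).
have [tau2 tau20 H2] := flowE bR (fun x _ => HRE x).
exists (Num.min tau1 tau2); first by rewrite lt_min tau10.
move=> t x; rewrite lt_min => /andP[t1 t2] xs.
have x0 := in_hs0 s0 xs.
rewrite (H2 t t2 x x0) H1//.
have [C C0 HC] := bounded_op_hnorm_le (bounded_prop (fun=> 0 : R) bR t) (lexx 0).
exact: in_hs_hnorm_le x0 (HC x x0).
Qed.

Lemma transformed_lie_error s : 0 <= s ->
  exists C, exists2 tau0, 0 < tau0 & forall tau, `|tau| < tau0 ->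
    forall x, in_hs s x ->
    (hnorm s (flow (opA + opZ V + opR V)%R tau x -
              flow (opA + opZ V)%R tau (flow (opR V) tau x))%R
      <= (C * tau ^+ 2)%:E * hnorm s x)%E.
Proof.
move=> s0.
have [C C0 [tau1 tau10 HC]] := lie_error_hnorm s0.
have [tau2 tau20 H2] := flowE bZR (fun x _ => HfullE x).
have [tau3 tau30 H3] := split_flowE s0.
exists C, (Num.min tau1 (Num.min tau2 tau3)); first by rewrite !lt_min tau10 tau20.
move=> tau; rewrite !lt_min => /and3P[t1 t2 t3] x xs.
by rewrite (H2 tau t2 x (in_hs0 s0 xs)) (H3 tau x t3 xs); exact: HC (ltW t1) xs.
Qed.

Lemma schrodinger_lie_error s : 0 <= s ->
  exists C, exists2 tau0, 0 < tau0 & forall tau, `|tau| < tau0 ->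
    forall x, in_hs s x ->
    (hnorm s (flow (opA + opB V)%R tau x -
              expNiX V (flow (opA + opZ V)%R tau (flow (opR V) tau (expiX V x))))%R
      <= (C * tau ^+ 2)%:E * hnorm s x)%E.
Proof.
move=> s0.
have [C C0 [tau1 tau10 HC]] := lie_error_hnorm s0.
have [tau2 tau20 H2] := flowE bB (fun x _ => HABE x).
have [tau3 tau30 H3] := split_flowE s0.
have [tau4 tau40 H4] := conjugated_flow 0.
have [CE CE0 HCE] := bounded_op_hnorm_le bE s0.
have [CE' CE'0 HCE'] := bounded_op_hnorm_le bE' s0.
exists (CE' * (C * CE)), (Num.min (Num.min tau1 tau2) (Num.min tau3 tau4)).
  by rewrite !lt_min tau10 tau20 tau30.
move=> t; rewrite !lt_min => /andP[/andP[t1 t2] /andP[t3 t4]] x xs.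
have Exs := in_hs_hnorm_le xs (HCE x xs).
have Ext := in_hs_tempered s0 Exs.
rewrite (H2 t t2 x (in_hs0 s0 xs)) (H3 t _ t3 Exs).
have [c c0 xc] := in_hs_bnd s0 xs.
rewrite -/(SAB t x) (H4 t _ x (ltW t4) (moderate_cst 0 c0) xc).
have St : tempered (S t (expiX V x)).
  exact: tame_tempered (bounded_prop lamA bZR t) Ext.
have SFt : tempered (SF t (SR t (expiX V x))).
  apply: tame_tempered (bounded_prop lamA bZ t) _.
  exact: tame_tempered (bounded_prop (fun=> 0 : R) bR t) Ext.
have -> : (expNiX V (S t (expiX V x)) - expNiX V (SF t (SR t (expiX V x))))%R =
    expNiX V (fun k => S t (expiX V x) k - SF t (SR t (expiX V x)) k).
  by rewrite (tameB_seq bE' St SFt).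
have err := HC t _ (ltW t1) Exs.
have Ct : 0 <= C * t ^+ 2 by rewrite mulr_ge0// sqr_ge0.
apply: le_trans (HCE' _ (in_hs_hnorm_le Exs err)) _.
have [d dE _] := in_hsP xs.
have [e eE _] := in_hsP Exs.
have := HCE x xs; rewrite eE dE -EFinM lee_fin => ed.
rewrite eE in err.
apply: (@le_trans _ _ (CE'%:E * ((C * t ^+ 2) * e)%:E)%E).
  by apply: lee_wpmul2l; [rewrite lee_fin|rewrite EFinM].
rewrite -!EFinM lee_fin.
have -> : CE' * (C * CE) * t ^+ 2 * d = CE' * (C * t ^+ 2 * (CE * d)) by ring.
by rewrite !ler_wpM2l.
Qed.

End LieSplitting.

Theorem proposition4p9 (R : realType) (V : R -> R)
    (V_torus : torus_fun V) (V_smooth : smooth V) :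
  (forall s : R, 0 <= s ->
     exists C : R, exists2 tau0 : R, 0 < tau0 &
       forall tau : R, `|tau| < tau0 -> forall x : zseq R, in_hs s x ->
         (hnorm s (flow (opA + opZ V + opR V)%R tau x -
                   flow (opA + opZ V)%R tau (flow (opR V) tau x))%R
          <= (C * tau ^+ 2)%:E * hnorm s x)%E) /\
  (forall s : R, 0 <= s ->
     exists C : R, exists2 tau0 : R, 0 < tau0 &
       forall tau : R, `|tau| < tau0 -> forall x : zseq R, in_hs s x ->
         (hnorm s (flow (opA + opB V)%R tau x -
                   expNiX V (flow (opA + opZ V)%R tau
                               (flow (opR V) tau (expiX V x))))%R
          <= (C * tau ^+ 2)%:E * hnorm s x)%E).
Proof.
split=> s s0; first exact: transformed_lie_error.
exact: schrodinger_lie_error.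
Qed.
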